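(* Let $(\Lambda_t)_{t\ge0}$ be a family of CPTP maps on $d\times d$ density matrices ($d\ge2$ finite), with $\Lambda_0=\mathrm{id}$ and $t\mapsto\Lambda_t$ differentiable, which is non-Markovian. Suppose either (i) every $\Lambda_t$ is invertible as a linear map on $d\times d$ matrices, or (ii) $d=2$ (in which case invertibility is not required). Then there exist finite-dimensional systems $B$ and $C$ and a state $\rho^{ABC}$ on $\mathbb{C}^d\otimes\mathcal H_B\otimes\mathcal H_C$ such that for some $t>0$ $$\frac{\mathrm d}{\mathrm dt}E^{AB|C}\big((\Lambda_t^A\otimes\mathrm{id}^{BC})[\rho^{ABC}]\big)>0$$ (understood as the right derivative), so that the negativity $E^{AB|C}$ of the evolved state strictly increases at some time.
   Context: Negativity of a bipartite operator $X$ on $\mathcal H_{X_1}\otimes\mathcal H_{X_2}$ with respect to the cut $X_1|X_2$ is $E^{X_1|X_2}(X)=\frac{\|X^{T_{X_2}}\|_1-1}{2}$, where $T_{X_2}$ is the partial transpose on $X_2$ and $\|M\|_1=\mathrm{Tr}\sqrt{M^\dagger M}$. Here $E^{AB|C}$ treats $AB$ as one party and $C$ as the other. An evolution $(\Lambda_t)$ is Markovian (CP-divisible) if for every $0\le s\le t$ there is a CPTP map $V_{t,s}$ with $\Lambda_t=V_{t,s}\circ\Lambda_s$; otherwise it is non-Markovian. $\Lambda_t^A\otimes\mathrm{id}^{BC}$ means $\Lambda_t$ acting on the system $A=\mathbb{C}^d$ only. *)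

(* Defs.v *)
From Stdlib Require Import Reals Lra Lia Arith ClassicalEpsilon.
Open Scope R_scope.

Record C := mkC { re : R ; im : R }.
Definition C0 : C := mkC 0 0.
Definition C1 : C := mkC 1 0.
Definition Cadd (x y : C) : C := mkC (re x + re y) (im x + im y).
Definition Cmul (x y : C) : C :=
  mkC (re x * re y - im x * im y) (re x * im y + im x * re y).
Definition Cconj (x : C) : C := mkC (re x) (- im x).

Fixpoint Csum (n : nat) (f : nat -> C) : C :=
  match n with O => C0 | S m => Cadd (Csum m f) (f m) end.

(** * Matrices: an n x n matrix is a function nat -> nat -> C, of which only
    the entries with indices < n are meaningful. *)
Definition Mat := nat -> nat -> C.

Definition meq (n : nat) (A B : Mat) : Prop :=
  forall i j, (i < n)%nat -> (j < n)%nat -> A i j = B i j.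

Definition madd (A B : Mat) : Mat := fun i j => Cadd (A i j) (B i j).
Definition mscale (a : C) (A : Mat) : Mat := fun i j => Cmul a (A i j).
Definition mmul (n : nat) (A B : Mat) : Mat :=
  fun i j => Csum n (fun k => Cmul (A i k) (B k j)).
Definition madj (A : Mat) : Mat := fun i j => Cconj (A j i).
Definition mtrace (n : nat) (A : Mat) : C := Csum n (fun i => A i i).

Definition hermitian (n : nat) (A : Mat) : Prop :=
  forall i j, (i < n)%nat -> (j < n)%nat -> A i j = Cconj (A j i).

Definition psd (n : nat) (A : Mat) : Prop :=
  hermitian n A /\
  forall v : nat -> C,
    0 <= re (Csum n (fun i => Csum n (fun j => Cmul (Cmul (Cconj (v i)) (A i j)) (v j)))).

Definition density (n : nat) (rho : Mat) : Prop :=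
  psd n rho /\ mtrace n rho = C1.

(** square root of a PSD matrix: the PSD matrix S with S S = P
    (exists and is unique by the spectral theorem) *)
Definition msqrt (n : nat) (P : Mat) : Mat :=
  epsilon (inhabits (fun _ _ : nat => C0))
          (fun S => psd n S /\ meq n (mmul n S S) P).

Definition trace_norm (n : nat) (M : Mat) : R :=
  re (mtrace n (msqrt n (mmul n (madj M) M))).

(** * Tensor products.  On C^m (x) C^k the basis index of |a> (x) |b> is a*k+b. *)

Definition ptrans2 (k : nat) (X : Mat) : Mat :=
  fun i j => X ((i / k) * k + j mod k)%nat ((j / k) * k + i mod k)%nat.

(** Phi (x) id_k, for a map Phi on d x d matrices acting on the first factor
    of C^d (x) C^k *)
Definition Map := Mat -> Mat.
Definition liftA (k : nat) (Phi : Map) (X : Mat) : Mat :=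
  fun i j => Phi (fun a a' => X (a * k + i mod k)%nat (a' * k + j mod k)%nat)
                 (i / k)%nat (j / k)%nat.

Definition lin_map (d : nat) (Phi : Map) : Prop :=
  (forall X Y, meq d X Y -> meq d (Phi X) (Phi Y)) /\
  (forall (a : C) X Y, meq d (Phi (madd X (mscale a Y))) (madd (Phi X) (mscale a (Phi Y)))).

Definition trace_preserving (d : nat) (Phi : Map) : Prop :=
  forall X, mtrace d (Phi X) = mtrace d X.

Definition completely_positive (d : nat) (Phi : Map) : Prop :=
  forall k : nat, (1 <= k)%nat ->
    forall X, psd (d * k) X -> psd (d * k) (liftA k Phi X).

Definition CPTP (d : nat) (Phi : Map) : Prop :=
  lin_map d Phi /\ completely_positive d Phi /\ trace_preserving d Phi.

Definition invertible_map (d : nat) (Phi : Map) : Prop :=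
  exists G : Map, lin_map d G /\
    (forall X, meq d (G (Phi X)) X) /\ (forall X, meq d (Phi (G X)) X).

Definition markovian (d : nat) (Lam : R -> Map) : Prop :=
  forall s t, 0 <= s -> s <= t ->
    exists V : Map, CPTP d V /\ forall X, meq d (Lam t X) (V (Lam s X)).

Definition right_deriv (f : R -> R) (t l : R) : Prop :=
  forall eps, 0 < eps -> exists delta, 0 < delta /\
    forall h, 0 < h < delta -> Rabs ((f (t + h) - f t) / h - l) < eps.

Definition differentiable_family (d : nat) (Lam : R -> Map) : Prop :=
  forall X i j, (i < d)%nat -> (j < d)%nat ->
    (forall t, 0 < t ->
       (exists l, derivable_pt_lim (fun s => re (Lam s X i j)) t l) /\
       (exists l, derivable_pt_lim (fun s => im (Lam s X i j)) t l)) /\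
    (exists l1, right_deriv (fun s => re (Lam s X i j)) 0 l1) /\
    (exists l2, right_deriv (fun s => im (Lam s X i j)) 0 l2).

Definition negativity (n k : nat) (X : Mat) : R :=
  (trace_norm n (ptrans2 k X) - 1) / 2.

(* Main.v *)
(** Let [P], [N] be positive operators on [A (x) B'] of total trace [1], and let
    [F = P - N].  For [rho = P (x) |Phi+><Phi+| + N (x) |Phi-><Phi-|], with Bell
    states shared between a further qubit of Bob and the qubit [C], the partial
    transpose over [C] has trace norm [1 + ||F||_1], so the negativity of the
    evolved state is [||(Lambda_t (x) id) F||_1 / 2].  If it never increases,
    then [||(Lambda_t (x) id) F||_1 <= ||(Lambda_s (x) id) F||_1] for [s <= t],
    every ancilla and every hermitian [F].

    Hence [Lambda_s X |-> Lambda_t X] is well defined on the image of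
    [Lambda_s] and completely positive there; this settles the case where
    [Lambda_s] is onto.  For a qubit the image may be smaller, and the map has
    to be extended to a CPTP map on all 2 x 2 matrices:
    - dimension 1: compose the trace with a fixed state;
    - dimension 2: the image is spanned by two pure states, and contractivity
      without ancilla says that their fidelity does not decrease (Alberti and
      Uhlmann);
    - dimension 3: the image is spanned by [u0 u0^* + u1 u1^*], [u0 u1^*] and
      [u1 u0^*] for a basis [u0], [u1].  If [P] and [X] are the images of the
      first two, one needs [Q] with [[Q, X], [X^*, P - Q]] >= 0 and
      [tr Q = |u0|^2].  The iterated Schur complements of the block Toeplitz
      operator with symbol [P + z X + z^-1 X^*] increase to a solution [Q], and
      contractivity for an ancilla carrying the Toeplitz structure bounds
      their traces by [|u0|^2].  Exchanging [u0] and [u1] gives a solution with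
      [tr Q >= |u0|^2]; interpolate. *)
Require Import Defs.
From Stdlib Require Import Reals Lra Lia Arith ClassicalEpsilon.
Open Scope R_scope.

(** * One-sided derivatives *)

(** Complete positivity comes from a case of equality: a hermitian operator whose trace norm does
    not exceed its trace is positive, so between trace-preserving maps contractivity implies
    positivity.

    Denying the conclusion only forbids positive right derivatives; it provides no derivative.
    Existence is proved first, from convexity of the trace norm along tangent lines, and
    monotonicity is then read off from the sign.

    For a qubit with an image of dimension 2 or 3 the extension is sought through its Choi operator
    in a basis adapted to the image: some blocks are prescribed, the others must complete a positive
    operator with the right partial traces. Such a basis exists because the image of the maximally
    mixed state is then invertible, and the line through it in a traceless direction of the image
    meets two pure states, of vectors al and be. In dimension 3 the phase of be can be chosen so
    that the third generator is al be^* + be al^*. These are the real symmetric matrices up to a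
    change of basis, and al + i be, al - i be turn them into 2 x 2 Toeplitz matrices; hence the
    Toeplitz ancilla. *)

Definition lim0 (e : R -> R) := forall eps, 0 < eps -> exists delta, 0 < delta /\
  forall h, 0 < h < delta -> Rabs (e h) < eps.

Lemma lim0_add e1 e2 : lim0 e1 -> lim0 e2 -> lim0 (fun h => e1 h + e2 h).
Proof.
  intros H1 H2 eps He.
  destruct (H1 (eps / 2)) as [d1 [p1 q1]]; [lra|].
  destruct (H2 (eps / 2)) as [d2 [p2 q2]]; [lra|].
  exists (Rmin d1 d2); split; [now apply Rmin_glb_lt|].
  intros h [h0 hd].
  assert (hd1 := Rlt_le_trans _ _ _ hd (Rmin_l d1 d2)).
  assert (hd2 := Rlt_le_trans _ _ _ hd (Rmin_r d1 d2)).
  specialize (q1 h (conj h0 hd1)); specialize (q2 h (conj h0 hd2)).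
  assert (T := Rabs_triang (e1 h) (e2 h)); lra.
Qed.

Lemma lim0_scale c e : lim0 e -> lim0 (fun h => c * e h).
Proof.
  intros H eps He.
  assert (P : 0 < Rabs c + 1) by (assert (Q := Rabs_pos c); lra).
  destruct (H (eps / (Rabs c + 1))) as [d [p q]]; [now apply Rdiv_lt_0_compat|].
  exists d; split; [assumption|]; intros h hh; specialize (q h hh).
  rewrite Rabs_mult.
  assert (E : eps = (Rabs c + 1) * (eps / (Rabs c + 1))) by (field; lra).
  assert (Q := Rabs_pos c); assert (Q' := Rabs_pos (e h)).
  rewrite E; nra.
Qed.

Lemma lim0_abs e : lim0 e -> lim0 (fun h => Rabs (e h)).
Proof. intros H eps He; destruct (H eps He) as [d [p q]]; exists d; split; [assumption|];
  intros h hh; rewrite Rabs_Rabsolu; auto. Qed.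

Lemma lim0_zero : lim0 (fun _ => 0).
Proof. intros eps He; exists 1; split; [lra|]; intros; rewrite Rabs_R0; assumption. Qed.

Lemma right_deriv_lim0 f t l : right_deriv f t l -> lim0 (fun h => (f (t + h) - f t) / h - l).
Proof. exact (fun H => H). Qed.

Lemma right_deriv_of_deriv f t l : derivable_pt_lim f t l -> right_deriv f t l.
Proof.
  intros H eps He; destruct (H eps He) as [d Hd].
  exists d; split; [apply cond_pos|]; intros h [h0 h1].
  apply Hd; [lra|]; rewrite Rabs_pos_eq; lra.
Qed.

Lemma right_deriv_uniq f g t l m : (forall s, t <= s -> f s = g s) ->
  right_deriv f t l -> right_deriv g t m -> l = m.
Proof.
  intros E Hl Hm; destruct (Req_dec l m) as [|N]; [assumption|exfalso].
  assert (P : 0 < Rabs (l - m) / 2) by (assert (Q := Rabs_pos_lt (l - m)); lra).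
  destruct (Hl _ P) as [d1 [p1 q1]]; destruct (Hm _ P) as [d2 [p2 q2]].
  set (h := Rmin d1 d2 / 2).
  assert (M := Rmin_glb_lt _ _ _ p1 p2).
  assert (M1 := Rmin_l d1 d2); assert (M2 := Rmin_r d1 d2).
  assert (A1 := q1 h ltac:(unfold h; lra)); assert (A2 := q2 h ltac:(unfold h; lra)).
  rewrite <- !E in A2 by (unfold h; lra).
  set (x := (f (t + h) - f t) / h) in *.
  assert (T := Rabs_triang (l - x) (x - m)).
  replace (l - x + (x - m)) with (l - m) in T by ring.
  rewrite (Rabs_minus_sym l x) in T; lra.
Qed.

(** Here [g] stands for a convex function on the tangent line: its slopes at 0 shrink with [h] and
    are bounded below, so they converge to their infimum. It is written [- M] because [completeness]
    provides suprema; [f] inherits it since it differs from [g] by [o(h)]. *)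
Lemma right_deriv_of_slopes f g e t m :
  g 0 = f t ->
  (forall h, 0 < h -> Rabs (f (t + h) - g h) <= h * e h) ->
  lim0 e ->
  (forall h h', 0 < h -> h < h' -> (g h - g 0) / h <= (g h' - g 0) / h') ->
  (forall h, 0 < h -> - m <= (g h - g 0) / h) ->
  exists l, right_deriv f t l.
Proof.
  intros g0 fg le mono low.
  set (E := fun y => exists h, 0 < h /\ y = - ((g h - g 0) / h)).
  destruct (completeness E) as [M [ub lub]].
  - exists m; intros y [h [h0 ->]]; specialize (low h h0); lra.
  - exists (- ((g 1 - g 0) / 1)); exists 1; split; [lra|reflexivity].
  - exists (- M); intros eps He.
    assert (X : exists h0, 0 < h0 /\ (g h0 - g 0) / h0 < - M + eps / 2).
    { destruct (Classical_Prop.classic (exists h0, 0 < h0 /\ (g h0 - g 0) / h0 < - M + eps / 2)) as [|N];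
        [assumption|exfalso].
      assert (B : M <= M - eps / 2).
      { apply lub; intros y [h [hp ->]].
        destruct (Rlt_le_dec ((g h - g 0) / h) (- M + eps / 2)); [exfalso; apply N; exists h; split; assumption|lra]. }
      lra. }
    destruct X as [h0 [h0p h0s]].
    destruct (le (eps / 2)) as [d [dp dq]]; [lra|].
    exists (Rmin h0 d); split; [now apply Rmin_glb_lt|].
    intros h [hp hd].
    assert (hh0 := Rlt_le_trans _ _ _ hd (Rmin_l h0 d)).
    assert (hhd := Rlt_le_trans _ _ _ hd (Rmin_r h0 d)).
    specialize (dq h (conj hp hhd)).
    assert (S1 := mono h h0 hp hh0).
    assert (S2 : - M <= (g h - g 0) / h).
    { assert (U : - ((g h - g 0) / h) <= M) by (apply ub; exists h; split; [assumption|reflexivity]); lra. }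
    assert (F := fg h hp).
    replace ((f (t + h) - f t) / h - - M) with ((f (t + h) - g h) / h + ((g h - g 0) / h + M)).
    2: { rewrite g0; field; lra. }
    assert (F2 : Rabs ((f (t + h) - g h) / h) <= e h).
    { unfold Rdiv; rewrite Rabs_mult, (Rabs_pos_eq (/ h)) by (left; now apply Rinv_0_lt_compat).
      apply (Rmult_le_reg_r h); [assumption|].
      rewrite Rmult_assoc, Rinv_l by lra; lra. }
    assert (F3 := Rle_abs (e h)).
    assert (T := Rabs_triang ((f (t + h) - g h) / h) ((g h - g 0) / h + M)).
    rewrite (Rabs_pos_eq ((g h - g 0) / h + M)) in T by lra; lra.
Qed.

Definition cont_nonneg (f : R -> R) := forall t, 0 <= t -> forall eps, 0 < eps ->
  exists delta, 0 < delta /\ forall s, 0 <= s -> Rabs (s - t) < delta -> Rabs (f s - f t) < eps.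

(** Let [c] be the supremum of the points up to which the bound with slope [eps] holds. Continuity
    makes the bound hold at [c], and the right derivative carries it a little beyond, so [c = t].
    The slack [eps] is what makes a derivative equal to 0 good enough. *)
Lemma nonincreasing_eps f eps s t : cont_nonneg f -> 0 < eps -> 0 < s -> s <= t ->
  (forall x, 0 < x -> exists l, right_deriv f x l /\ l <= 0) ->
  f t <= f s + eps * (t - s).
Proof.
  intros Hc He Hs Hst Hd.
  set (E := fun x => s <= x <= t /\ forall y, s <= y <= x -> f y <= f s + eps * (y - s)).
  assert (Es : E s).
  { split; [lra|]; intros y Hy; replace y with s by lra; lra. }
  destruct (completeness E) as [c [ub lub]].
  - exists t; intros x [Hx _]; lra.
  - exists s; assumption.
  - assert (sc : s <= c) by (now apply ub).
    assert (ct : c <= t) by (apply lub; intros x [Hx _]; lra).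
    assert (below : forall y, s <= y < c -> f y <= f s + eps * (y - s)).
    { intros y Hy.
      destruct (Rle_dec (f y) (f s + eps * (y - s))) as [|N]; [assumption|exfalso].
      assert (c <= y); [|lra].
      apply lub; intros x [Hx Hall].
      destruct (Rle_dec x y); [assumption|]; exfalso; apply N; apply Hall; lra. }
    assert (atc : f c <= f s + eps * (c - s)).
    { destruct (Req_dec c s) as [->|Nc]; [lra|].
      destruct (Rle_dec (f c) (f s + eps * (c - s))) as [|N]; [assumption|exfalso].
      set (eta := f c - (f s + eps * (c - s))).
      destruct (Hc c ltac:(lra) eta) as [d [dp dq]]; [unfold eta; lra|].
      set (y := Rmax s (c - d / 2)).
      assert (Y1 : s <= y) by apply Rmax_l.
      assert (Y2 : c - d / 2 <= y) by apply Rmax_r.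
      assert (Y3 : y < c) by (apply Rmax_lub_lt; lra).
      assert (Q := dq y ltac:(lra)).
      assert (Q' : Rabs (f y - f c) < eta) by (apply Q; rewrite Rabs_minus_sym, Rabs_pos_eq; lra).
      apply Rabs_def2 in Q'; assert (W := below y ltac:(lra)).
      assert (eps * (y - s) <= eps * (c - s)) by (apply Rmult_le_compat_l; lra).
      unfold eta in Q'; lra. }
    destruct (Req_dec c t) as [<-|Nc]; [assumption|exfalso].
    destruct (Hd c ltac:(lra)) as [l [Hl Hl0]].
    destruct (Hl eps He) as [d [dp dq]].
    set (h := Rmin (d / 2) (t - c)).
    assert (H1 : h <= d / 2) by apply Rmin_l.
    assert (H2 : h <= t - c) by apply Rmin_r.
    assert (H3 : 0 < h) by (apply Rmin_glb_lt; lra).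
    assert (E (c + h)).
    { split; [lra|]; intros y Hy.
      destruct (Rlt_le_dec y c); [apply below; lra|].
      destruct (Req_dec y c) as [->|Ny]; [assumption|].
      assert (Q := dq (y - c) ltac:(lra)).
      replace (c + (y - c)) with y in Q by ring.
      apply Rabs_def2 in Q.
      assert (Q2 : (f y - f c) / (y - c) * (y - c) <= eps * (y - c)) by (apply Rmult_le_compat_r; lra).
      replace ((f y - f c) / (y - c) * (y - c)) with (f y - f c) in Q2 by (field; lra).
      lra. }
    assert (c + h <= c) by (now apply ub); lra.
Qed.

Lemma nonincreasing_of_right_deriv f s t : cont_nonneg f ->
  (forall x, 0 < x -> exists l, right_deriv f x l /\ l <= 0) ->
  0 <= s -> s <= t -> f t <= f s.
Proof.
  intros Hc Hd.
  assert (P : forall s t, 0 < s -> s <= t -> f t <= f s).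
  { intros s' t' Hs Hst.
    destruct (Rle_dec (f t') (f s')) as [|N]; [assumption|exfalso].
    (* This [e] keeps the permitted growth [e * (t' - s')] below half of the supposed increase; the
       added 1 keeps the denominator positive when [t' = s']. *)
    set (e := (f t' - f s') / (2 * (t' - s' + 1))).
    assert (e0 : 0 < e) by (apply Rdiv_lt_0_compat; lra).
    assert (Q := nonincreasing_eps f e s' t' Hc e0 Hs Hst Hd).
    assert (W : e * (t' - s' + 1) = (f t' - f s') / 2) by (unfold e; field; lra).
    lra. }
  (* No derivative is assumed at 0, so that endpoint is reached by continuity: for a small [y > 0]
     the value [f y] would already lie below [f t]. *)
  intros Hs Hst; destruct (Rle_lt_or_eq_dec 0 s Hs) as [|<-]; [now apply P|].
  destruct (Req_dec 0 t) as [<-|Nt]; [lra|].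
  destruct (Rle_dec (f t) (f 0)) as [|N]; [assumption|exfalso].
  destruct (Hc 0 (Rle_refl 0) (f t - f 0)) as [d [dp dq]]; [lra|].
  set (y := Rmin (d / 2) t).
  assert (Y1 : y <= d / 2) by apply Rmin_l.
  assert (Y2 : y <= t) by apply Rmin_r.
  assert (Y3 : 0 < y) by (apply Rmin_glb_lt; lra).
  assert (Q : Rabs (f y - f 0) < f t - f 0) by (apply dq; [lra|]; rewrite Rminus_0_r, Rabs_pos_eq; lra).
  apply Rabs_def2 in Q; assert (W := P y t Y3 Y2); lra.
Qed.

Lemma cont_nonneg_of_deriv f :
  (forall t, 0 < t -> exists l, derivable_pt_lim f t l) ->
  (exists l, right_deriv f 0 l) -> cont_nonneg f.
Proof.
  intros Hd [l Hl] t Ht eps He.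
  destruct (Rle_lt_or_eq_dec 0 t Ht) as [P|<-].
  - destruct (Hd t P) as [m Hm].
    assert (D : derivable_pt f t) by (exists m; exact Hm).
    destruct (derivable_continuous_pt f t D eps He) as [d [dp dq]].
    exists d; split; [assumption|]; intros s Hs Hsd.
    destruct (Req_dec s t) as [->|N]; [rewrite Rminus_diag_eq, Rabs_R0; [assumption|reflexivity]|].
    apply dq; split; [split; [exact I|]|exact Hsd]; intros E; apply N; symmetry; exact E.
  - destruct (Hl 1 ltac:(lra)) as [d [dp dq]].
    set (c := Rabs l + 1).
    assert (c0 : 0 < c) by (unfold c; assert (Q := Rabs_pos l); lra).
    exists (Rmin d (eps / c)); split; [apply Rmin_glb_lt; [assumption|now apply Rdiv_lt_0_compat]|].
    intros s Hs Hsd; rewrite Rminus_0_r, Rabs_pos_eq in Hsd by assumption.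
    destruct (Rle_lt_or_eq_dec 0 s Hs) as [P|<-]; [|rewrite Rminus_diag_eq, Rabs_R0; [assumption|reflexivity]].
    assert (S1 := Rlt_le_trans _ _ _ Hsd (Rmin_l _ _)).
    assert (S2 := Rlt_le_trans _ _ _ Hsd (Rmin_r _ _)).
    specialize (dq s (conj P S1)); rewrite Rplus_0_l in dq.
    assert (T := Rabs_triang ((f s - f 0) / s - l) l).
    replace ((f s - f 0) / s - l + l) with ((f s - f 0) / s) in T by ring.
    replace (f s - f 0) with ((f s - f 0) / s * s) by (field; lra).
    rewrite Rabs_mult, (Rabs_pos_eq s) by assumption.
    apply Rle_lt_trans with (c * s); [apply Rmult_le_compat_r; [assumption|unfold c; lra]|].
    replace eps with (c * (eps / c)) by (field; lra).
    now apply Rmult_lt_compat_l.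
Qed.


(** * Tensor indices *)

Definition idx (k a b : nat) : nat := (a * k + b)%nat.

Lemma idx_div k a b : (b < k)%nat -> (idx k a b / k)%nat = a.
Proof. intros H; symmetry; apply (Nat.div_unique _ _ a b); unfold idx; lia. Qed.

Lemma idx_mod k a b : (b < k)%nat -> (idx k a b mod k)%nat = b.
Proof. intros H; symmetry; apply (Nat.mod_unique _ _ a b); unfold idx; lia. Qed.

Lemma idx_lt d k a b : (a < d)%nat -> (b < k)%nat -> (idx k a b < d * k)%nat.
Proof. unfold idx; nia. Qed.

Lemma idx_assoc k l a b c : idx (k * l) a (idx l b c) = idx l (idx k a b) c.
Proof. unfold idx; nia. Qed.

Lemma liftA_idx k Phi X a b a' b' : (b < k)%nat -> (b' < k)%nat ->
  liftA k Phi X (idx k a b) (idx k a' b') = Phi (fun x x' => X (idx k x b) (idx k x' b')) a a'.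
Proof. intros H H'; unfold liftA; rewrite !idx_div, !idx_mod by assumption; reflexivity. Qed.

Lemma ptrans2_idx k X r c r' c' : (c < k)%nat -> (c' < k)%nat ->
  ptrans2 k X (idx k r c) (idx k r' c') = X (idx k r c') (idx k r' c).
Proof. intros H H'; unfold ptrans2; rewrite !idx_div, !idx_mod by assumption; reflexivity. Qed.

Lemma right_deriv_opp f t l : right_deriv f t l -> right_deriv (fun s => - f s) t (- l).
Proof.
  intros H eps He; destruct (H eps He) as [d [p q]]; exists d; split; [assumption|].
  intros h hh; specialize (q h hh).
  replace ((- f (t + h) - - f t) / h - - l) with (- ((f (t + h) - f t) / h - l)).
  - rewrite Rabs_Ropp; assumption.
  - field; lra.
Qed.

Lemma right_deriv_ext f g t l : (forall s, t <= s -> f s = g s) ->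
  right_deriv f t l -> right_deriv g t l.
Proof.
  intros E H eps He; destruct (H eps He) as [d [p q]]; exists d; split; [assumption|].
  intros h hh; rewrite <- !E by lra; auto.
Qed.

Module NegativityWitness.

From mathcomp Require Import all_boot all_order all_algebra.
From mathcomp Require Import boolp ring lra complex Rstruct.
Set Implicit Arguments.
Unset Strict Implicit.
Unset Printing Implicit Defensive.
Import Order.TTheory GRing.Theory Num.Theory.
Local Open Scope ring_scope.

(** * Positive semidefinite kernels *)

Section Kernels.
Variable C : numClosedFieldType.

(** Operators are kernels over an arbitrary finite type, so that a tensor product is a product type
    and needs no index arithmetic. *)
Definition qf (I : finType) (M : I -> I -> C) (v : I -> C) : C :=
  \sum_i \sum_j (v i)^* * M i j * v j.
(* In the order of [C], [0 <= z] entails that [z] is real, so that these kernels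
   are hermitian. *)
Definition psdk (I : finType) (M : I -> I -> C) := forall v, 0 <= qf M v.
Definition hermk (I : finType) (M : I -> I -> C) := forall i j, M i j = (M j i)^*.
Definition trk (I : finType) (M : I -> I -> C) := \sum_i M i i.
Definition mulk (I : finType) (A B : I -> I -> C) :=
  fun i j => \sum_k A i k * B k j.

Lemma kerext (I J : Type) (A B : I -> J -> C) : (forall i j, A i j = B i j) -> A = B.
Proof. by move=> h; apply: funext => i; apply: funext => j. Qed.

Section One.
Variable I : finType.
Implicit Types (A B M : I -> I -> C) (v w : I -> C).

Lemma qfD A B v : qf (fun i j => A i j + B i j) v = qf A v + qf B v.
Proof.
rewrite /qf -big_split; apply: eq_bigr => i _.
by rewrite -big_split; apply: eq_bigr => j _ /=; rewrite mulrDr mulrDl.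
Qed.

Lemma qfZ c A v : qf (fun i j => c * A i j) v = c * qf A v.
Proof.
rewrite /qf mulr_sumr; apply: eq_bigr => i _.
rewrite mulr_sumr; apply: eq_bigr => j _ /=; ring.
Qed.

Lemma qfB A B v : qf (fun i j => A i j - B i j) v = qf A v - qf B v.
Proof.
have -> : (fun i j => A i j - B i j) = (fun i j => A i j + (-1) * B i j).
  by apply: kerext => i j; rewrite mulN1r.
by rewrite qfD qfZ mulN1r.
Qed.

Lemma qf_sum (K : finType) (F : K -> I -> I -> C) v :
  qf (fun i j => \sum_k F k i j) v = \sum_k qf (F k) v.
Proof.
rewrite /qf [RHS]exchange_big /=; apply: eq_bigr => i _.
rewrite [RHS]exchange_big /=; apply: eq_bigr => j _.
by rewrite mulr_sumr mulr_suml.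
Qed.

Lemma qf_rank1 (w v : I -> C) :
  qf (fun i j => w i * (w j)^*) v = `|\sum_j (w j)^* * v j| ^+ 2.
Proof.
rewrite normCK rmorph_sum /qf mulr_suml exchange_big /=; apply: eq_bigr => j _.
rewrite mulr_sumr; apply: eq_bigr => i _; rewrite rmorphM /= conjCK; ring.
Qed.

Lemma psdk_rank1 (w : I -> C) : psdk (fun i j => w i * (w j)^*).
Proof. by move=> v; rewrite qf_rank1 exprn_ge0. Qed.

Lemma psdkD A B : psdk A -> psdk B -> psdk (fun i j => A i j + B i j).
Proof. by move=> a b v; rewrite qfD addr_ge0. Qed.

Lemma psdkZ c A : 0 <= c -> psdk A -> psdk (fun i j => c * A i j).
Proof. by move=> c0 a v; rewrite qfZ mulr_ge0. Qed.

Lemma psdk_sum (K : finType) (F : K -> I -> I -> C) :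
  (forall k, psdk (F k)) -> psdk (fun i j => \sum_k F k i j).
Proof. by move=> h v; rewrite qf_sum sumr_ge0 // => k _; apply: h. Qed.

Lemma psdk0 : psdk (fun _ _ : I => 0).
Proof. by move=> v; rewrite /qf big1 // => i _; rewrite big1 // => j _; rewrite mulr0 mul0r. Qed.

Lemma trkD A B : trk (fun i j => A i j + B i j) = trk A + trk B.
Proof. by rewrite /trk big_split. Qed.
Lemma trkB A B : trk (fun i j => A i j - B i j) = trk A - trk B.
Proof. by rewrite /trk sumrB. Qed.
Lemma trkZ c A : trk (fun i j => c * A i j) = c * trk A.
Proof. by rewrite /trk mulr_sumr. Qed.
End One.

Lemma qf_congr (I J : finType) (M : I -> I -> C) (K : I -> J -> C) v :
  qf (fun j j' => \sum_i \sum_i' (K i j)^* * M i i' * K i' j') v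
  = qf M (fun i => \sum_j K i j * v j).
Proof.
rewrite /qf.
under eq_bigr => j _.
  under eq_bigr => j' _.
    rewrite mulr_sumr mulr_suml.
    under eq_bigr do rewrite mulr_sumr mulr_suml.
    over.
  rewrite exchange_big /=.
  under eq_bigr do rewrite exchange_big /=.
  over.
rewrite exchange_big /=; apply: eq_bigr => i _.
rewrite exchange_big /=; apply: eq_bigr => i' _.
rewrite rmorph_sum mulr_suml mulr_suml; apply: eq_bigr => j _.
rewrite mulr_sumr; apply: eq_bigr => j' _; rewrite rmorphM; ring.
Qed.

Lemma psdk_congr (I J : finType) (M : I -> I -> C) (K : I -> J -> C) : psdk M ->
  psdk (fun j j' => \sum_i \sum_i' (K i j)^* * M i i' * K i' j').
Proof. by move=> m v; rewrite qf_congr. Qed.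

Lemma sum_delta (I : finType) (f : I -> C) i : \sum_k (k == i)%:R * f k = f i.
Proof.
rewrite (bigD1 i) //= eqxx mul1r big1 ?addr0 // => k /negbTE ->; exact: mul0r.
Qed.

Lemma psdk_pull (I J : finType) (M : I -> I -> C) (f : J -> I) : psdk M ->
  psdk (fun j j' => M (f j) (f j')).
Proof.
move=> /(psdk_congr (fun i j => (i == f j)%:R)) h.
suff -> : (fun j j' => M (f j) (f j')) =
  (fun j j' => \sum_i \sum_i' (i == f j)%:R^* * M i i' * (i' == f j')%:R) by [].
apply: kerext => j j'; rewrite -(sum_delta (fun k => M k (f j')) (f j)).
apply: eq_bigr => i _; rewrite conjC_nat -(sum_delta (fun k => M i k) (f j')) mulr_sumr.
by apply: eq_bigr => i' _; ring.
Qed.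

Lemma qf_bool (M : bool -> bool -> C) v : qf M v =
  (v true)^* * M true true * v true + (v true)^* * M true false * v false
  + ((v false)^* * M false true * v true + (v false)^* * M false false * v false).
Proof. by rewrite /qf !big_bool. Qed.

Lemma psdk_pair (I : finType) (M : I -> I -> C) i j x y : psdk M ->
  0 <= x^* * M i i * x + x^* * M i j * y + (y^* * M j i * x + y^* * M j j * y).
Proof.
move=> /(psdk_pull (fun b : bool => if b then i else j)).
by move=> /(_ (fun b => if b then x else y)); rewrite qf_bool.
Qed.

Lemma psdk_diag (I : finType) (M : I -> I -> C) i : psdk M -> 0 <= M i i.
Proof.
by move=> /(psdk_pair i i 1 0); rewrite conjC1 conjC0 !(mul1r, mul0r, mulr1, mulr0, addr0).
Qed.

Lemma psdk_herm (I : finType) (M : I -> I -> C) : psdk M -> hermk M.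
Proof.
move=> m i j.
have di := psdk_diag i m; have dj := psdk_diag j m.
have h1 := psdk_pair i j 1 1 m; have h2 := psdk_pair i j 1 'i m.
have r1 : M i j + M j i \is Num.real.
  have -> : M i j + M j i = (1^* * M i i * 1 + 1^* * M i j * 1 +
     (1^* * M j i * 1 + 1^* * M j j * 1)) - M i i - M j j.
    rewrite conjC1; ring.
  by rewrite !rpredB ?ger0_real.
have r2 : 'i * (M i j - M j i) \is Num.real.
  have -> : 'i * (M i j - M j i) = (1^* * M i i * 1 + 1^* * M i j * 'i +
     ('i^* * M j i * 1 + 'i^* * M j j * 'i)) - M i i - M j j.
    rewrite conjC1 conjCi; transitivity ('i * (M i j - M j i) + M j j *(- ('i ^+ 2) - 1)).
      rewrite sqrCi opprK subrr mulr0 addr0 //.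
    ring.
  by rewrite !rpredB ?ger0_real.
move/CrealP: r1; rewrite rmorphD /= => r1.
move/CrealP: r2; rewrite rmorphM rmorphB /= conjCi mulNr -mulrN => /(mulfI (neq0Ci _)) r2.
have : 2%:R * M i j = 2%:R * (M j i)^*.
  transitivity ((M i j + M j i) + (M i j - M j i)); first by ring.
  rewrite -r1 -r2; ring.
by move/(mulfI); apply; rewrite pnatr_eq0.
Qed.

Lemma psdk_tr_ge0 (I : finType) (M : I -> I -> C) : psdk M -> 0 <= trk M.
Proof. by move=> m; apply: sumr_ge0 => i _; apply: psdk_diag. Qed.

Lemma psdk_diag_le_tr (I : finType) (M : I -> I -> C) i : psdk M -> M i i <= trk M.
Proof.
move=> m; rewrite /trk (bigD1 i) //= lerDl; apply: sumr_ge0 => k _; exact: psdk_diag.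
Qed.

Lemma psdk_offdiag (I : finType) (M : I -> I -> C) i j : psdk M ->
  2%:R * `|M i j| <= M i i + M j j.
Proof.
move=> m; have [->|z0] := eqVneq (M i j) 0.
  by rewrite normr0 mulr0 addr_ge0 ?psdk_diag.
have n0 : `|M i j| != 0 by rewrite normr_eq0.
(* The coefficient at [j] has modulus 1 and the phase that turns both cross terms into minus the
   modulus of [M i j]. *)
have := psdk_pair i j 1 (- ((M i j)^* / `|M i j|)) m.
rewrite (psdk_herm m j i) conjC1 !rmorphN !rmorphM /= conjCK fmorphV /= conj_normC.
set z := M i j; set n := `|z| => h.
rewrite -subr_ge0; congr (0 <= _): h.
have e : z * z^* = n ^+ 2 by rewrite /n normCK.
transitivity (M i i + M j j * (z * z^*) / n^+2 - 2%:R * (z * z^*)/ n).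
  by field; exact: n0.
by rewrite e; field; exact: n0.
Qed.

Lemma psdk_entry (I : finType) (M : I -> I -> C) i j : psdk M -> `|M i j| <= trk M.
Proof.
move=> m; have h := psdk_offdiag i j m.
rewrite -(ler_pM2l (ltr0n C 2)); apply: (le_trans h).
by rewrite mulr_natl mulr2n lerD ?psdk_diag_le_tr.
Qed.

Lemma psdk_tr0 (I : finType) (M : I -> I -> C) : psdk M -> trk M = 0 ->
  forall i j, M i j = 0.
Proof. by move=> m t0 i j; have := psdk_entry i j m; rewrite t0 normr_le0 => /eqP. Qed.

(** * Spectral decomposition and functional calculus *)

Section Spectral.
Variable (I : finType).

(** For orthonormal [u k] this is the operator with eigenvalue [g k] on the conjugate of [u k]. The
    conjugate comes from the spectral theorem in the form P^* diag P, where the [u k] are the rows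
    of P. *)
Definition fc (n : nat) (u : 'I_n -> I -> C) (g : 'I_n -> C) : I -> I -> C :=
  fun i j => \sum_k g k * ((u k i)^* * u k j).

Lemma spectralk (M : I -> I -> C) : hermk M ->
  exists (u : 'I_#|I| -> I -> C) (l : 'I_#|I| -> C),
  [/\ forall k, l k \is Num.real,
      forall k k', \sum_i u k i * (u k' i)^* = (k == k')%:R,
      forall i j, \sum_k (u k i)^* * u k j = (i == j)%:R & M = fc u l].
Proof.
move=> hM; pose A : 'M[C]_#|I| := \matrix_(i, j) M (enum_val i) (enum_val j).
have hA : A \is hermsymmx.
  apply/is_hermitianmxP; rewrite expr0 scale1r; apply/matrixP => i j; rewrite !mxE; exact: hM.
have /orthomx_spectralP eA := hermitian_normalmx hA.
have un := spectral_unitarymx A.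
have rl := hermitian_spectral_diag_real hA.
set P := spectralmx A in eA un; set X := spectral_diag A in eA rl.
have u1 := unitarymxP un; rewrite (invmx_unitary un) in eA.
have u2 := mulmx1C u1.
exists (fun k i => P k (enum_rank i)), (fun k => X 0 k); split.
- by move=> k; apply: (mxOverP rl).
- move=> k k'; move/matrixP: u1 => /(_ k k'); rewrite !mxE => <-.
  rewrite (reindex (@enum_val I I)) /=; last by exists enum_rank => x _; rewrite ?enum_rankK ?enum_valK.
  by apply: eq_bigr => i _; rewrite !mxE enum_valK.
- move=> i j; move/matrixP: u2 => /(_ (enum_rank i) (enum_rank j)); rewrite !mxE.
  rewrite (inj_eq enum_rank_inj) => <-.
  by apply: eq_bigr => k _; rewrite !mxE.
- apply: kerext => i j; move/matrixP: eA => /(_ (enum_rank i) (enum_rank j)).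
  rewrite mxE !enum_rankK => ->; rewrite !mxE; apply: eq_bigr => k _.
  rewrite !mxE (bigD1 k) //= big1 ?addr0; last first.
    by move=> k' /negbTE kk'; rewrite !mxE kk' mulr0n mulr0.
  by rewrite !mxE eqxx mulr1n; ring.
Qed.

Variables (n : nat) (u : 'I_n -> I -> C).

Lemma qf_fc g v : qf (fc u g) v = \sum_k g k * `|\sum_j u k j * v j| ^+ 2.
Proof.
rewrite /fc qf_sum; apply: eq_bigr => k _; rewrite qfZ; congr (_ * _).
have := qf_rank1 (fun i => (u k i)^*) v; rewrite /=.
under eq_bigr do rewrite conjCK.
by move=> <-; congr qf; apply: kerext => i j; rewrite conjCK.
Qed.

Lemma psdk_fc g : (forall k, 0 <= g k) -> psdk (fc u g).
Proof.
by move=> h v; rewrite qf_fc sumr_ge0 // => k _; rewrite mulr_ge0 // exprn_ge0.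
Qed.

Hypothesis ortho : forall k k', \sum_i u k i * (u k' i)^* = (k == k')%:R.

Lemma tr_fc g : trk (fc u g) = \sum_k g k.
Proof.
rewrite /trk exchange_big /=; apply: eq_bigr => k _.
rewrite -mulr_sumr (eq_bigr (fun i => u k i * (u k i)^*)) ?ortho ?eqxx ?mulr1 //.
by move=> i _; rewrite mulrC.
Qed.

Lemma mul_fc g h : mulk (fc u g) (fc u h) = fc u (fun k => g k * h k).
Proof.
apply: kerext => i j; rewrite /mulk /fc.
under eq_bigr do rewrite mulr_suml.
rewrite exchange_big /=; apply: eq_bigr => k _.
under eq_bigr do rewrite mulr_sumr.
rewrite exchange_big /=.
rewrite (eq_bigr (fun k' => (k == k')%:R * (g k * h k' * (u k i)^* * u k' j))).
  under eq_bigr do rewrite eq_sym.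
  by rewrite sum_delta; ring.
move=> k' _; rewrite -ortho mulr_suml; apply: eq_bigr => l _; ring.
Qed.
End Spectral.

Lemma psdk_eig_ge0 (I : finType) n (u : 'I_n -> I -> C) l k : 
  (forall k k', \sum_i u k i * (u k' i)^* = (k == k')%:R) ->
  psdk (fc u l) -> 0 <= l k.
Proof.
move=> o /(_ (fun i => (u k i)^*)); rewrite qf_fc.
rewrite (eq_bigr (fun k' => (k' == k)%:R * l k')) ?sum_delta //.
move=> k' _; rewrite o; case: (_ == _); rewrite ?normr1 ?normr0 ?expr1n ?expr0n /=; ring.
Qed.

Lemma psdk_gram (I : finType) (M : I -> I -> C) : psdk M ->
  exists S : I -> I -> C, [/\ psdk S, mulk S S = M & hermk S].
Proof.
move=> m; have [u [l [rl o c e]]] := spectralk (psdk_herm m).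
have p k : 0 <= l k by apply: (psdk_eig_ge0 k o); rewrite -e.
have ps : psdk (fc u (fun k => sqrtC (l k))) by apply: psdk_fc => k; rewrite sqrtC_ge0.
exists (fc u (fun k => sqrtC (l k))); split=> //; last exact: psdk_herm.
rewrite mul_fc // e; congr fc; apply: funext => k; rewrite -expr2 sqrtCK //.
Qed.

Lemma trk_mul_ge0 (I : finType) (A B : I -> I -> C) : psdk A -> psdk B ->
  0 <= \sum_i \sum_j A i j * B j i.
Proof.
move=> /psdk_gram [S [_ <- hS]] b.
suff -> : \sum_i \sum_j mulk S S i j * B j i = \sum_k qf B (fun i => S i k).
  by apply: sumr_ge0 => k _; apply: b.
rewrite /mulk /qf.
under eq_bigr do under eq_bigr do rewrite mulr_suml.
under eq_bigr do rewrite exchange_big /=.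
rewrite exchange_big /=; apply: eq_bigr => k _.
rewrite exchange_big /=; apply: eq_bigr => i _; apply: eq_bigr => j _.
by rewrite (hS k i); ring.
Qed.

End Kernels.

(** * Trace norm *)

Section TraceNorm.
Variable C : numClosedFieldType.

Section One.
Variable I : finType.
Implicit Types (A B M S : I -> I -> C).

(* The trace norm of a hermitian kernel, as an attained minimum. *)
Definition isTN M (r : C) :=
  (exists A B, [/\ psdk A, psdk B, forall i j, M i j = A i j - B i j & r = trk A + trk B]) /\
  (forall A B, psdk A -> psdk B -> (forall i j, M i j = A i j - B i j) -> r <= trk A + trk B).

Lemma isTN_uniq M r r' : isTN M r -> isTN M r' -> r = r'.
Proof.
move=> [[A [B [a b e ->]]] m] [[A' [B' [a' b' e' ->]]] m'].
by apply/eqP; rewrite eq_le m // m'.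
Qed.

Lemma isTN_ge0 M r : isTN M r -> 0 <= r.
Proof. by case=> [[A [B [a b _ ->]]] _]; rewrite addr_ge0 ?psdk_tr_ge0. Qed.

Lemma isTN_herm M r : isTN M r -> hermk M.
Proof.
move=> [[A [B [a b e _]]] _] i j.
by rewrite !e rmorphB /= -(psdk_herm a) -(psdk_herm b).
Qed.

Lemma isTN_psd A : psdk A -> isTN A (trk A).
Proof.
move=> a; split.
  exists A, (fun _ _ => 0); split=> //; [exact: psdk0 | by move=> i j; rewrite subr0|].
  by rewrite [X in _ + X]/trk big1 ?addr0.
move=> A' B' a' b' e.
have -> : trk A = trk A' - trk B' by rewrite -trkB; apply: eq_bigr => i _; rewrite e.
by apply: lerD => //; rewrite -subr_ge0 opprK addr_ge0 ?psdk_tr_ge0.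
Qed.

(** In an optimal decomposition the hypothesis reads [tr A' + tr B' <= tr A' - tr B'], so [B'] has
    trace 0 and vanishes. This turns contractivity of trace-preserving maps into positivity. *)
Lemma psd_of_isTN A r : isTN A r -> r <= trk A -> psdk A.
Proof.
move=> [[A' [B' [a' b' e ->]]] _].
have -> : trk A = trk A' - trk B' by rewrite -trkB; apply: eq_bigr => i _; rewrite e.
rewrite lerD2l => h.
have p := psdk_tr_ge0 b'.
have t0 : trk B' = 0.
  have h2 : trk B' + trk B' <= 0 by rewrite -lerBrDr sub0r.
  by apply/eqP; rewrite eq_le p andbT (le_trans _ h2) // lerDl.
have -> // : A = A'; apply: kerext => i j; rewrite e (psdk_tr0 b' t0) subr0 //.
Qed.

Lemma isTN_triangle A B D a b d : isTN A a -> isTN B b -> isTN D d ->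
  (forall i j, D i j = A i j + B i j) -> d <= a + b.
Proof.
move=> [[A1 [A2 [a1 a2 ea ->]]] _] [[B1 [B2 [b1 b2 eb ->]]] _] [_ m] e.
have := m _ _ (psdkD a1 b1) (psdkD a2 b2).
rewrite !trkD [trk A1 + trk A2 + _]addrACA; apply.
by move=> i j; rewrite e ea eb opprD addrACA.
Qed.

Lemma isTN_scale A a c : 0 < c -> isTN A a -> isTN (fun i j => c * A i j) (c * a).
Proof.
move=> c0 [[A1 [A2 [a1 a2 ea ->]]] m]; split.
  exists (fun i j => c * A1 i j), (fun i j => c * A2 i j).
  split; try by apply: psdkZ => //; apply: ltW.
    by move=> i j; rewrite ea mulrBr.
  by rewrite !trkZ mulrDr.
move=> A' B' a' b' e.
have ci : 0 <= c^-1 by rewrite invr_ge0 ltW.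
have := m _ _ (psdkZ ci a') (psdkZ ci b').
rewrite !trkZ -mulrDr mulrC ler_pdivlMr // mulrC; apply.
by move=> i j; rewrite -mulrBr -e mulKf // gt_eqF.
Qed.

Lemma isTN_opp A a : isTN A a -> isTN (fun i j => - A i j) a.
Proof.
move=> [[A1 [A2 [a1 a2 ea ->]]] m]; split.
  by exists A2, A1; split=> //; [move=> i j; rewrite ea opprB | rewrite addrC].
move=> A' B' a' b' e; rewrite [leRHS]addrC; apply: m => // i j.
by rewrite -[LHS]opprK e opprB.
Qed.

Lemma qf_norm (v : I -> C) : qf (fun i j : I => (i == j)%:R) v = \sum_i `|v i| ^+ 2.
Proof.
rewrite /qf; apply: eq_bigr => i _.
rewrite (eq_bigr (fun j => (j == i)%:R * ((v i)^* * v j))).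
  by rewrite sum_delta normCK mulrC.
by move=> j _; rewrite eq_sym; ring.
Qed.

Lemma psdk1 (c : C) : 0 <= c -> psdk (fun i j : I => c * (i == j)%:R).
Proof.
by move=> c0; apply: psdkZ => // v; rewrite qf_norm sumr_ge0 // => i _; rewrite exprn_ge0.
Qed.

Lemma hermk_qf_real M v : hermk M -> qf M v \is Num.real.
Proof.
move=> h; apply/CrealP; rewrite /qf rmorph_sum exchange_big; apply: eq_bigr => i _.
rewrite rmorph_sum; apply: eq_bigr => j _; rewrite !rmorphM /= conjCK -h; ring.
Qed.

(** The sum of the moduli of the entries dominates the operator norm, because |v_i| |v_j| <= |v|^2.
    The shift writes a hermitian kernel as an explicit difference of positive ones. *)
Lemma psdk_shift M : hermk M ->
  psdk (fun i j => M i j + (\sum_i \sum_j `|M i j|) * (i == j)%:R).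
Proof.
move=> h v; rewrite qfD qfZ qf_norm.
rewrite -[qf M v]opprK addrC subr_ge0.
have r : - qf M v \is Num.real by rewrite rpredN hermk_qf_real.
apply: le_trans (real_ler_norm r) _; rewrite normrN /qf.
apply: le_trans (ler_norm_sum _ _ _) _; rewrite mulr_suml; apply: ler_sum => i _.
apply: le_trans (ler_norm_sum _ _ _) _; rewrite mulr_suml; apply: ler_sum => j _.
rewrite !normrM norm_conjC mulrC mulrA mulrC ler_wpM2l //.
set s := \sum_i _.
have hs k : `|v k| ^+ 2 <= s.
  by rewrite /s (bigD1 k) //= lerDl sumr_ge0 // => l _; rewrite exprn_ge0.
rewrite -(ler_pM2l (ltr0n C 2)) [leRHS]mulr_natl mulr2n.
apply: le_trans (lerD (hs j) (hs i)).
rewrite -subr_ge0.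
have -> : `|v j| ^+ 2 + `|v i| ^+ 2 - 2 * (`|v j| * `|v i|) = (`|v j| - `|v i|) ^+ 2 by ring.
by rewrite -realEsqr rpredB ?normr_real.
Qed.

(** The constant comes from the decomposition of [M] as [M + s] minus [s], of total trace
    [tr M + 2 |I| s]. The bound makes the trace norm continuous in the entries. *)
Lemma isTN_bound M r : isTN M r ->
  r <= (1 + #|I|%:R *+ 2) * (\sum_i \sum_j `|M i j|).
Proof.
move=> tM; have h := isTN_herm tM; have [_ m] := tM.
set s := \sum_i _.
have s0 : 0 <= s by rewrite sumr_ge0 // => i _; rewrite sumr_ge0.
have := m _ _ (psdk_shift h) (psdk1 s0).
rewrite trkD -/s trkZ => /(_ (fun i j => esym (addrK _ _))) /le_trans; apply.
have -> : trk (fun i j : I => (i == j)%:R : C) = #|I|%:R.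
  by rewrite /trk (eq_bigr (fun=> 1)) ?sumr_const // => i _; rewrite eqxx.
rewrite mulrDl mul1r -addrA -mulr2n mulrnAl [_ * s]mulrC lerD //.
have rt : trk M \is Num.real by apply: rpred_sum => i _; apply/CrealP; rewrite -h.
apply: le_trans (real_ler_norm rt) _; apply: le_trans (ler_norm_sum _ _ _) _.
by apply: ler_sum => i _; rewrite (bigD1 i) //= lerDl sumr_ge0.
Qed.

Lemma isTN_exists_spectral M : hermk M ->
  exists S, [/\ psdk S, mulk S S = mulk M M & isTN M (trk S)].
Proof.
move=> h; have [u [l [rl o c e]]] := spectralk h.
have pS : psdk (fc u (fun k => `|l k|)) by apply: psdk_fc => k.
exists (fc u (fun k => `|l k|)); split=> //.
  by rewrite e !mul_fc //; congr fc; apply: funext => k; rewrite -!expr2 -normrX ger0_norm -?realEsqr.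
have fcD g g' i j : fc u g i j + fc u g' i j = fc u (fun k => g k + g' k) i j.
  by rewrite /fc -big_split; apply: eq_bigr => k _; rewrite mulrDl.
have fcB g g' i j : fc u g i j - fc u g' i j = fc u (fun k => g k - g' k) i j.
  by rewrite /fc -sumrB; apply: eq_bigr => k _; rewrite mulrBl.
split.
  exists (fc u (fun k => (`|l k| + l k) / 2)), (fc u (fun k => (`|l k| - l k) / 2)).
  have two : 0 <= 2^-1 :> C by rewrite invr_ge0 ler0n.
  split.
  - apply: psdk_fc => k; rewrite mulr_ge0 // -lerBlDr sub0r -normrN real_ler_norm //.
    by rewrite rpredN.
  - by apply: psdk_fc => k; rewrite mulr_ge0 // subr_ge0 real_ler_norm.
  - move=> i j; rewrite fcB e; congr fc; apply: funext => k; by field.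
  - rewrite !tr_fc // -big_split; apply: eq_bigr => k _ /=; by field.
move=> A B a b e'.
(* Dual certificate of minimality: the sign of [M] pairs with [M] to the sum of the moduli of the
   eigenvalues, while [1 - sg >= 0] and [1 + sg >= 0] bound its pairing with [A - B] by
   [tr A + tr B]. *)
pose sg k : C := if l k < 0 then -1 else 1.
have one i j : (i == j)%:R = fc u (fun=> 1) i j.
  by rewrite -c; apply: eq_bigr => k _; rewrite mul1r.
have sg1 k : 0 <= 1 - sg k by rewrite /sg; case: ifP; rewrite ?opprK ?subrr // addr_ge0.
have sg2 k : 0 <= 1 + sg k by rewrite /sg; case: ifP; rewrite ?subrr // addr_ge0.
have p1 := trk_mul_ge0 (psdk_fc u sg1) a.
have p2 := trk_mul_ge0 (psdk_fc u sg2) b.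
rewrite -subr_ge0; have := addr_ge0 p1 p2; congr (0 <= _).
have -> : trk (fc u (fun k => `|l k|)) = trk (mulk (fc u sg) M).
  rewrite e mul_fc //; congr (trk (fc u _)); apply: funext => k.
  by rewrite /sg; case: ifP => [/ltr0_norm ->|]; rewrite ?mulN1r // real_ltNge // => /negbFE/ger0_norm->; rewrite mul1r.
have d (X : I -> I -> C) g : \sum_i \sum_j fc u (fun k => 1 + g k) i j * X j i =
    trk X + trk (mulk (fc u g) X).
  rewrite /trk -big_split; apply: eq_bigr => i _ /=.
  rewrite -(sum_delta (fun j => X j i) i) -big_split; apply: eq_bigr => j _ /=.
  by rewrite -fcD -one mulrDl eq_sym.
rewrite (d A (fun k => - sg k)) (d B sg).
have -> : trk (mulk (fc u sg) M) = trk (mulk (fc u sg) A) - trk (mulk (fc u sg) B).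
  rewrite -trkB; apply: eq_bigr => i _; rewrite /mulk -sumrB; apply: eq_bigr => j _.
  by rewrite e' mulrBr.
have -> : trk (mulk (fc u (fun k => - sg k)) A) = - trk (mulk (fc u sg) A).
  rewrite /trk -sumrN; apply: eq_bigr => i _; rewrite /mulk -sumrN; apply: eq_bigr => j _.
  rewrite -mulNr; congr (_ * _); rewrite /fc -sumrN; apply: eq_bigr => k _; by rewrite mulNr.
ring.
Qed.

Lemma qf_mulk_eigr A B v c : (forall k, \sum_j B k j * v j = c * v k) ->
  qf (mulk A B) v = c * qf A v.
Proof.
move=> h; rewrite /qf mulr_sumr; apply: eq_bigr => i _.
transitivity (\sum_k (v i)^* * A i k * \sum_j B k j * v j).
  under [RHS]eq_bigr do rewrite mulr_sumr.
  rewrite [RHS]exchange_big; apply: eq_bigr => j _ /=.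
  rewrite /mulk mulr_sumr mulr_suml; apply: eq_bigr => k _; ring.
by rewrite mulr_sumr; apply: eq_bigr => k _; rewrite h; ring.
Qed.

Lemma qf_mulk_eigl A B v c : (forall j, \sum_i (v i)^* * A i j = c * (v j)^*) ->
  qf (mulk A B) v = c * qf B v.
Proof.
move=> h; rewrite /qf [in LHS]exchange_big [in RHS]exchange_big mulr_sumr /=.
apply: eq_bigr => j _.
transitivity (\sum_k (\sum_i (v i)^* * A i k) * B k j * v j).
  under [RHS]eq_bigr do rewrite mulr_suml mulr_suml.
  rewrite [RHS]exchange_big; apply: eq_bigr => i _ /=.
  rewrite /mulk mulr_sumr mulr_suml; apply: eq_bigr => k _; ring.
by rewrite mulr_sumr; apply: eq_bigr => k _; rewrite h; ring.
Qed.

(* Test on an eigenvector v of S - H: since 2 (S^2 - H^2) is the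
   anticommutator of S - H and S + H, a negative eigenvalue would force
   <v, (S + H) v> = 0 and hence <v, S v> < 0. *)
Lemma psdk_sqrt_sub S H : psdk S -> hermk H -> mulk S S = mulk H H ->
  psdk (fun i j => S i j - H i j).
Proof.
move=> s hH e.
have hD : hermk (fun i j => S i j - H i j).
  by move=> i j; rewrite rmorphB /= -(psdk_herm s) -hH.
have [u [l [rl o c eD]]] := spectralk hD.
rewrite eD; apply: psdk_fc => k.
pose v i := (u k i)^*.
have er i : \sum_j (S i j - H i j) * v j = l k * v i.
  have -> : \sum_j (S i j - H i j) * v j = \sum_j fc u l i j * v j by rewrite -eD.
  under eq_bigr do rewrite mulr_suml.
  rewrite exchange_big /= (eq_bigr (fun k' => (k' == k)%:R * (l k' * (u k' i)^*))).
    by rewrite sum_delta.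
  move=> k' _; rewrite -o mulr_suml; apply: eq_bigr => j _; rewrite /v; ring.
have el i : \sum_j (v j)^* * (S j i - H j i) = l k * (v i)^*.
  rewrite -(CrealP (rl k)) -rmorphM /= -er rmorph_sum; apply: eq_bigr => j _.
  by rewrite rmorphM /= -hD mulrC.
have h0 : l k * qf (fun i j => S i j + H i j) v = 0.
  have two : 2%:R != 0 :> C by rewrite pnatr_eq0.
  apply: (mulfI two); rewrite mulr0.
  transitivity (qf (mulk (fun i j => S i j + H i j) (fun i j => S i j - H i j)) v
     + qf (mulk (fun i j => S i j - H i j) (fun i j => S i j + H i j)) v).
    by rewrite (qf_mulk_eigr _ er) (qf_mulk_eigl _ el); ring.
  rewrite -qfD -[RHS](_ : qf (fun i j => 2%:R * (mulk S S i j - mulk H H i j)) v = 0); last first.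
    by rewrite e qfZ qfB subrr mulr0.
  congr qf; apply: kerext => i j; rewrite /mulk -big_split -sumrB mulr_sumr.
  apply: eq_bigr => m _ /=; ring.
have h1 : qf (fun i j => S i j - H i j) v = l k.
  rewrite eD qf_fc (eq_bigr (fun k' => (k' == k)%:R * l k')) ?sum_delta //.
  move=> k' _; rewrite o; case: (_ == _); rewrite ?normr1 ?normr0 ?expr1n ?expr0n /=; ring.
have sv := s v.
have [l0|ln0] := eqVneq (l k) 0; first by rewrite l0.
move/eqP: h0; rewrite mulf_eq0 (negbTE ln0) /= => /eqP h0.
have : qf S v + qf S v = l k by rewrite -h1 -[RHS]addr0 -h0 qfB (qfD S H); ring.
by move=> <-; rewrite addr_ge0.
Qed.

(** [psdk_sqrt_sub], applied in both directions, gives [S] the same trace as the spectral root. So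
    any positive root computes the trace norm, in particular one picked by [epsilon]. *)
Lemma isTN_sqrt M S : hermk M -> psdk S -> mulk S S = mulk M M -> isTN M (trk S).
Proof.
move=> h s e; have [S0 [s0 e0 t]] := isTN_exists_spectral h.
have eS : mulk S S = mulk S0 S0 by rewrite e e0.
have p1 := psdk_tr_ge0 (psdk_sqrt_sub s (psdk_herm s0) eS).
have p2 := psdk_tr_ge0 (psdk_sqrt_sub s0 (psdk_herm s) (esym eS)).
rewrite !trkB !subr_ge0 in p1 p2.
suff -> : trk S = trk S0 by [].
by apply/eqP; rewrite eq_le p1 p2.
Qed.

End One.
End TraceNorm.

(** * Channels *)

Section Channels.
Variable C : numClosedFieldType.

Lemma sum_pair (S T : finType) (f : S * T -> C) : \sum_p f p = \sum_a \sum_b f (a, b).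
Proof. by rewrite pair_bigA; apply: eq_bigr => -[]. Qed.

Lemma isTN_exists (I : finType) (M : I -> I -> C) : hermk M -> exists r, isTN M r.
Proof. by move=> /isTN_exists_spectral [S [_ _ t]]; exists (trk S). Qed.

Lemma isTN_reindex (I J : finType) (M : I -> I -> C) r (f : J -> I) (g : I -> J) :
  cancel f g -> cancel g f -> isTN M r -> isTN (fun j j' => M (f j) (f j')) r.
Proof.
move=> fg gf [[A [B [a b e ->]]] m].
have bij : bijective f by exists g.
have tf (X : I -> I -> C) : trk (fun j j' => X (f j) (f j')) = trk X.
  by rewrite /trk [RHS](reindex f) //; apply: onW_bij.
split.
  exists (fun j j' => A (f j) (f j')), (fun j j' => B (f j) (f j')).
  by split; rewrite ?tf //; try exact: psdk_pull.
move=> A' B' a' b' e'.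
have tg (X : J -> J -> C) : trk (fun j j' => X (g j) (g j')) = trk X.
  by rewrite /trk [RHS](reindex g) //; apply: onW_bij; exists f.
have := m _ _ (psdk_pull g a') (psdk_pull g b'); rewrite !tg; apply=> i j.
by rewrite -e' !gf.
Qed.

Definition adjk (I J : finType) (X : I -> J -> C) : J -> I -> C := fun j i => (X i j)^*.

Lemma hermk_adj (I : finType) (X : I -> I -> C) : hermk X <-> adjk X = X.
Proof.
split=> [h|e i j]; first by apply: kerext => i j; rewrite /adjk -h.
by rewrite -{1}e.
Qed.

Section Maps.
Variable D : finType.
Notation K := (D -> D -> C).
Implicit Types (Phi A B G V : K -> K).

Definition linm Phi := forall a X Y,
  Phi (fun i j => X i j + a * Y i j) = (fun i j => Phi X i j + a * Phi Y i j).
Definition liftk (J : finType) Phi (X : D * J -> D * J -> C) : D * J -> D * J -> C :=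
  fun p q => Phi (fun a a' => X (a, p.2) (a', q.2)) p.1 q.1.
Definition cpm Phi := forall n (X : D * 'I_n -> D * 'I_n -> C),
  psdk X -> psdk (liftk Phi X).
Definition tpm Phi := forall X, trk (Phi X) = trk X.
Definition hpm Phi := forall X, Phi (adjk X) = adjk (Phi X).
Definition contr A B := forall n (F : D * 'I_n -> D * 'I_n -> C) a b,
  hermk F -> isTN (liftk A F) a -> isTN (liftk B F) b -> b <= a.

Lemma linm0 Phi : linm Phi -> Phi (fun _ _ => 0) = (fun _ _ => 0).
Proof.
move=> h; have := h (-1) (fun _ _ => 0) (fun _ _ => 0).
have -> : (fun _ _ : D => 0 + -1 * 0 : C) = (fun _ _ => 0) by apply: kerext => *; ring.
by move=> ->; apply: kerext => i j; ring.
Qed.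

Lemma linmZ Phi a X : linm Phi -> Phi (fun i j => a * X i j) = (fun i j => a * Phi X i j).
Proof.
move=> h; have := h a (fun _ _ => 0) X; rewrite (linm0 h).
have -> : (fun i j => 0 + a * X i j) = (fun i j => a * X i j) by apply: kerext => *; ring.
by move=> ->; apply: kerext => i j; ring.
Qed.

Lemma linmD Phi X Y : linm Phi ->
  Phi (fun i j => X i j + Y i j) = (fun i j => Phi X i j + Phi Y i j).
Proof.
move=> h; have := h 1 X Y.
have -> : (fun i j => X i j + 1 * Y i j) = (fun i j => X i j + Y i j) by apply: kerext => *; ring.
by move=> ->; apply: kerext => i j; ring.
Qed.

Lemma linmB Phi X Y : linm Phi ->
  Phi (fun i j => X i j - Y i j) = (fun i j => Phi X i j - Phi Y i j).
Proof.
move=> h; have := h (-1) X Y.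
have -> : (fun i j => X i j + -1 * Y i j) = (fun i j => X i j - Y i j) by apply: kerext => *; ring.
by move=> ->; apply: kerext => i j; ring.
Qed.

Lemma linm_sum Phi (T : finType) (F : T -> K) : linm Phi ->
  Phi (fun i j => \sum_t F t i j) = (fun i j => \sum_t Phi (F t) i j).
Proof.
move=> h.
suff H (s : seq T) : Phi (fun i j => \sum_(t <- s) F t i j)
    = (fun i j => \sum_(t <- s) Phi (F t) i j) by apply: H.
elim: s => [|t s IH].
  have -> : (fun i j => \sum_(t <- [::]) F t i j) = (fun _ _ => 0).
    by apply: kerext => i j; rewrite big_nil.
  by rewrite linm0 //; apply: kerext => i j; rewrite big_nil.
have -> : (fun i j => \sum_(t <- t :: s) F t i j) = (fun i j => F t i j + \sum_(t <- s) F t i j).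
  by apply: kerext => i j; rewrite big_cons.
by rewrite linmD // IH; apply: kerext => i j; rewrite big_cons.
Qed.

Lemma cpm_pos Phi X : cpm Phi -> psdk X -> psdk (Phi X).
Proof.
move=> cp x; have := cp 1%N _ (psdk_pull (fun p : D * 'I_1 => p.1) x).
by move/(psdk_pull (fun a : D => (a, ord0))).
Qed.

Lemma cpm_herm Phi X : linm Phi -> cpm Phi -> hermk X -> hermk (Phi X).
Proof.
move=> lin cp h.
set s := \sum_i \sum_j `|X i j|.
have s0 : 0 <= s by rewrite sumr_ge0 // => i _; rewrite sumr_ge0.
have h1 := psdk_herm (cpm_pos cp (psdk_shift h)).
have h2 := psdk_herm (cpm_pos cp (@psdk1 C D s s0)).
have -> : Phi X = (fun i j =>
    Phi (fun i j => X i j + s * (i == j)%:R) i j - Phi (fun i j => s * (i == j)%:R) i j).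
  rewrite -linmB //; congr Phi; apply: kerext => i j; ring.
by move=> i j; rewrite rmorphB /= -h1 -h2.
Qed.

Lemma cpm_hpm Phi : linm Phi -> cpm Phi -> hpm Phi.
Proof.
move=> lin cp X.
pose X1 : K := fun i j => (X i j + adjk X i j).
pose X2 : K := fun i j => 'i * (X i j - adjk X i j).
have h1 : hermk X1 by move=> i j; rewrite /X1 /adjk rmorphD /= conjCK addrC.
have h2 : hermk X2.
  by move=> i j; rewrite /X2 /adjk rmorphM rmorphB /= conjCi conjCK; ring.
have p1 := cpm_herm lin cp h1; have p2 := cpm_herm lin cp h2.
rewrite {}/X1 {}/X2 in p1 p2 h1 h2.
move: p1 p2; rewrite linmD // linmZ // linmB // => p1 p2.
apply: kerext => i j; rewrite {2}/adjk.
have := p1 i j; have := p2 i j; rewrite rmorphD rmorphM rmorphB /= conjCi => e2 e1.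
have {}e2 : Phi X i j - Phi (adjk X) i j = (Phi (adjk X) j i)^* - (Phi X j i)^*.
  apply: (mulfI (neq0Ci C)); rewrite e2; ring.
have : 2%:R * Phi (adjk X) i j = 2%:R * (Phi X j i)^*.
  transitivity ((Phi X i j + Phi (adjk X) i j) - (Phi X i j - Phi (adjk X) i j)); first by ring.
  by rewrite e1 e2; ring.
by move/(mulfI); apply; rewrite pnatr_eq0.
Qed.

Lemma tr_liftk (J : finType) Phi (X : D * J -> D * J -> C) : tpm Phi ->
  trk (liftk Phi X) = trk X.
Proof.
move=> tp; rewrite /trk !sum_pair exchange_big [RHS]exchange_big /=; apply: eq_bigr => j _.
exact: (tp (fun a a' => X (a, j) (a', j))).
Qed.

Lemma hermk_lift (J : finType) Phi (F : D * J -> D * J -> C) : hpm Phi -> hermk F ->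
  hermk (liftk Phi F).
Proof.
move=> hp h p q; rewrite /liftk.
have -> : (fun a a' => F (a, p.2) (a', q.2)) = adjk (fun a a' => F (a, q.2) (a', p.2)).
  by apply: kerext => a a'; rewrite /adjk -h.
by rewrite hp.
Qed.

Lemma contr1 A B X a b : contr A B -> hermk X -> isTN (A X) a -> isTN (B X) b -> b <= a.
Proof.
move=> c h ta tb.
have c1 : cancel (fun p : D * 'I_1 => p.1) (fun a => (a, ord0)) by case=> x y; rewrite [y]ord1.
have c2 : cancel (fun a : D => (a, ord0 : 'I_1)) (fun p : D * 'I_1 => p.1) by [].
apply: (c 1%N (fun p q => X p.1 q.1)); first by move=> i j; apply: h.
  exact: (isTN_reindex c1 c2 ta).
exact: (isTN_reindex c1 c2 tb).
Qed.

(** Makes [A X |-> B X] well defined. Contractivity sees hermitian arguments only; a general [X] is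
    reached through its hermitian and antihermitian parts, which [A] also kills because it commutes
    with the adjoint. *)
Lemma contr_ker A B X : linm A -> linm B -> hpm A -> hpm B -> contr A B ->
  A X = (fun _ _ => 0) -> B X = (fun _ _ => 0).
Proof.
move=> lA lB hA hB c e.
have tn0 : isTN (fun _ _ : D => 0 : C) 0.
  rewrite -[X in isTN _ X](_ : trk (fun _ _ : D => 0 : C) = 0); last by rewrite /trk big1.
  by apply: isTN_psd; apply: psdk0.
have H Y : hermk Y -> A Y = (fun _ _ => 0) -> B Y = (fun _ _ => 0).
  move=> hY e0.
  have hBY : hermk (B Y) by rewrite hermk_adj -hB (proj1 (hermk_adj _) hY).
  have [b tb] := isTN_exists hBY.
  have le0 : b <= 0 by apply: (contr1 c hY _ tb); rewrite e0.
  case: tb => [[P [N [p n eB eb]]] _].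
  have tp := psdk_tr_ge0 p; have tn := psdk_tr_ge0 n.
  have : trk P + trk N == 0 by rewrite eq_le -eb le0 eb addr_ge0.
  rewrite paddr_eq0 // => /andP[/eqP t1 /eqP t2].
  by apply: kerext => i j; rewrite eB (psdk_tr0 p t1) (psdk_tr0 n t2) subrr.
have eadj : A (adjk X) = (fun _ _ => 0) by rewrite hA e; apply: kerext => i j; rewrite /adjk conjC0.
have h1 : B (fun i j => X i j + adjk X i j) = (fun _ _ => 0).
  apply: H; first by move=> i j; rewrite /adjk rmorphD /= conjCK addrC.
  by rewrite linmD // e eadj; apply: kerext => i j; rewrite addr0.
have h2 : B (fun i j => 'i * (X i j - adjk X i j)) = (fun _ _ => 0).
  apply: H; first by move=> i j; rewrite /adjk rmorphM rmorphB /= conjCi conjCK; ring.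
  by rewrite linmZ // linmB // e eadj; apply: kerext => i j; rewrite subr0 mulr0.
rewrite linmD // in h1; rewrite linmZ // linmB // in h2.
apply: kerext => i j.
have e1 := congr1 (fun f => f i j) h1; have e2 := congr1 (fun f => f i j) h2.
move: e1 e2 => /= e1 /eqP; rewrite mulf_eq0 (negbTE (neq0Ci C)) /= subr_eq0 => /eqP e2.
move: e1; rewrite -e2 -mulr2n => /eqP; rewrite mulrn_eq0 /= => /eqP //.
Qed.

Lemma contr_kerE A B X Y : linm A -> linm B -> hpm A -> hpm B -> contr A B ->
  A X = A Y -> B X = B Y.
Proof.
move=> lA lB hA hB c e.
have := contr_ker (X := fun i j => X i j - Y i j) lA lB hA hB c.
rewrite (linmB _ _ lA) (linmB _ _ lB) e => h.
have {}h := h (kerext (fun i j => subrr _)).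
apply: kerext => i j; apply/eqP; rewrite -subr_eq0.
by have := congr1 (fun f => f i j) h => /= ->.
Qed.

Lemma hermk_map Phi X : hpm Phi -> hermk X -> hermk (Phi X).
Proof. by move=> h /hermk_adj e; apply/hermk_adj; rewrite -h e. Qed.

Lemma ext_surj A B G : linm A -> linm B -> hpm A -> hpm B -> tpm A -> tpm B ->
  contr A B -> linm G -> (forall X, A (G X) = X) ->
  exists V, [/\ linm V, cpm V, tpm V & forall X, B X = V (A X)].
Proof.
move=> lA lB hA hB tA tB c lG AG.
have kerE := contr_kerE lA lB hA hB c.
have tV : tpm (fun X => B (G X)) by move=> X; rewrite tB -tA AG.
exists (fun X => B (G X)); split=> //.
- by move=> a X Y; rewrite lG lB.
- move=> n X x.
  (* [G] is only linear and may fail to preserve hermiticity, while [contr] asks for a hermitian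
     kernel. The hermitian part of the lifted preimage still maps to [X] under [A], as [X] is
     hermitian. *)
  pose F := fun p q : D * 'I_n => 2^-1 * (liftk G X p q + adjk (liftk G X) p q).
  have hF : hermk F.
    move=> p q; rewrite /F /adjk rmorphM rmorphD /= conjCK fmorphV /= conjC_nat addrC //.
  have two : 2%:R != 0 :> C by rewrite pnatr_eq0.
  have blk (j j' : 'I_n) : A (fun a a' => F (a, j) (a', j')) = (fun a a' => X (a, j) (a', j')).
    rewrite /F linmZ // linmD //.
    have -> : A (fun a a' => liftk G X (a, j) (a', j')) = (fun a a' => X (a, j) (a', j')).
      exact: (AG (fun a a' => X (a, j) (a', j'))).
    have -> : (fun a a' => adjk (liftk G X) (a, j) (a', j'))
       = adjk (G (fun a a' => X (a, j') (a', j))) by [].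
    rewrite hA AG; apply: kerext => a a'; rewrite /adjk -(psdk_herm x); by field.
  have eA : liftk A F = X.
    by apply: kerext => -[a j] [a' j']; rewrite /liftk /= blk.
  have eB : liftk B F = liftk (fun X => B (G X)) X.
    apply: kerext => -[a j] [a' j']; rewrite /liftk /=.
    by rewrite (kerE _ (G (fun a a' => X (a, j) (a', j')))) // blk AG.
  have [b tb] := isTN_exists (hermk_lift hB hF).
  suff : psdk (liftk B F) by rewrite eB.
  apply: (psd_of_isTN tb).
  rewrite (tr_liftk F tB) -(tr_liftk F tA) eA; apply: (c _ _ _ _ hF _ tb); rewrite eA; exact: isTN_psd.
- by move=> X; apply: kerE; rewrite AG.
Qed.
End Maps.

(** * Completely positive maps from Choi operators *)

Section Choi.
Variables (E D : finType) (M : E * D -> E * D -> C) (W : E -> D -> C).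

(** The map with Choi operator [M] in a basis that need not be orthonormal: with [W] the dual basis,
    the inner sum is the coefficient of [X] at [(i, j)], and the block [(i, j)] of [M] is the image
    of that basis element. *)
Definition choim (X : D -> D -> C) : D -> D -> C := fun a a' =>
  \sum_i \sum_j M (i, a) (j, a') * (\sum_b \sum_c (W i b)^* * X b c * W j c).

Lemma linm_choi : linm choim.
Proof.
move=> x X Y; apply: kerext => a a'; rewrite /choim mulr_sumr -big_split; apply: eq_bigr => i _ /=.
rewrite mulr_sumr -big_split; apply: eq_bigr => j _ /=.
rewrite mulrCA -mulrDr; congr (_ * _); rewrite mulr_sumr -big_split; apply: eq_bigr => b _ /=.
rewrite mulr_sumr -big_split; apply: eq_bigr => c _ /=; ring.
Qed.

(** Factoring [M = S S] with [S] hermitian gives a Kraus form: the lifted map is a sum over [k] of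
    congruences, built from the rows of [S], of the transform [Y] of [X] by [W]. *)
Lemma cpm_choi : psdk M -> cpm choim.
Proof.
move=> /psdk_gram [S [_ eM hS]] n X x.
pose Y (p q : E * 'I_n) := \sum_b \sum_c (W p.1 b)^* * X (b, p.2) (c, q.2) * W q.1 c.
have y : psdk Y.
  have := psdk_congr (fun (r : D * 'I_n) (p : E * 'I_n) => (r.2 == p.2)%:R * W p.1 r.1) x.
  congr psdk; apply: kerext => -[i s] [j t]; rewrite /Y /=.
  rewrite sum_pair /=.
  apply: eq_bigr => b _; rewrite -[RHS](sum_delta (fun s' => \sum_c (W i b)^* * X (b, s') (c, t) * W j c) s).
  apply: eq_bigr => s' _.
  rewrite sum_pair /=.
  rewrite mulr_sumr; apply: eq_bigr => c _.
  rewrite -[X (b, s') (c, t)](sum_delta (fun t' => X (b, s') (c, t')) t) mulr_sumr mulr_suml mulr_sumr.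
  apply: eq_bigr => t' _; rewrite rmorphM /= conjC_nat; ring.
have -> : liftk choim X = (fun p q => \sum_k \sum_r \sum_r'
    ((r.2 == p.2)%:R * S k (r.1, p.1))^* * Y r r' * ((r'.2 == q.2)%:R * S k (r'.1, q.1))).
  apply: kerext => -[a s] [a' t]; rewrite /liftk /choim /=.
  under [RHS]eq_bigr => k _.
    rewrite sum_pair /=.
    over.
  rewrite [RHS]exchange_big /=; apply: eq_bigr => i _.
  rewrite [RHS]exchange_big /= -[LHS](sum_delta (fun s' => \sum_j M (i, a) (j, a') * Y (i, s') (j, t)) s).
  apply: eq_bigr => s' _.
  under [RHS]eq_bigr => k _.
    rewrite sum_pair /=.
    over.
  rewrite [RHS]exchange_big /= mulr_sumr; apply: eq_bigr => j _.
  rewrite [RHS]exchange_big /= -[Y (i, s') (j, t)](sum_delta (fun t' => Y (i, s') (j, t')) t) !mulr_sumr.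
  apply: eq_bigr => t' _; rewrite -eM /mulk mulr_suml mulr_sumr; apply: eq_bigr => k _.
  rewrite rmorphM /= conjC_nat -hS; ring.
by apply: psdk_sum => k; apply: psdk_congr.
Qed.

Lemma choim_rank1 (u : E -> D -> C) k l :
  (forall i k, \sum_b (W i b)^* * u k b = (i == k)%:R) ->
  choim (fun b c => u k b * (u l c)^*) = (fun a a' => M (k, a) (l, a')).
Proof.
move=> h; apply: kerext => a a'; rewrite /choim.
have e i j : \sum_b \sum_c (W i b)^* * (u k b * (u l c)^*) * W j c = (i == k)%:R * (j == l)%:R.
  have -> : (j == l)%:R = (\sum_b (W j b)^* * u l b)^* by rewrite h conjC_nat.
  rewrite -h mulr_suml; apply: eq_bigr => b _; rewrite rmorph_sum mulr_sumr.
  apply: eq_bigr => c _; rewrite rmorphM /= conjCK; ring.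
rewrite -[RHS](sum_delta (fun i => M (i, a) (l, a')) k); apply: eq_bigr => i _.
rewrite -[M (i, a) (l, a')](sum_delta (fun j => M (i, a) (j, a')) l) mulr_sumr.
apply: eq_bigr => j _; rewrite e; ring.
Qed.
End Choi.

End Channels.

(** * Shorted operators and Toeplitz forms *)

Section Shorted.
Variable C : numClosedFieldType.
Variable D : finType.
Implicit Types (P Q K S X : D -> D -> C) (v w : D -> C).

Definition bf X v w : C := \sum_a \sum_b (v a)^* * X a b * w b.
Definition crs X v w : C := bf X v w + (bf X v w)^*.
Definition psd2 Q X S := forall v w, 0 <= qf Q v + crs X v w + qf S w.
(* K is the least K with [[K, X], [X^*, S]] >= 0, i.e. X S^+ X^*. *)
Definition isShort K X S := psd2 K X S /\ forall v, exists w, qf K v + crs X v w + qf S w = 0.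

Lemma bf0l X w : bf X (fun=> 0) w = 0.
Proof. by rewrite /bf big1 // => a _; rewrite big1 // => b _; rewrite conjC0 !mul0r. Qed.

Lemma qf0 (I : finType) (M : I -> I -> C) : qf M (fun=> 0) = 0.
Proof. by rewrite /qf big1 // => a _; rewrite big1 // => b _; rewrite mulr0. Qed.

Lemma psd2_psdk Q X S : psd2 Q X S -> psdk S.
Proof. by move=> h w; have := h (fun=> 0) w; rewrite qf0 /crs bf0l conjC0 !add0r. Qed.

Lemma conj_mul_normr (z : C) : z^* * z = `|z| ^+ 2.
Proof. by rewrite mulrC normCK. Qed.

(** In an eigenbasis of [S] the form splits into one variable per eigenvalue, and the square is
    completed in each. The hypothesis enters through the null directions of [S], where it forces the
    linear term to vanish. *)
Lemma short_exists Q X S : psd2 Q X S -> exists K, isShort K X S.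
Proof.
move=> h; have s := psd2_psdk h.
have [u [l [rl o c e]]] := spectralk (psdk_herm s).
have lp k : 0 <= l k by apply: (psdk_eig_ge0 k o); rewrite -e.
pose g k v := \sum_a (v a)^* * \sum_b X a b * (u k b)^*.
pose t k w := \sum_j u k j * w j.
have wE w b : w b = \sum_k (u k b)^* * t k w.
  rewrite /t -[LHS](sum_delta w b).
  under [RHS]eq_bigr do rewrite mulr_sumr.
  rewrite [RHS]exchange_big; apply: eq_bigr => j _ /=.
  by rewrite eq_sym -c mulr_suml; apply: eq_bigr => k _; rewrite mulrA.
have bfE v w : bf X v w = \sum_k g k v * t k w.
  transitivity (\sum_a \sum_b \sum_k (v a)^* * X a b * (u k b)^* * t k w).
    apply: eq_bigr => a _; apply: eq_bigr => b _; rewrite [w b]wE mulr_sumr.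
    by apply: eq_bigr => k _; rewrite mulrA.
  under eq_bigr do rewrite exchange_big /=.
  rewrite exchange_big; apply: eq_bigr => k _ /=; move: (t k w) => z.
  rewrite /g mulr_suml; apply: eq_bigr => a _; rewrite mulr_sumr mulr_suml.
  by apply: eq_bigr => b _; rewrite mulrA.
have qS w : qf S w = \sum_k l k * `|t k w| ^+ 2 by rewrite e qf_fc.
have tE k (z : 'I_#|D| -> C) : t k (fun b => \sum_k' (u k' b)^* * z k') = z k.
  rewrite /t -[RHS](sum_delta z k).
  under eq_bigr do rewrite mulr_sumr.
  rewrite exchange_big; apply: eq_bigr => k' _ /=.
  rewrite eq_sym -o mulr_suml; apply: eq_bigr => b _; ring.
have g0 k v : l k = 0 -> g k v = 0.
  move=> l0; apply/eqP; apply: contraT => gn0.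
  (* Along a null direction of [S] the form is affine; this [r] brings it to
     [qf Q v - (qf Q v + 1) = -1]. *)
  pose r := - ((g k v)^* * ((qf Q v + 1) / (2%:R * `|g k v| ^+ 2))).
  have := h v (fun b => \sum_k' (u k' b)^* * (if k' == k then r else 0)).
  rewrite qS big1 => [|k' _]; last first.
    by rewrite tE; case: eqP => [->|_]; rewrite ?l0 ?mul0r // normr0 expr0n /= mulr0.
  rewrite /crs bfE (bigD1 k) //= big1 => [|k' /negbTE nk]; last by rewrite tE nk mulr0.
  rewrite tE eqxx !addr0.
  have ng : `|g k v| != 0 by rewrite normr_eq0.
  have qr : (qf Q v)^* = qf Q v.
    apply/CrealP; apply: ger0_real.
    by have := h v (fun=> 0); rewrite qf0 /crs /bf big1 ?conjC0 ?addr0 // => a _; rewrite big1 // => b _; rewrite mulr0.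
  have -> : g k v * r = - ((qf Q v + 1) / 2%:R).
    transitivity (- (g k v * (g k v)^* * ((qf Q v + 1) / (2%:R * `|g k v| ^+ 2)))).
      by rewrite /r; ring.
    rewrite -(normCK (g k v)); field; exact: ng.
  rewrite rmorphN rmorphM rmorphD fmorphV /= conjC1 conjC_nat qr.
  have -> : qf Q v + (- ((qf Q v + 1) / 2) - (qf Q v + 1) / 2) = -1 by field.
  by rewrite ler0N1.
pose cc k a := \sum_b X a b * (u k b)^*.
(* As the inverse of 0 is 0, null eigenvalues contribute nothing: this is the pseudoinverse. *)
pose K a a' := \sum_k (l k)^-1 * (cc k a * (cc k a')^*).
have qK v : qf K v = \sum_k (l k)^-1 * `|g k v| ^+ 2.
  rewrite /K qf_sum; apply: eq_bigr => k _; rewrite qfZ qf_rank1; congr (_ * _).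
  rewrite -norm_conjC rmorph_sum; congr (`|_| ^+ 2); apply: eq_bigr => a _.
  by rewrite rmorphM /= conjCK mulrC.
have tot v w : qf K v + crs X v w + qf S w =
    \sum_k ((l k)^-1 * `|g k v| ^+ 2 + (g k v * t k w + (g k v * t k w)^*) + l k * `|t k w| ^+ 2).
  rewrite !big_split /= -qK -qS /crs bfE rmorph_sum //.
have sq k v w : l k != 0 ->
  (l k)^-1 * `|g k v| ^+ 2 + (g k v * t k w + (g k v * t k w)^*) + l k * `|t k w| ^+ 2
  = l k * `|t k w + (g k v)^* / l k| ^+ 2.
  move=> l0; rewrite !normCK !rmorphD !rmorphM /= fmorphV /= conjCK (CrealP (rl k)).
  by field.
exists K; split.
  move=> v w; rewrite tot sumr_ge0 // => k _.
  have [l0|l0] := eqVneq (l k) 0.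
    by rewrite g0 // l0 normr0 expr0n /= !(mul0r, mulr0) conjC0 !addr0.
  by rewrite sq // mulr_ge0 // exprn_ge0.
move=> v; exists (fun b => \sum_k' (u k' b)^* * (- ((g k' v)^* / l k'))).
rewrite tot big1 // => k _; have [l0|l0] := eqVneq (l k) 0.
  by rewrite g0 // l0 normr0 expr0n /= !(mul0r, mulr0) conjC0 !addr0.
by rewrite sq // tE addNr normr0 expr0n /= mulr0.
Qed.

Lemma short_min Q K X S v : psd2 Q X S -> isShort K X S -> qf K v <= qf Q v.
Proof.
by move=> h [_ /(_ v) [w e]]; rewrite -subr_ge0; have := h v w; congr (0 <= _); 
  rewrite -[RHS]addr0 -e; ring.
Qed.

(** The minimiser of each step is the starting vector of the next, so [- qf (K k) v0] is a value of
    the block Toeplitz form with [v0] as block 0, the diagonal term of [v0] left out. *)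
Lemma short_chain P X (K : nat -> D -> D -> C) k :
  K 0%N = (fun _ _ => 0) ->
  (forall j, (j < k)%N -> isShort (K j.+1) X (fun a b => P a b - K j a b)) ->
  forall v0, exists v : nat -> D -> C, v 0%N = v0 /\
    qf (K k) v0 + \sum_(j < k) (crs X (v j) (v j.+1) + qf P (v j.+1)) = 0.
Proof.
move=> K0; elim: k => [|k IH] h v0.
  exists (fun=> v0); split=> //; rewrite big_ord0 addr0 K0.
  by rewrite /qf big1 // => a _; rewrite big1 // => b _; rewrite mulr0 mul0r.
have [_ /(_ v0) [w e]] := h k (ltnSn k).
have [v [vw ev]] := IH (fun j jk => h j (ltnW jk)) w.
exists (fun j => if j is j'.+1 then v j' else v0); split=> //.
rewrite big_ord_recl /= vw.
rewrite (eq_bigr (fun i : 'I_k => crs X (v i) (v i.+1) + qf P (v i.+1))) //.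
move: e; rewrite qfB; move: ev; set s := \sum_(j < k) _ => ev e.
transitivity (qf (K k.+1) v0 + crs X v0 w + (qf P w - qf (K k) w) + (qf (K k) w + s)).
  ring.
by rewrite e ev addr0.
Qed.
End Shorted.

(** * Block tridiagonal operators and their quadratic forms *)

Section Tri.
Variable C : numClosedFieldType.
Variables (D : finType) (n : nat).
Implicit Types (P X : D -> D -> C).

(** The second index is the ancilla, so a map on [D] acts on [P] and [X] alone. The weights [x] and
    [y] allow a Toeplitz operator to be modified at its first corner. *)
Definition tri (x y : nat -> C) P X : D * 'I_n -> D * 'I_n -> C := fun p q =>
  (p.2 == q.2)%:R * x p.2 * P p.1 q.1
  + ((q.2 == p.2.+1 :> nat)%:R * y p.2 * X p.1 q.1
     + (p.2 == q.2.+1 :> nat)%:R * y q.2 * (X q.1 p.1)^*).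

Lemma tri_herm x y P X : (forall i, x i \is Num.real) -> (forall i, y i \is Num.real) ->
  hermk P -> hermk (tri x y P X).
Proof.
move=> rx ry hP [a i] [b j]; rewrite /tri /= !rmorphD !rmorphM /= !conjC_nat conjCK.
rewrite -hP !(CrealP (ry _)) (CrealP (rx _)).
have -> : (i == j)%:R * x i = (j == i)%:R * x j by rewrite eq_sym; case: eqP => [->|_]; rewrite ?mul0r.
ring.
Qed.

Lemma liftk_tri (Phi : (D -> D -> C) -> D -> D -> C) x y P X : linm Phi -> hpm Phi ->
  liftk Phi (tri x y P X) = tri x y (Phi P) (Phi X).
Proof.
move=> lin hp; apply: kerext => -[a i] [b j]; rewrite /liftk /tri /=.
rewrite (linmD _ _ lin) (linmD _ _ lin) !(linmZ _ _ lin).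
by have -> : Phi (fun a a' => (X a' a)^*) = adjk (Phi X) by exact: (hp X).
Qed.

Lemma sum_succ m (f : 'I_m.+1 -> 'I_m.+1 -> C) (i : 'I_m.+1) :
  \sum_(j < m.+1) (j == i.+1 :> nat)%:R * f i j =
  if (i < m)%N then f i (inord i.+1) else 0.
Proof.
case: ltnP => im.
  rewrite (bigD1 (inord i.+1)) //= inordK ?ltnS // eqxx mul1r big1 ?addr0 //.
  move=> j /eqP nj; case: eqP => [e|_]; rewrite ?mul0r //; case: nj.
  by apply: val_inj; rewrite /= inordK ?ltnS.
rewrite big1 // => j _; rewrite (_ : (j == i.+1 :> nat) = false) ?mul0r //.
by apply/negP => /eqP e; have := ltn_ord j; rewrite e ltnS ltnNge im.
Qed.
End Tri.

Section TriForm.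
Variable C : numClosedFieldType.
Variables (D : finType) (n : nat).

Lemma sum_succ2 (f : nat -> nat -> C) :
  \sum_(i < n.+1) \sum_(j < n.+1) (j == i.+1 :> nat)%:R * f i j = \sum_(i < n) f i i.+1.
Proof.
rewrite (eq_bigr (fun i : 'I_n.+1 => if (i < n)%N then f i i.+1 else 0)).
  rewrite big_ord_recr /= ltnn addr0; apply: eq_bigr => i _ /=; by rewrite ltn_ord.
move=> i _; rewrite (sum_succ (fun i j : 'I_n.+1 => f i j)).
by case: ltnP => // im; rewrite inordK ?ltnS.
Qed.

Lemma qf_tri (x y : nat -> C) (P X : D -> D -> C) (v : nat -> D -> C) :
  (forall i, y i \is Num.real) ->
  qf (tri (n := n.+1) x y P X) (fun p => v p.2 p.1) =
  \sum_(i < n.+1) x i * qf P (v i) + \sum_(i < n) y i * crs X (v i) (v i.+1).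
Proof.
move=> ry; rewrite {1}/qf sum_pair exchange_big /=.
under eq_bigr => i _.
  under eq_bigr => a _.
    rewrite sum_pair exchange_big /=.
    over.
  rewrite exchange_big /=.
  over.
transitivity (\sum_(i < n.+1) \sum_(j < n.+1)
  ((i == j)%:R * x i * qf P (v i) + ((j == i.+1 :> nat)%:R * (y i * bf X (v i) (v j))
  + (i == j.+1 :> nat)%:R * (y j * (bf X (v j) (v i))^*)))).
  apply: eq_bigr => i _; apply: eq_bigr => j _.
  have -> : (i == j)%:R * x i * qf P (v i) = (i == j)%:R * x i * bf P (v i) (v j).
    by case: eqP => [->|_] //; rewrite !mul0r.
  have -> : (bf X (v j) (v i))^* = \sum_a \sum_b (v i a)^* * (X b a)^* * v j b.
    rewrite /bf rmorph_sum /=; under eq_bigr do rewrite rmorph_sum.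
    rewrite [LHS]exchange_big /=; apply: eq_bigr => b _; apply: eq_bigr => a _.
    rewrite !rmorphM /= conjCK; ring.
  rewrite /bf !mulr_sumr -!big_split; apply: eq_bigr => a _ /=.
  rewrite !mulr_sumr -!big_split; apply: eq_bigr => b _ /=.
  rewrite /tri /=; ring.
under [LHS]eq_bigr => i _ do rewrite big_split /= [X in _ + X]big_split /=.
rewrite !big_split /=; congr (_ + _).
  apply: eq_bigr => i _.
  rewrite (eq_bigr (fun j : 'I_n.+1 => (j == i)%:R * (x i * qf P (v i)))) ?sum_delta //.
  by move=> j _; rewrite eq_sym mulrA.
rewrite (sum_succ2 (fun i j => y i * bf X (v i) (v j))) exchange_big /=.
rewrite (sum_succ2 (fun j i => y j * (bf X (v j) (v i))^*)) -big_split.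
by apply: eq_bigr => i _; rewrite /= -mulrDr.
Qed.

Lemma vec_blocks (V : D * 'I_n.+1 -> C) :
  V = (fun p => (fun i a => V (a, inord i)) (p.2 : nat) p.1).
Proof. by apply: funext => -[a i] /=; rewrite inord_val. Qed.
End TriForm.

(** * Iterated Schur complements and the bound on their traces *)

Section Toeplitz.
Variable C : numClosedFieldType.

Lemma eps_le0 (x M : C) : x \is Num.real -> 0 <= M ->
  (forall e, 0 < e -> e <= 1 -> x <= e * M) -> x <= 0.
Proof.
move=> rx M0 h; rewrite real_leNgt // ?real0 //; apply/negP => x0.
have p : 0 < x + M by rewrite ltr_wpDr.
(* At this [e] the bound amounts to [x + M <= M]. *)
have := h (x / (x + M)) (divr_gt0 x0 p); rewrite ler_pdivrMr // mul1r lerDl M0 => /(_ isT).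
by rewrite mulrAC ler_pdivlMr // mulrDr gerDr lt_geF // mulr_gt0.
Qed.

Lemma qf_comb (I : finType) (M : I -> I -> C) (a b : I -> C) s :
  qf M (fun i => a i + s * b i) =
  qf M a + s * bf M a b + s^* * bf M b a + s^* * s * qf M b.
Proof.
rewrite /qf /bf !mulr_sumr -!big_split; apply: eq_bigr => i _ /=.
rewrite !mulr_sumr -!big_split; apply: eq_bigr => j _ /=; rewrite rmorphD rmorphM /=; ring.
Qed.

(** The difference of the two sides is [e] times the form at [a - e^-1 b]. It separates one block of
    a vector from the rest at the price of a factor close to 1. *)
Lemma qf_split (I : finType) (M : I -> I -> C) (a b : I -> C) e : psdk M -> 0 < e ->
  qf M (fun i => a i + b i) <= (1 + e) * qf M a + (1 + e^-1) * qf M b.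
Proof.
move=> m e0; have e0' := lt0r_neq0 e0.
have -> : (fun i => a i + b i) = (fun i => a i + 1 * b i) by apply: funext => i; rewrite mul1r.
have := m (fun i => a i + (- e^-1) * b i).
rewrite !qf_comb conjC1 rmorphN fmorphV /= (CrealP (gtr0_real e0)) => h.
rewrite -subr_ge0; have := mulr_ge0 (ltW e0) h; congr (0 <= _); field; exact: e0'.
Qed.

Lemma qf_le_tr (I : finType) (M : I -> I -> C) v : psdk M ->
  qf M v <= trk M * (\sum_i `|v i|) ^+ 2.
Proof.
move=> m; apply: le_trans (real_ler_norm (ger0_real (m v))) _.
apply: le_trans (ler_norm_sum _ _ _) _.
move: (trk M) (fun i j => psdk_entry i j m) => t ht.
rewrite expr2 mulr_suml mulr_sumr; apply: ler_sum => i _.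
apply: le_trans (ler_norm_sum _ _ _) _; rewrite mulr_sumr mulr_sumr; apply: ler_sum => j _.
by rewrite !normrM norm_conjC mulrA [t * _]mulrC ler_wpM2r // ler_wpM2l.
Qed.

(** Contractivity for negative parts: the trace norm of [F] is [tr F] plus twice the least trace of
    a positive [N] with [F + N >= 0], and both maps preserve [tr F]. *)
Lemma contr_neg (D : finType) (A B : (D -> D -> C) -> D -> D -> C) n
    (F N : D * 'I_n -> D * 'I_n -> C) :
  hpm A -> hpm B -> tpm A -> tpm B -> contr A B -> hermk F -> psdk N ->
  psdk (fun p q => liftk A F p q + N p q) ->
  exists N', [/\ psdk N', psdk (fun p q => liftk B F p q + N' p q) & trk N' <= trk N].
Proof.
move=> hA hB tA tB c hF pN pAN.
have [a ta] := isTN_exists (hermk_lift hA hF).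
have [b tb] := isTN_exists (hermk_lift hB hF).
have ab := c _ _ _ _ hF ta tb.
have : a <= trk F + trk N + trk N.
  case: ta => _ /(_ _ _ pAN pN); rewrite trkD tr_liftk //; apply=> i j; ring.
case: tb => [[X [Y [x y e eb]]] _] => aF.
exists Y; split=> //.
  by have -> : (fun p q => liftk B F p q + Y p q) = X by apply: kerext => p q; rewrite e; ring.
have eX : trk X = trk F + trk Y.
  by rewrite -(tr_liftk F tB) -trkD; apply: eq_bigr => i _; rewrite e; ring.
have := le_trans ab aF; rewrite eb eX -!addrA lerD2l -!mulr2n.
by rewrite lerMn2r.
Qed.

Section Main.
Variables (D : finType) (A B : (D -> D -> C) -> D -> D -> C) (u0 u1 : D -> C).
Variables (XP XC : D -> D -> C).
Hypotheses (lA : linm A) (lB : linm B) (hA : hpm A) (hB : hpm B) (tA : tpm A) (tB : tpm B).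
Hypothesis (cAB : contr A B).
Hypothesis hXP : hermk XP.
Hypothesis AXP : A XP = (fun a b => u0 a * (u0 b)^* + u1 a * (u1 b)^*).
Hypothesis AXC : A XC = (fun a b => u0 a * (u1 b)^*).
Let P := B XP.
Let X := B XC.
Let p (v : D -> C) := \sum_a (u0 a)^* * v a.
Let q (v : D -> C) := \sum_a (u1 a)^* * v a.

Lemma qf_AXP v : qf (A XP) v = (p v)^* * p v + (q v)^* * q v.
Proof. by rewrite AXP qfD !qf_rank1 !conj_mul_normr. Qed.

Lemma bf_AXC v w : bf (A XC) v w = (p v)^* * q w.
Proof.
rewrite AXC /bf /p /q rmorph_sum mulr_suml; apply: eq_bigr => a _.
rewrite mulr_sumr; apply: eq_bigr => b _; rewrite rmorphM /= conjCK; ring.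
Qed.

Lemma crs_AXC v w : crs (A XC) v w = (p v)^* * q w + p v * (q w)^*.
Proof. by rewrite /crs bf_AXC rmorphM /= conjCK. Qed.

(** Under [A] the form is a sum of squares [|p (v i) + q (v (i+1))|^2] and two boundary squares
    [|p (v n)|^2], [|q (v 0)|^2]. Contractivity with an ancilla of dimension [n + 1] carries
    positivity over to [P] and [X]. *)
Lemma toep_psd n (v : nat -> D -> C) :
  0 <= \sum_(i < n.+1) qf P (v i) + \sum_(i < n) crs X (v i) (v i.+1).
Proof.
pose F := tri (n := n.+1) (fun=> 1) (fun=> 1) XP XC.
have r1 (i : nat) : (1 : C) \is Num.real by [].
have hF : hermk F by apply: tri_herm.
have pA : psdk (liftk A F).
  move=> V; pose w i a := V (a, inord i).
  have -> : V = (fun p => w p.2 p.1) := vec_blocks V.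
  rewrite liftk_tri // qf_tri //; move: w => {V} w.
  rewrite (eq_bigr (fun i : 'I_n.+1 => (p (w i))^* * p (w i) + (q (w i))^* * q (w i))); last first.
    by move=> i _; rewrite mul1r qf_AXP.
  rewrite (eq_bigr (fun i : 'I_n => (p (w i))^* * q (w i.+1) + p (w i) * (q (w i.+1))^*)); last first.
    by move=> i _; rewrite mul1r crs_AXC.
  rewrite big_split /= big_ord_recr /= [X in _ + X + _]big_ord_recl /=.
  set a := (p (w n))^* * p (w n); set b := (q (w 0%N))^* * q (w 0%N).
  have -> (s t r : C) : s + a + (b + t) + r = a + b + (s + t + r) by ring.
  rewrite -!big_split /= addr_ge0 //; first by rewrite addr_ge0 // /a /b conj_mul_normr exprn_ge0.
  rewrite sumr_ge0 // => i _ /=.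
  rewrite [leRHS](_ : _ = `|p (w i) + q (w i.+1)| ^+ 2) ?exprn_ge0 //.
  rewrite normCK rmorphD /= /bump /= add1n; ring.
have pB : psdk (liftk B F).
  have [b tb] := isTN_exists (hermk_lift hB hF).
  apply: (psd_of_isTN tb); rewrite tr_liftk // -(tr_liftk F tA).
  exact: (cAB hF (isTN_psd pA) tb).
have := pB (fun p => v p.2 p.1); rewrite liftk_tri // qf_tri //.
congr (0 <= _ + _); by apply: eq_bigr => i _; rewrite mul1r.
Qed.

(** The default value allows [Kseq] to be defined before the shorted operators are known to exist;
    existence is part of the induction in [Kseq_short]. *)
Definition shsel (S : D -> D -> C) : D -> D -> C :=
  match pselect (exists K, isShort K X S) with
  | left h => sval (cid h) | right _ => fun _ _ => 0 end.

Fixpoint Kseq (k : nat) : D -> D -> C :=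
  if k is k'.+1 then shsel (fun a b => P a b - Kseq k' a b) else fun _ _ => 0.

(** Continuing [v] by the chain of minimisers that starts at [w] replaces the tail of the Toeplitz
    form by [- qf (Kseq k) w]. Positivity on [k + 2] blocks is then the inequality that the next
    Schur complement needs. *)
Lemma Kseq_short k : isShort (Kseq k.+1) X (fun a b => P a b - Kseq k a b).
Proof.
have [m] := ubnP k; elim: m k => // m IH k; rewrite ltnS => km.
have H : psd2 P X (fun a b => P a b - Kseq k a b).
  move=> v w.
  have [w' [e0 e]] := short_chain (K := Kseq) (erefl _) (fun j jk => IH j (leq_trans jk km)) w.
  have := toep_psd k.+1 (fun j => if j is j'.+1 then w' j' else v).
  rewrite big_ord_recl big_ord_recl [X in _ + X]big_ord_recl /= e0 qfB; congr (0 <= _).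
  move: e; rewrite big_split /=.
  set s1 := \sum_(i < k) crs _ _ _; set s2 := \sum_(i < k) qf _ _ => e.
  have {e} -> : qf (Kseq k) w = - (s1 + s2) by apply/eqP; rewrite -addr_eq0 e.
  ring.
rewrite /= /shsel; case: pselect => [h|]; last by case; exact: short_exists H.
exact: (svalP (cid h)).
Qed.

Lemma Kseq_psd k : psdk (Kseq k).
Proof.
case: k => [|k]; first exact: psdk0.
have [h _] := Kseq_short k => v; have := h v (fun=> 0).
rewrite qf0 /crs (_ : bf _ _ _ = 0) ?conjC0 ?addr0 //.
by rewrite /bf big1 // => a _; rewrite big1 // => b _; rewrite mulr0.
Qed.

Let c := \sum_a u0 a * (u0 a)^*.

Lemma norm_u0_ge0 : 0 <= c.
Proof. by apply: sumr_ge0 => a _; rewrite -normCK exprn_ge0. Qed.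

(* Cutting the corner of the Toeplitz operator down to [eps] costs negativity
   [eps^2 |u0|^2] before [B], hence at most as much after it. *)
Lemma corner_negativity n e : 0 < e ->
  exists N : D * 'I_n.+2 -> D * 'I_n.+2 -> C, [/\ psdk N, trk N <= e ^+ 2 * c &
   psdk (fun r s => tri (fun i => (i != 0)%:R) (fun i => if i == 0%N then e else 1) P X r s + N r s)].
Proof.
move=> e0; set x : nat -> C := fun i => _; set y : nat -> C := fun i => _.
pose F := tri (n := n.+2) x y XP XC.
have re := gtr0_real e0.
have rx i : x i \is Num.real by rewrite realn.
have ry i : y i \is Num.real by rewrite /y; case: ifP.
have hF : hermk F by apply: tri_herm.
(* The square of this vector supplies the missing term [e^2 |p (v 0)|^2], which completes
   [|e p (v 0) + q (v 1)|^2]. *)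
pose w (r : D * 'I_n.+2) := (r.2 == ord0)%:R * (e * u0 r.1).
have tw : trk (fun r s => w r * (w s)^*) = e ^+ 2 * c.
  rewrite /trk sum_pair /c mulr_sumr; apply: eq_bigr => a _.
  rewrite (eq_bigr (fun b : 'I_n.+2 => (b == ord0)%:R * (e^+2 * (u0 a * (u0 a)^*)))) ?sum_delta //.
  move=> b _; rewrite /w /= !rmorphM /= conjC_nat (CrealP re).
  by case: (b == ord0); rewrite /= ?mul0r ?mul1r //; ring.
have [|N [pN pB tN]] := contr_neg hA hB tA tB cAB hF (psdk_rank1 w).
  move=> V; rewrite qfD qf_rank1 liftk_tri //.
  pose v i a := V (a, inord i).
  have -> : \sum_j (w j)^* * V j = e * p (v 0%N).
    rewrite sum_pair /p mulr_sumr; apply: eq_bigr => a _.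
    rewrite (eq_bigr (fun b => (b == ord0)%:R * (e * (u0 a)^* * V (a, b)))) ?sum_delta.
      rewrite /v (_ : inord 0 = ord0) ?mulrA //; by apply: val_inj; rewrite /= inordK.
    by move=> b _; rewrite /w /= !rmorphM /= conjC_nat (CrealP re); ring.
  have -> : V = (fun p => v p.2 p.1) := vec_blocks V.
  rewrite qf_tri // big_ord_recl [X in _ + X + _]big_ord_recl /= /x /y /= mul0r add0r.
  move: v => {V} v.
  rewrite (eq_bigr (fun i : 'I_n.+1 => (p (v i.+1))^* * p (v i.+1) + (q (v i.+1))^* * q (v i.+1))); last first.
    by move=> i _; rewrite mul1r qf_AXP.
  rewrite (eq_bigr (fun i : 'I_n => (p (v i.+1))^* * q (v i.+2) + p (v i.+1) * (q (v i.+2))^*)); last first.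
    by move=> i _; rewrite mul1r crs_AXC.
  rewrite big_split /= big_ord_recr /= [X in _ + X + _ + _]big_ord_recl /= crs_AXC normCK rmorphM /= (CrealP re).
  set a := (p (v n.+1))^* * p (v n.+1); set b := (q (v 1%N))^* * q (v 1%N).
  have -> (s t r : C) : s + a + (b + t) + (e * ((p (v 0%N))^* * q (v 1%N) + p (v 0%N) * (q (v 1%N))^*) + r)
      + e * p (v 0%N) * (e * (p (v 0%N))^*) =
     a + (e * p (v 0%N) + q (v 1%N)) * (e * (p (v 0%N))^* + (q (v 1%N))^*) + (s + t + r) by rewrite /b; ring.
  rewrite -!big_split /= addr_ge0 //.
    rewrite addr_ge0 //; first by rewrite /a conj_mul_normr exprn_ge0.
    have -> : e * (p (v 0%N))^* + (q (v 1%N))^* = (e * p (v 0%N) + q (v 1%N))^*.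
      by rewrite rmorphD rmorphM /= (CrealP re).
    by rewrite -normCK exprn_ge0.
  rewrite sumr_ge0 // => i _ /=.
  rewrite [leRHS](_ : _ = `|p (v i.+1) + q (v i.+2)| ^+ 2) ?exprn_ge0 //.
  rewrite normCK rmorphD /= /bump /= !add1n; ring.
exists N; split=> //; first by rewrite -tw.
by move: pB; rewrite liftk_tri.
Qed.

Lemma crsZl (Y : D -> D -> C) e v w : e \is Num.real -> crs Y (fun a => e * v a) w = e * crs Y v w.
Proof.
move=> re; rewrite /crs.
have -> : bf Y (fun a => e * v a) w = e * bf Y v w.
  rewrite /bf mulr_sumr; apply: eq_bigr => a _; rewrite mulr_sumr; apply: eq_bigr => b _.
  rewrite rmorphM /= (CrealP re); ring.
by rewrite rmorphM /= (CrealP re) mulrDr.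
Qed.

(** The chains that attain the diagonal entries of [Kseq] are tested against the form with the weak
    corner. As [tr N <= e^2 c], the corner of [N], magnified by [e^-2], costs at most [c] summed
    over [a], and the other blocks cost [O(e)]; then [e] tends to 0. *)
Lemma Kseq_tr k : trk (Kseq k) <= c.
Proof.
case: k => [|n]; first by rewrite /trk big1 ?norm_u0_ge0.
have ch a := short_chain (K := Kseq) (k := n.+1) (erefl _) (fun j _ => Kseq_short j) (fun b => (b == a)%:R).
have [v vP] := choice ch.
pose V2 a (r : D * 'I_n.+2) := if r.2 == ord0 then 0 else v a r.2 r.1.
pose s := \sum_a (\sum_r `|V2 a r|) ^+ 2.
have s0 : 0 <= s by apply: sumr_ge0 => a _; rewrite exprn_ge0 // sumr_ge0.
have rK : trk (Kseq n.+1) \is Num.real by rewrite ger0_real // psdk_tr_ge0 //; apply: Kseq_psd.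
have rc := ger0_real norm_u0_ge0.
rewrite -subr_le0; apply: (eps_le0 (M := c + 2%:R * c * s)).
- by rewrite rpredB.
- by rewrite addr_ge0 ?mulr_ge0 ?norm_u0_ge0.
move=> e e0 e1; have re := gtr0_real e0; have en0 := lt0r_neq0 e0.
have [N [pN tN pS]] := corner_negativity n e0.
have one a : Kseq n.+1 a a <= (1 + e) * (e ^- 2 * N (a, ord0) (a, ord0)) + (1 + e^-1) * (trk N * (\sum_r `|V2 a r|) ^+ 2).
  have [va0 eva] := vP a.
  (* The factor [e^-1] undoes the weight [e] of the first coupling, and block 0 has no diagonal term
     that could see it; so the form takes the value [- Kseq n.+1 a a] for every [e]. *)
  pose vv i := if i == 0%N then (fun b => e^-1 * v a 0%N b) else v a i.
  have := pS (fun r => vv r.2 r.1); rewrite qfD qf_tri; last by move=> i; case: ifP.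
  rewrite big_ord_recl [X in _ + X + _]big_ord_recl /= mul0r add0r crsZl ?rpredV // mulVKf //.
  have -> : \sum_(i < n.+1) 1%:R * qf P (v a (bump 0 i)) + (crs X (v a 0%N) (v a 1%N) +
     \sum_(i < n) 1 * crs X (v a (bump 0 i)) (v a (bump 0 i).+1)) = - Kseq n.+1 a a.
    have -> : Kseq n.+1 a a = qf (Kseq n.+1) (fun b => (b == a)%:R).
      rewrite /qf -[LHS](sum_delta (fun b => Kseq n.+1 b a) a); apply: eq_bigr => b _.
      rewrite -(sum_delta (fun b' => Kseq n.+1 b b') a) mulr_sumr; apply: eq_bigr => b' _.
      rewrite conjC_nat; ring.
    move/eqP: eva; rewrite addr_eq0 => /eqP ->; rewrite opprK big_split /= [LHS]addrC; congr (_ + _).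
      by rewrite [RHS]big_ord_recl; congr (_ + _); apply: eq_bigr => i _; rewrite mul1r.
    by apply: eq_bigr => i _; rewrite mul1r.
  rewrite addrC subr_ge0 => /le_trans; apply.
  pose V1 (r : D * 'I_n.+2) := (r == (a, ord0))%:R * e^-1.
  have -> : (fun r : D * 'I_n.+2 => vv r.2 r.1) = (fun r => V1 r + V2 a r).
    apply: funext => -[b i]; rewrite /vv /V1 /V2 /= xpair_eqE va0 [i == ord0](_ : _ = (i == 0%N :> nat)) //.
    by case: ifP => _; rewrite ?andbT ?andbF ?addr0 ?mul0r ?add0r // mulrC.
  apply: le_trans (qf_split V1 (V2 a) pN e0) _.
  apply: lerD; last by apply: ler_wpM2l; [rewrite addr_ge0 ?invr_ge0 ?ltW | apply: qf_le_tr].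
  rewrite [qf N V1](_ : _ = e ^- 2 * N (a, ord0) (a, ord0)) //.
  rewrite /qf -(sum_delta (fun r => N r (a, ord0)) (a, ord0)) mulr_sumr; apply: eq_bigr => r _.
  rewrite -[N r (a, ord0)](sum_delta (fun r' => N r r') (a, ord0)) !mulr_sumr; apply: eq_bigr => r' _.
  rewrite /V1 rmorphM /= conjC_nat fmorphV /= (CrealP re) -exprVn; ring.
rewrite lerBlDr.
apply: le_trans (ler_sum _ (fun a _ => one a)) _.
rewrite big_split /= -!mulr_sumr.
have h1 : e ^- 2 * \sum_a N (a, ord0) (a, ord0) <= c.
  rewrite mulrC ler_pdivrMr ?exprn_gt0 // mulrC; apply: le_trans tN.
  rewrite /trk sum_pair; apply: ler_sum => a _; rewrite (bigD1 ord0) //= lerDl.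
  by apply: sumr_ge0 => i _; apply: psdk_diag.
have h2 : (1 + e^-1) * (trk N * s) <= e * (2%:R * c * s).
  apply: (@le_trans _ _ ((1 + e^-1) * (e ^+ 2 * c * s))).
    by apply: ler_wpM2l; [rewrite addr_ge0 ?invr_ge0 ?ltW | apply: ler_wpM2r].
  have -> : (1 + e^-1) * (e ^+ 2 * c * s) = e * ((e + 1) * (c * s)) by field.
  rewrite ler_pM2l // -mulrA ler_wpM2r ?mulr_ge0 ?norm_u0_ge0 // mulr2n lerD2r //.
apply: le_trans (lerD (ler_wpM2l _ h1) h2) _; first by rewrite addr_ge0 ?ltW.
rewrite [leRHS](_ : _ = (1 + e) * c + e * (2%:R * c * s)) //; ring.
Qed.
End Main.
End Toeplitz.

(** * Entrywise limits of complex kernels *)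

Notation RC := (complex R).

(** Polarisation in the shape produced by [qf_comb]: it recovers an off-diagonal entry from values
    of the form, so that convergence of forms gives convergence of entries. *)
Lemma polarize (C : numClosedFieldType) (x y s t : C) :
  2%:R^-1 * (x + 1 * s + 1^* * t + 1^* * 1 * y - x - y -
    'i * (x + 'i * s + 'i^* * t + 'i^* * 'i * y - x - y)) = s.
Proof.
rewrite conjC1 conjCi; have i2 : 'i * 'i = -1 :> C by rewrite -expr2 sqrCi.
transitivity (2%:R^-1 * (s + t - ('i * 'i) * (s - t) + ('i * 'i + 1) * 'i * y)); first by ring.
by rewrite i2; field.
Qed.

Section ComplexLimits.

Definition ccv (z : nat -> RC) (l : RC) :=
  Un_cv (fun n => complex.Re (z n)) (complex.Re l) /\ Un_cv (fun n => complex.Im (z n)) (complex.Im l).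

Lemma Un_cv_ext u v l : (forall n, u n = v n) -> Un_cv u l -> Un_cv v l.
Proof. by move=> h; rewrite (_ : u = v) //; apply: funext. Qed.

Lemma Un_cv_const (a : R) : Un_cv (fun=> a) a.
Proof.
move=> e e0; exists 0%N => n _; rewrite /Rdist Rminus_diag_eq // Rabs_R0.
exact: e0.
Qed.

Lemma ccv_const a : ccv (fun=> a) a.
Proof. by split; apply: Un_cv_const. Qed.

Lemma ccvD z w a b : ccv z a -> ccv w b -> ccv (fun n => z n + w n) (a + b).
Proof.
move=> [z1 z2] [w1 w2]; split.
  have := CV_plus _ _ _ _ z1 w1; rewrite (_ : complex.Re (a + b) = Rplus (complex.Re a) (complex.Re b)).
    by apply: Un_cv_ext => n; case: (z n) (w n) => [? ?] [? ?].
  by case: a {z1 z2} => ? ?; case: b {w1 w2}.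
have := CV_plus _ _ _ _ z2 w2; rewrite (_ : complex.Im (a + b) = Rplus (complex.Im a) (complex.Im b)).
  by apply: Un_cv_ext => n; case: (z n) (w n) => [? ?] [? ?].
by case: a {z1 z2} => ? ?; case: b {w1 w2}.
Qed.

Lemma ccvM z w a b : ccv z a -> ccv w b -> ccv (fun n => z n * w n) (a * b).
Proof.
move=> [z1 z2] [w1 w2]; split.
  have := CV_minus _ _ _ _ (CV_mult _ _ _ _ z1 w1) (CV_mult _ _ _ _ z2 w2).
  rewrite (_ : complex.Re (a * b) = Rminus (Rmult (complex.Re a) (complex.Re b)) (Rmult (complex.Im a) (complex.Im b))).
    by apply: Un_cv_ext => n; case: (z n) (w n) => [? ?] [? ?].
  by case: a {z1 z2} => ? ?; case: b {w1 w2}.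
have := CV_plus _ _ _ _ (CV_mult _ _ _ _ z1 w2) (CV_mult _ _ _ _ z2 w1).
rewrite (_ : complex.Im (a * b) = Rplus (Rmult (complex.Re a) (complex.Im b)) (Rmult (complex.Im a) (complex.Re b))).
  by apply: Un_cv_ext => n; case: (z n) (w n) => [? ?] [? ?].
by case: a {z1 z2} => ? ?; case: b {w1 w2}.
Qed.

Lemma ccvB z w a b : ccv z a -> ccv w b -> ccv (fun n => z n - w n) (a - b).
Proof.
move=> hz hw; have := ccvD hz (ccvM (ccv_const (-1)) hw); rewrite mulN1r.
by congr (ccv _ _); apply: funext => n; rewrite mulN1r.
Qed.

Lemma ccv_sum (T : finType) (z : T -> nat -> RC) (a : T -> RC) :
  (forall t, ccv (z t) (a t)) -> ccv (fun n => \sum_t z t n) (\sum_t a t).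
Proof.
move=> h; elim: index_enum => [|t s IH].
  rewrite big_nil; have := ccv_const 0; congr (ccv _ _); apply: funext => n; by rewrite big_nil.
rewrite big_cons; have := ccvD (h t) IH; congr (ccv _ _); apply: funext => n; by rewrite big_cons.
Qed.

Lemma ccv_shift z a : ccv z a -> ccv (fun n => z n.+1) a.
Proof.
move=> [z1 z2]; split.
  by have := CV_shift' _ 1%N _ z1; apply: Un_cv_ext => n; rewrite plusE addn1.
by have := CV_shift' _ 1%N _ z2; apply: Un_cv_ext => n; rewrite plusE addn1.
Qed.

Lemma Un_cv_ge0 u l : (forall n, Rle 0 (u n)) -> Un_cv u l -> Rle 0 l.
Proof.
move=> h c; apply: (@Rle_cv_lim (fun=> 0) u 0 l) => //; exact: Un_cv_const.
Qed.

Lemma ccv_ge0 z a : (forall n, 0 <= z n) -> ccv z a -> 0 <= a.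
Proof.
move=> h [c1 c2]; rewrite lecE /=; apply/andP; split.
  apply/eqP; apply: (UL_sequence _ _ _ c2).
  apply: (Un_cv_ext _ (Un_cv_const 0)) => n; by have := h n; rewrite lecE /= => /andP[/eqP -> _].
apply/RleP; apply: (Un_cv_ge0 _ c1) => n; apply/RleP.
by have := h n; rewrite lecE /= => /andP[_].
Qed.

Lemma ccv_le z w a b : (forall n, z n <= w n) -> ccv z a -> ccv w b -> a <= b.
Proof.
move=> h hz hw; rewrite -subr_ge0; apply: ccv_ge0 (ccvB hw hz) => n; by rewrite subr_ge0.
Qed.

Lemma ccv_mono (z : nat -> RC) (M : RC) :
  (forall n, 0 <= z n) -> (forall n, z n <= z n.+1) -> (forall n, z n <= M) ->
  exists l, ccv z l.
Proof.
move=> h0 h1 h2.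
have g : Un_growing (fun n => complex.Re (z n)).
  by move=> n; apply/RleP; have := h1 n; rewrite lecE => /andP[].
have b : has_ub (fun n => complex.Re (z n)).
  exists (complex.Re M) => x [n ->]; apply/RleP; have := h2 n; by rewrite lecE => /andP[].
have [l cl] := growing_cv _ g b.
exists (Complex l 0); split=> //=.
apply: (Un_cv_ext _ (Un_cv_const 0)) => n; by have := h0 n; rewrite lecE /= => /andP[/eqP -> _].
Qed.

(** The shorted operator grows as [P - K k] decreases, so the forms [qf (K k) v] increase, and the
    trace bound keeps them bounded. In the limit of the blocks [K k.+1], [X], [P - K k] the same [Q]
    appears in both corners. *)
Lemma short_limit (D : finType) (P X : D -> D -> RC) (K : nat -> D -> D -> RC) (c : RC) :
  K 0%N = (fun _ _ => 0) -> (forall k, psdk (K k)) ->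
  (forall k, isShort (K k.+1) X (fun a b => P a b - K k a b)) ->
  (forall k, trk (K k) <= c) ->
  exists Q, psd2 Q X (fun a b => P a b - Q a b) /\ trk Q <= c.
Proof.
move=> K0 pK sK tK.
have mono k v : qf (K k) v <= qf (K k.+1) v.
  elim: k v => [|k IH] v.
    by rewrite K0 (_ : qf _ v = 0) ?pK // /qf big1 // => a _; rewrite big1 // => b _; rewrite mulr0 mul0r.
  apply: (short_min _ _ (sK k)); have [h _] := sK k.+1 => v' w.
  apply: le_trans (h v' w) _; rewrite lerD2l !qfB lerD2l lerN2; exact: IH.
have bd v k : qf (K k) v <= c * (\sum_i `|v i|) ^+ 2.
  apply: le_trans (qf_le_tr v (pK k)) _; apply: ler_wpM2r => //.
  by rewrite exprn_ge0 // sumr_ge0.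
have qcv v : exists l, ccv (fun k => qf (K k) v) l.
  by apply: (ccv_mono (M := c * (\sum_i `|v i|) ^+ 2)) => // n; apply: pK.
pose dl (a i : D) : RC := (i == a)%:R.
have bfd M a b : bf M (dl a) (dl b) = M a b.
  rewrite /bf -[RHS](sum_delta (fun i => M i b) a); apply: eq_bigr => i _.
  rewrite -[M i b](sum_delta (fun j => M i j) b) mulr_sumr; apply: eq_bigr => j _.
  rewrite /dl conjC_nat; ring.
have ent a b : exists l, ccv (fun k => K k a b) l.
  have [l1 c1] := qcv (fun i => dl a i + 1 * dl b i).
  have [l2 c2] := qcv (fun i => dl a i + 'i * dl b i).
  have [l3 c3] := qcv (dl a); have [l4 c4] := qcv (dl b).
  have c5 := ccvM (ccv_const 2%:R^-1) (ccvB (ccvB (ccvB c1 c3) c4) (ccvM (ccv_const 'i) (ccvB (ccvB c2 c3) c4))).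
  eexists; move: c5; congr (ccv _ _); apply: funext => k; rewrite !qf_comb !bfd.
  exact: polarize.
have [Q cQ] : exists Q : D -> D -> RC, forall a b, ccv (fun k => K k a b) (Q a b).
  have h a : exists f : D -> RC, forall b, ccv (fun k => K k a b) (f b) by have [f hf] := boolp.choice (ent a); exists f.
  by have [Q hQ] := boolp.choice h; exists Q.
have cqf v : ccv (fun k => qf (K k) v) (qf Q v).
  apply: ccv_sum => a; apply: ccv_sum => b.
  by apply: ccvM (ccv_const _); apply: ccvM (cQ a b); apply: ccv_const.
exists Q; split.
  move=> v w.
  have cc := ccvD (ccvD (ccv_shift (cqf v)) (ccv_const (crs X v w))) (ccvB (ccv_const (qf P w)) (cqf w)).
  rewrite qfB; apply: (ccv_ge0 _ cc) => k; rewrite -qfB; by have [h _] := sK k; apply: h.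
have ct : ccv (fun k => trk (K k)) (trk Q) by apply: ccv_sum => a; apply: cQ.
exact: (ccv_le tK ct (ccv_const c)).
Qed.
End ComplexLimits.

(** * Qubits *)

Section Qubit.
Variable C : numClosedFieldType.
Notation K2 := ('I_2 -> 'I_2 -> C).

Lemma sum2 (f : 'I_2 -> C) : \sum_i f i = f 0 + f 1.
Proof.
rewrite !big_ord_recl big_ord0 addr0; congr (f _ + f _); exact: val_inj.
Qed.

Lemma ord2P (i : 'I_2) : i = 0 \/ i = 1.
Proof. by case: i => [[|[|//]] h]; [left|right]; apply: val_inj. Qed.

Lemma ker2 (A B : K2) : A 0 0 = B 0 0 -> A 0 1 = B 0 1 -> A 1 0 = B 1 0 -> A 1 1 = B 1 1 -> A = B.
Proof. by move=> *; apply: kerext => i j; case: (ord2P i) => ->; case: (ord2P j) => ->. Qed.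

Definition det2 (X : K2) := X 0 0 * X 1 1 - X 0 1 * X 1 0.

Lemma herm2 (X : K2) : hermk X -> [/\ (X 0 0)^* = X 0 0, (X 1 1)^* = X 1 1 & X 1 0 = (X 0 1)^*].
Proof. by move=> h; split; rewrite -h. Qed.

Lemma rank1_of_det0 (H : K2) : hermk H -> det2 H = 0 -> 0 <= trk H ->
  exists al : 'I_2 -> C, H = (fun a b => al a * (al b)^*).
Proof.
move=> h; have [r0 r1 e10] := herm2 h; rewrite /det2 /trk sum2 e10 -normCK => /eqP.
rewrite subr_eq0 => /eqP d t.
have R0 : H 0 0 \is Num.real by apply/CrealP.
have R1 : H 1 1 \is Num.real by apply/CrealP.
have p : 0 <= H 0 0 * H 1 1 by rewrite d exprn_ge0.
have p0 : 0 <= H 0 0.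
  rewrite real_leNgt ?real0 //; apply/negP => n0.
  move: p; rewrite nmulr_rge0 // => p; move: t; rewrite lt_geF //.
  by apply: (le_lt_trans _ n0); rewrite gerDl.
have p1 : 0 <= H 1 1.
  have [z|n0] := eqVneq (H 0 0) 0; first by move: t; rewrite z add0r.
  have p00 : 0 < H 0 0 by rewrite lt_def n0 p0.
  by move: p; rewrite pmulr_rge0.
have [z|n0] := eqVneq (H 0 0) 0.
  have q0 : H 0 1 = 0.
    by apply/eqP; rewrite -normr_eq0 -sqrf_eq0 -d z mul0r.
  exists (fun a => if a == 0 then 0 else sqrtC (H 1 1)).
  apply: ker2 => /=; rewrite ?conjC0 ?mul0r ?mulr0 ?e10 ?q0 ?conjC0 //.
  by rewrite geC0_conj ?sqrtC_ge0 // -expr2 sqrtCK.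
have s0 : sqrtC (H 0 0) != 0 by rewrite sqrtC_eq0.
have sr : (sqrtC (H 0 0))^* = sqrtC (H 0 0) by rewrite geC0_conj ?sqrtC_ge0.
have ss : sqrtC (H 0 0) * sqrtC (H 0 0) = H 0 0 by rewrite -expr2 sqrtCK.
exists (fun a => if a == 0 then sqrtC (H 0 0) else (H 0 1)^* / sqrtC (H 0 0)).
apply: ker2 => /=; rewrite ?rmorphM ?fmorphV /= ?conjCK ?sr ?ss //.
- by field.
- by rewrite e10; field.
- transitivity (H 0 0 * H 1 1 / (sqrtC (H 0 0) * sqrtC (H 0 0))).
    by rewrite ss mulrAC divff // mul1r.
  rewrite d normCK; by field.
Qed.

Lemma psd_det0 (H : K2) : hermk H -> det2 H = 0 -> 0 <= trk H -> psdk H.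
Proof. by move=> h d t; have [al ->] := rank1_of_det0 h d t; apply: psdk_rank1. Qed.

Lemma det2_ge0 (H : K2) : psdk H -> 0 <= det2 H.
Proof.
move=> /psdk_gram [S [_ <- hS]]; have [_ _ e10] := herm2 hS; have [r0 r1 _] := herm2 hS.
rewrite /det2 /mulk !sum2 e10.
have -> : (S 0 0 * S 0 0 + S 0 1 * (S 0 1)^*) * ((S 0 1)^* * S 0 1 + S 1 1 * S 1 1) -
  (S 0 0 * S 0 1 + S 0 1 * S 1 1) * ((S 0 1)^* * S 0 0 + S 1 1 * (S 0 1)^*)
  = (S 0 0 * S 1 1 - S 0 1 * (S 0 1)^*) ^+ 2 by ring.
by rewrite -realEsqr; apply/CrealP; rewrite rmorphB !rmorphM /= conjCK r0 r1 [in X in _ - X]mulrC.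
Qed.

(** The left side is the squared difference of the eigenvalues, which is the squared trace norm when
    [det2 H <= 0]. The gap is [4 (det A + det B + tr (A B))], a sum of nonnegative terms. *)
Lemma isTN_lower2 (H : K2) r : isTN H r -> (trk H) ^+ 2 - 4%:R * det2 H <= r ^+ 2.
Proof.
move=> [[A [B [a b e ->]]] _].
have -> : trk H = trk A - trk B by rewrite -trkB; apply: eq_bigr => i _; rewrite e.
have ab := trk_mul_ge0 a b; rewrite !sum2 in ab.
rewrite -subr_ge0; have := mulr_ge0 (ler0n C 4) (addr_ge0 (addr_ge0 (det2_ge0 a) (det2_ge0 b)) ab).
congr (0 <= _); rewrite /det2 /trk !sum2 !e; ring.
Qed.

Lemma isTN_upper2 (H : K2) r : isTN H r -> det2 H <= 0 -> r ^+ 2 <= (trk H) ^+ 2 - 4%:R * det2 H.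
Proof.
move=> tn d; have h := isTN_herm tn; have [r0 r1 e10] := herm2 h.
have rt : trk H \is Num.real by apply/CrealP; rewrite /trk sum2 rmorphD /= r0 r1.
set t := trk H in rt *; set D := det2 H in d *.
have p : 0 <= t ^+ 2 - 4%:R * D.
  by rewrite addr_ge0 // -?realEsqr // oppr_ge0 pmulr_rle0 ?ltr0n.
set s := sqrtC (t ^+ 2 - 4%:R * D).
have s0 : 0 <= s by rewrite sqrtC_ge0.
have ss : s ^+ 2 = t ^+ 2 - 4%:R * D by rewrite sqrtCK.
have sr : s^* = s by rewrite geC0_conj.
have tr := CrealP rt.
have r0' := isTN_ge0 tn.
suff rs : r <= s by rewrite -ss ler_pXn2r ?nnegrE.
have [z|n0] := eqVneq s 0.
  have t2 : t ^+ 2 = 0.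
    apply/eqP; rewrite eq_le -realEsqr rt andbT.
    have : t ^+ 2 + (- (4%:R * D)) = 0 by rewrite -ss z expr0n.
    by move/eqP; rewrite addr_eq0 opprK => /eqP ->; rewrite pmulr_rle0 ?ltr0n.
  have t0 : t = 0 by apply/eqP; rewrite -sqrf_eq0 t2.
  have D0 : D = 0.
    have : t ^+ 2 - 4%:R * D = 0 by rewrite -ss z expr0n.
    by rewrite t2 sub0r => /eqP; rewrite oppr_eq0 mulf_eq0 pnatr_eq0 /= => /eqP.
  have pH : psdk H by apply: psd_det0; rewrite // -/t t0.
  by rewrite (isTN_uniq tn (isTN_psd pH)) -/t t0 s0.
(* The eigenvalues of [H] are [lp] and [- lm], so [(H + lm) / s] and [(lp - H) / s] are its spectral
   projections. Both shifted operators have determinant 0, so their positivity is a matter of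
   trace. *)
pose lp := (t + s) / 2%:R; pose lm := (s - t) / 2%:R.
have half : 0 <= 2%:R^-1 :> C by rewrite invr_ge0 ler0n.
have ts : `|t| <= s.
  rewrite -(ler_pXn2r (ltn0Sn 1)) ?nnegrE // real_normK // ss lerDl oppr_ge0.
  by rewrite pmulr_rle0 ?ltr0n.
have lp0 : 0 <= lp.
  by rewrite mulr_ge0 // addrC -[t]opprK subr_ge0 (le_trans _ ts) // -normrN real_ler_norm // rpredN.
have lm0 : 0 <= lm by rewrite mulr_ge0 // subr_ge0 (le_trans _ ts) // real_ler_norm.
have tE : t = H 0 0 + H 1 1 by rewrite /t /trk sum2.
have DE : D = H 0 0 * H 1 1 - H 0 1 * (H 0 1)^* by rewrite /D /det2 e10.
have ds : s * s = t * t - 4%:R * D by rewrite -!expr2.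
have pA : psdk (fun a b => H a b + lm * (a == b)%:R).
  apply: psd_det0.
  - by move=> i j; rewrite rmorphD rmorphM /= -h conjC_nat (geC0_conj lm0) eq_sym.
  - rewrite /det2 /= !(mulr0, addr0, mulr1) e10.
    transitivity (4%:R^-1 * (4%:R * D + (s * s - t * t))); last by rewrite ds; ring.
    by rewrite DE tE /lm tE; field.
  - by rewrite /trk sum2 /= mulr1 addrACA -tE /lm (_ : t + _ = s) //; field.
have pB : psdk (fun a b => lp * (a == b)%:R - H a b).
  apply: psd_det0.
  - by move=> i j; rewrite rmorphB rmorphM /= -h conjC_nat (geC0_conj lp0) eq_sym.
  - rewrite /det2 /= !(mulr0, add0r, sub0r, mulr1) e10.
    transitivity (4%:R^-1 * (4%:R * D + (s * s - t * t))); last by rewrite ds; ring.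
    by rewrite DE tE /lp tE; field.
  - by rewrite /trk sum2 /= mulr1 addrACA -opprD -tE /lp (_ : _ - t = s) //; field.
case: tn => _ m.
have si : 0 <= s^-1 by rewrite invr_ge0.
have := m _ _ (psdkZ (mulr_ge0 lp0 si) pA) (psdkZ (mulr_ge0 lm0 si) pB).
rewrite !trkZ trkD trkB trkZ (_ : trk (fun i j : 'I_2 => (i == j)%:R) = 2%:R); last first.
  by rewrite /trk sum2 !eqxx.
rewrite trkZ (_ : trk (fun i j : 'I_2 => (i == j)%:R) = 2%:R); last first.
  by rewrite /trk sum2 !eqxx.
rewrite -/t (_ : lp / s * _ + _ = s); first by apply=> i j; rewrite /lp /lm; field.
by rewrite /lp /lm; field.
Qed.
End Qubit.

(** * Extension from an image spanned by two pure states *)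

Section Qubit2.
Variable C : numClosedFieldType.
Notation K2 := ('I_2 -> 'I_2 -> C).

Definition ketbra (D : finType) (v w : D -> C) : D -> D -> C := fun a b => v a * (w b)^*.

Definition blk (D : finType) (Q X S : D -> D -> C) : 'I_2 * D -> 'I_2 * D -> C := fun p q =>
  if p.1 == 0 then (if q.1 == 0 then Q p.2 q.2 else X p.2 q.2)
  else (if q.1 == 0 then (X q.2 p.2)^* else S p.2 q.2).

Lemma psdk_blk (D : finType) (Q X S : D -> D -> C) : psd2 Q X S -> psdk (blk Q X S).
Proof.
move=> h v; have := h (fun a => v (0, a)) (fun a => v (1, a)); congr (0 <= _).
have -> : crs X (fun a => v (0, a)) (fun a => v (1, a)) =
    \sum_a \sum_b (v (0, a))^* * X a b * v (1, b) + \sum_a \sum_b (v (1, a))^* * (X b a)^* * v (0, b).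
  congr (_ + _); rewrite /bf rmorph_sum; under eq_bigr do rewrite rmorph_sum.
  rewrite [LHS]exchange_big; apply: eq_bigr => a _; apply: eq_bigr => b _ /=.
  rewrite !rmorphM /= conjCK; ring.
have -> (x y z t : C) : x + (y + z) + t = (x + y) + (z + t) by ring.
rewrite /qf [RHS]sum_pair [RHS]sum2 /=; congr (_ + _); rewrite -big_split; apply: eq_bigr => a _ /=;
  by rewrite sum_pair sum2.
Qed.

Lemma dual_basis (u : 'I_2 -> 'I_2 -> C) : det2 u != 0 -> exists W : 'I_2 -> 'I_2 -> C,
  (forall i k, \sum_b (W i b)^* * u k b = (i == k)%:R) /\
  (forall X : K2, X = (fun b c => \sum_k \sum_l (\sum_b \sum_c (W k b)^* * X b c * W l c) * ketbra (u k) (u l) b c)).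
Proof.
rewrite /det2 => d.
pose w (i b : 'I_2) : C := (if i == 0 then (if b == 0 then u 1 1 else - u 1 0)
   else (if b == 0 then - u 0 1 else u 0 0)) / (u 0 0 * u 1 1 - u 0 1 * u 1 0).
exists (fun i b => (w i b)^*).
have h1 i k : \sum_b w i b * u k b = (i == k)%:R.
  by rewrite sum2; case: (ord2P i) => ->; case: (ord2P k) => ->; rewrite /w /=; field.
have h2 b b' : \sum_k u k b * w k b' = (b' == b)%:R.
  by rewrite sum2; case: (ord2P b) => ->; case: (ord2P b') => ->; rewrite /w /=; field.
split; first by move=> i k; rewrite -h1; apply: eq_bigr => b _; rewrite conjCK.
move=> X; apply: kerext => b c; rewrite /ketbra.
rewrite -[LHS](sum_delta (fun b' => X b' c) b).
transitivity (\sum_b' \sum_c' (b' == b)%:R * (c' == c)%:R * X b' c').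
  apply: eq_bigr => b' _; rewrite -[X b' c](sum_delta (fun c' => X b' c') c) mulr_sumr.
  by apply: eq_bigr => c' _; rewrite mulrA.
under [RHS]eq_bigr do under eq_bigr do rewrite mulr_suml.
under [RHS]eq_bigr do rewrite exchange_big /=.
rewrite [RHS]exchange_big; apply: eq_bigr => b' _ /=.
under [RHS]eq_bigr do under eq_bigr do rewrite mulr_suml.
under [RHS]eq_bigr do rewrite exchange_big /=.
rewrite [RHS]exchange_big; apply: eq_bigr => c' _ /=.
have -> : (c' == c)%:R = (\sum_k u k c * w k c')^* by rewrite h2 conjC_nat.
rewrite -h2 rmorph_sum !mulr_suml; apply: eq_bigr => k _; rewrite mulr_sumr mulr_suml.
apply: eq_bigr => l _; rewrite rmorphM /= conjCK; ring.
Qed.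

(** Turns extension into completion: the blocks of a positive Choi operator in the basis [u] are the
    prescribed images, and the condition on partial traces is trace preservation on that basis. *)
Lemma ext_basis (u : 'I_2 -> 'I_2 -> C) (M : 'I_2 * 'I_2 -> 'I_2 * 'I_2 -> C) :
  det2 u != 0 -> psdk M -> (forall k l, \sum_a M (k, a) (l, a) = \sum_a u k a * (u l a)^*) ->
  exists V, [/\ linm V, cpm V, tpm V &
    forall k l, V (ketbra (u k) (u l)) = (fun a a' => M (k, a) (l, a'))].
Proof.
move=> d pM tM; have [W [W1 W2]] := dual_basis d.
have V1 k l : choim M W (ketbra (u k) (u l)) = (fun a a' => M (k, a) (l, a')) by exact: choim_rank1.
have lV := linm_choi M W.
exists (choim M W); split=> //; first exact: cpm_choi.
move=> X; rewrite [in RHS](W2 X) /choim /trk.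
rewrite [LHS]exchange_big [RHS]exchange_big; apply: eq_bigr => k _ /=.
rewrite [LHS]exchange_big [RHS]exchange_big; apply: eq_bigr => l _ /=.
by rewrite -mulr_suml tM mulrC mulr_sumr.
Qed.

Section Pairs.
Variables (A B : K2 -> K2).
Hypotheses (lA : linm A) (lB : linm B) (hA : hpm A) (hB : hpm B) (tA : tpm A) (tB : tpm B).
Hypothesis cAB : contr A B.

Lemma contr_psd X : hermk X -> psdk (A X) -> psdk (B X).
Proof.
move=> h p; have hBX := hermk_map hB h.
have [b tb] := isTN_exists hBX; apply: (psd_of_isTN tb); rewrite tB -tA.
exact: (contr1 cAB h (isTN_psd p) tb).
Qed.

Variables (al be : 'I_2 -> C) (X1 X2 : K2).
Hypotheses (h1 : hermk X1) (h2 : hermk X2).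
Hypotheses (A1 : A X1 = ketbra al al) (A2 : A X2 = ketbra be be).
Let s1 := B X1.
Let s2 := B X2.
Let du := al 0 * be 1 - al 1 * be 0.
Let m := s1 0 0 * s2 1 1 + s1 1 1 * s2 0 0 - s1 0 1 * s2 1 0 - s1 1 0 * s2 0 1.
Let phi := \sum_a al a * (be a)^*.

Lemma psd_s1 : psdk s1. Proof. by apply: contr_psd; rewrite // A1; apply: psdk_rank1. Qed.
Lemma psd_s2 : psdk s2. Proof. by apply: contr_psd; rewrite // A2; apply: psdk_rank1. Qed.

(** [A (X1 - x X2)] has determinant at most 0, where trace and determinant give the trace norm
    exactly. Both maps preserve the trace, so contractivity compares determinants. Here [m] is the
    polarised determinant of [s1] and [s2]. *)
Lemma det_mono x : 0 < x -> - (x * (du * du^*)) <= det2 s1 - x * m + x ^+ 2 * det2 s2.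
Proof.
move=> x0; pose F : K2 := fun i j => X1 i j - x * X2 i j.
have hF : hermk F.
  by move=> i j; rewrite /F rmorphB rmorphM /= -h1 -h2 (CrealP (gtr0_real x0)).
have lin Phi : linm Phi -> Phi F = (fun i j => Phi X1 i j - x * Phi X2 i j).
  by move=> l; rewrite /F (linmB _ (fun i j => x * X2 i j) l) linmZ.
have hAF := hermk_map hA hF.
have hBF := hermk_map hB hF.
have [a ta] := isTN_exists hAF; have [b tb] := isTN_exists hBF.
have ba := contr1 cAB hF ta tb.
have dA : det2 (A F) = - (x * (du * du^*)).
  by rewrite lin // A1 A2 /det2 /ketbra /du rmorphB !rmorphM /=; ring.
have dB : det2 (B F) = det2 s1 - x * m + x ^+ 2 * det2 s2.
  by rewrite lin // /det2 /m /s1 /s2; ring.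
have nA : det2 (A F) <= 0 by rewrite dA oppr_le0 mulr_ge0 ?(ltW x0) // -normCK exprn_ge0.
have := le_trans (isTN_lower2 tb) (le_trans _ (isTN_upper2 ta nA)).
rewrite ler_pXn2r ?nnegrE ?(isTN_ge0 ta) ?(isTN_ge0 tb) // => /(_ ba).
by rewrite tB tA lerD2l lerN2 ler_pM2l ?ltr0n // dA dB.
Qed.

Let dl := sqrtC (det2 s1 * det2 s2).
Let F2 := (s1 0 0 * s2 0 0 + s1 0 1 * s2 1 0 + (s1 1 0 * s2 0 1 + s1 1 1 * s2 1 1)) + 2%:R * dl.

(** [F2] is the squared fidelity of [s1] and [s2], which for 2 x 2 matrices is
    [tr (s1 s2) + 2 sqrt (det s1 det s2)]. The bound follows from [det_mono] by optimising over [x],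
    letting [x] tend to 0 or to infinity when a determinant vanishes. *)
Lemma fidelity : phi * phi^* <= F2.
Proof.
have d1 := det2_ge0 psd_s1; have d2 := det2_ge0 psd_s2.
have [a1 b1 c1] := herm2 (psdk_herm psd_s1); have [a2 b2 c2] := herm2 (psdk_herm psd_s2).
have t1 : s1 0 0 + s1 1 1 = al 0 * (al 0)^* + al 1 * (al 1)^*.
  by have := tB X1; rewrite -(tA X1) A1 /trk !sum2.
have t2 : s2 0 0 + s2 1 1 = be 0 * (be 0)^* + be 1 * (be 1)^*.
  by have := tB X2; rewrite -(tA X2) A2 /trk !sum2.
suff H : m - du * du^* <= 2%:R * dl.
  rewrite -subr_ge0; rewrite -subr_ge0 in H; move: H; congr (0 <= _).
  have -> : F2 = (s1 0 0 + s1 1 1) * (s2 0 0 + s2 1 1) - m + 2%:R * dl by rewrite /F2 /m; ring.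
  rewrite t1 t2 /phi /du sum2 !(rmorphD, rmorphM, rmorphN) /= !conjCK; ring.
have ry : m - du * du^* \is Num.real.
  rewrite rpredB //; last by rewrite -normCK ger0_real ?exprn_ge0.
  apply/CrealP; rewrite /m c1 c2 !(rmorphD, rmorphM, rmorphN) /= !conjCK a1 b1 a2 b2; ring.
have dx x : 0 < x -> x * (m - du * du^*) <= det2 s1 + x ^+ 2 * det2 s2.
  move=> /det_mono h; rewrite -subr_ge0 in h; rewrite -subr_ge0; move: h; congr (0 <= _); ring.
have [z1|n1] := eqVneq (det2 s1) 0.
  rewrite /dl z1 mul0r sqrtC0 mulr0; apply: (eps_le0 ry d2) => e e0 e1.
  by have := dx e e0; rewrite z1 add0r expr2 -mulrA ler_pM2l.
have [z2|n2] := eqVneq (det2 s2) 0.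
  rewrite /dl z2 mulr0 sqrtC0 mulr0; apply: (eps_le0 ry d1) => e e0 e1.
  have ei : 0 < e^-1 by rewrite invr_gt0.
  by have := dx _ ei; rewrite z2 mulr0 addr0 [_ * (m - _)]mulrC ler_pdivrMr // [_ * e]mulrC.
have p1 : 0 < det2 s1 by rewrite lt_def n1.
have p2 : 0 < det2 s2 by rewrite lt_def n2.
have dp : 0 < dl by rewrite sqrtC_gt0 mulr_gt0.
have dd : dl * dl = det2 s1 * det2 s2 by rewrite -expr2 sqrtCK.
(* This is [sqrt (det s1 / det s2)], the minimiser of [det s1 / x + x det s2]. *)
have := dx (dl / det2 s2) (divr_gt0 dp p2).
have -> : det2 s1 + (dl / det2 s2) ^+ 2 * det2 s2 = (dl / det2 s2) * (2%:R * dl).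
  have -> : (dl / det2 s2) * (2%:R * dl) = 2%:R * (dl * dl) / det2 s2 by field.
  have -> : (dl / det2 s2) ^+ 2 * det2 s2 = (dl * dl) / det2 s2 by field.
  by rewrite dd; field.
by rewrite ler_pM2l // divr_gt0.
Qed.

(* With g_i = sqrt s_i and N = g1 g2 + adj(g1) adj(g2), a multiple of a
   unitary with N^* N = F2, the block below is L = (phi / F2) g1 N g2. *)
Let L : K2 := fun a b => phi / F2 * (mulk s1 s2 a b + dl * (a == b)%:R).

(** With [x = g1 v], [y = g2 w] and [z = phi / F2] the form is
    [|x + z N y|^2 + (1 - |z|^2 F2) |y|^2], and [|z|^2 F2 <= 1] follows from [fidelity]. The rows of
    [N] are [(na, nb)] and [(- conj nb, conj na)]. *)
Lemma psd2_fidelity_block : psd2 s1 L s2.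
Proof.
move=> v w.
have [g1 [p1 e1 k1]] := psdk_gram psd_s1; have [g2 [p2 e2 k2]] := psdk_gram psd_s2.
have [a1 b1 c1] := herm2 k1; have [a2 b2 c2] := herm2 k2.
have dlE : dl = det2 g1 * det2 g2.
  apply/eqP; rewrite -(eqrXn2 (ltn0Sn 1)) ?sqrtC_ge0 ?mulr_ge0 ?det2_ge0 ?sqrtCK //; try exact: psd_s1; try exact: psd_s2.
  by rewrite -e1 -e2 /det2 /mulk !sum2; apply/eqP; ring.
pose x i := g1 i 0 * v 0 + g1 i 1 * v 1.
pose y i := g2 i 0 * w 0 + g2 i 1 * w 1.
pose na := g1 0 0 * g2 0 0 + g1 1 1 * g2 1 1 + 2%:R * (g1 0 1 * (g2 0 1)^*).
pose nb := g2 0 1 * (g1 0 0 - g1 1 1) + g1 0 1 * (g2 1 1 - g2 0 0).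
pose z := phi / F2.
have F2E : F2 = na * na^* + nb * nb^*.
  rewrite /F2 dlE -e1 -e2 /mulk !sum2 /det2 c1 c2 /na /nb !(rmorphD, rmorphM, rmorphN, conjC_nat) /= !conjCK a1 b1 a2 b2.
  ring.
have q1 : qf s1 v = x 0 * (x 0)^* + x 1 * (x 1)^*.
  by rewrite /qf -e1 /mulk !sum2 c1 /x c1 !(rmorphD, rmorphM) /= !conjCK a1 b1; ring.
have q2 : qf s2 w = y 0 * (y 0)^* + y 1 * (y 1)^*.
  by rewrite /qf -e2 /mulk !sum2 c2 /y c2 !(rmorphD, rmorphM) /= !conjCK a2 b2; ring.
pose n0 := na * y 0 + nb * y 1; pose n1 := - nb^* * y 0 + na^* * y 1.
have bL : bf L v w = z * ((x 0)^* * n0 + (x 1)^* * n1).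
  rewrite /bf !sum2 /L -/z /= dlE -e1 -e2 /mulk !sum2 /det2 /n0 /n1 /na /nb /x /y c1 c2.
  rewrite !(rmorphD, rmorphM, rmorphN, conjC_nat) /= !conjCK a1 b1 a2 b2.
  ring.
have Fp : 0 <= F2 by rewrite F2E addr_ge0 // -normCK exprn_ge0.
have Fr := CrealP (ger0_real Fp).
have zF : z * z^* * F2 <= 1.
  rewrite /z rmorphM fmorphV /= Fr; have [f0|f0] := eqVneq F2 0; first by rewrite f0 mulr0.
  have -> : phi / F2 * (phi^* / F2) * F2 = phi * phi^* / F2 by field.
  by rewrite ler_pdivrMr ?mul1r ?fidelity // lt_def f0.
clearbody z; rewrite /n0 /n1 in bL *; clear n0 n1; clearbody x y na nb.
have -> : qf s1 v + crs L v w + qf s2 w =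
   (x 0 + z * (na * y 0 + nb * y 1)) * (x 0 + z * (na * y 0 + nb * y 1))^*
   + (x 1 + z * (- nb^* * y 0 + na^* * y 1)) * (x 1 + z * (- nb^* * y 0 + na^* * y 1))^*
   + (1 - z * z^* * F2) * (y 0 * (y 0)^* + y 1 * (y 1)^*).
  rewrite /crs bL q1 q2 F2E !(rmorphD, rmorphM, rmorphN) /= !conjCK; ring.
have nn t : 0 <= t * t^* :> C by rewrite -normCK exprn_ge0.
by rewrite !addr_ge0 // mulr_ge0 ?subr_ge0 // addr_ge0.
Qed.

Lemma tr_fidelity_block : \sum_a L a a = phi.
Proof.
rewrite /L -mulr_sumr (_ : \sum_i _ = F2); last first.
  by rewrite sum2 /mulk !sum2 !eqxx /= !mulr1 /F2; ring.
(* If [F2 = 0], the quotient [phi / F2] is 0 by convention, and [fidelity] forces [phi = 0] as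
   well. *)
have [f0|f0] := eqVneq F2 0; last by rewrite divfK.
have := fidelity; rewrite f0 -normCK => h.
have : phi == 0 by rewrite -normr_eq0 -sqrf_eq0 eq_le h exprn_ge0.
by move/eqP => ->; rewrite mul0r mulr0.
Qed.

Lemma ext_pair : du != 0 -> (forall X, exists x y, A X = (fun a b => x * ketbra al al a b + y * ketbra be be a b)) ->
  exists V, [/\ linm V, cpm V, tpm V & forall X, B X = V (A X)].
Proof.
move=> d sp; pose u (i : 'I_2) := if i == 0 then al else be.
have [||k l|V [lV cV tV VE]] := @ext_basis u (blk s1 L s2).
- by rewrite /det2 /u.
- exact: psdk_blk psd2_fidelity_block.
- case: (ord2P k) => ->; case: (ord2P l) => ->; rewrite /blk /u /=.
  + by have := tB X1; rewrite -(tA X1) A1.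
  + exact: tr_fidelity_block.
  + rewrite -rmorph_sum tr_fidelity_block /phi rmorph_sum; apply: eq_bigr => a _.
    by rewrite rmorphM /= conjCK mulrC.
  + by have := tB X2; rewrite -(tA X2) A2.
exists V; split=> // X; have [x [y e]] := sp X.
have -> : B X = B (fun i j => x * X1 i j + y * X2 i j).
  by apply: (contr_kerE lA lB hA hB cAB); rewrite e (linmD _ _ lA) !(linmZ _ _ lA) A1 A2.
rewrite e (linmD _ _ lB) (linmD _ _ lV) !(linmZ _ _ lB) !(linmZ _ _ lV).
have -> := VE 0 0; have -> := VE 1 1; by [].
Qed.
End Pairs.
End Qubit2.

(** * Toeplitz images and the case distinction for qubits *)

Section Qubit3.
Variable C : numClosedFieldType.
Notation K2 := ('I_2 -> 'I_2 -> C).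

(** Bounded increasing sequences need not converge in an arbitrary [numClosedFieldType]; over
    [complex R] this is [short_limit]. *)
Hypothesis short_lim : forall (P X : K2) (K : nat -> K2) (c : C),
  K 0%N = (fun _ _ => 0) -> (forall k, psdk (K k)) ->
  (forall k, isShort (K k.+1) X (fun a b => P a b - K k a b)) ->
  (forall k, trk (K k) <= c) ->
  exists Q, psd2 Q X (fun a b => P a b - Q a b) /\ trk Q <= c.

Lemma crs_adj (D : finType) (X : D -> D -> C) v w : crs (adjk X) v w = crs X w v.
Proof.
rewrite /crs addrC; have -> : bf (adjk X) v w = (bf X w v)^*; last by rewrite conjCK.
rewrite /bf rmorph_sum; under [RHS]eq_bigr do rewrite rmorph_sum.
rewrite [RHS]exchange_big; apply: eq_bigr => a _; apply: eq_bigr => b _ /=.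
rewrite !rmorphM /= conjCK /adjk; ring.
Qed.

Lemma psd2_swap (D : finType) (Q X S : D -> D -> C) : psd2 Q (adjk X) S -> psd2 S X Q.
Proof.
move=> h v w; have := h w v; rewrite crs_adj; congr (0 <= _); ring.
Qed.

Section Maps.
Variables (A B : K2 -> K2).
Hypotheses (lA : linm A) (lB : linm B) (hA : hpm A) (hB : hpm B) (tA : tpm A) (tB : tpm B).
Hypothesis cAB : contr A B.

Lemma toeplitz_le (u0 u1 : 'I_2 -> C) (XP XC : K2) : hermk XP ->
  A XP = (fun a b => u0 a * (u0 b)^* + u1 a * (u1 b)^*) -> A XC = (fun a b => u0 a * (u1 b)^*) ->
  exists Q, psd2 Q (B XC) (fun a b => B XP a b - Q a b) /\ trk Q <= \sum_a u0 a * (u0 a)^*.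
Proof.
move=> hP eP eC; apply: (short_lim (K := Kseq B XP XC)) => // k.
- exact: (Kseq_psd lA lB hA hB tA tB cAB hP eP eC).
- exact: (Kseq_short lA lB hA hB tA tB cAB hP eP eC).
- exact: (Kseq_tr lA lB hA hB tA tB cAB hP eP eC).
Qed.

Lemma toeplitz_eq (u0 u1 : 'I_2 -> C) (XP XC : K2) : hermk XP ->
  A XP = (fun a b => u0 a * (u0 b)^* + u1 a * (u1 b)^*) -> A XC = (fun a b => u0 a * (u1 b)^*) ->
  exists Q, psd2 Q (B XC) (fun a b => B XP a b - Q a b) /\ trk Q = \sum_a u0 a * (u0 a)^*.
Proof.
move=> hP eP eC; have [Q1 [p1 t1]] := toeplitz_le hP eP eC.
have eP' : A XP = (fun a b => u1 a * (u1 b)^* + u0 a * (u0 b)^*).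
  by rewrite eP; apply: kerext => a b; rewrite addrC.
have eC' : A (adjk XC) = (fun a b => u1 a * (u0 b)^*).
  by rewrite hA eC; apply: kerext => a b; rewrite /adjk rmorphM /= conjCK mulrC.
have [Q2 [p2 t2]] := toeplitz_le hP eP' eC'.
rewrite hB in p2; have {p2} p2 := psd2_swap p2.
set c := \sum_a _ in t1 *; set c1 := \sum_a _ in t2.
have tP : trk (B XP) = c + c1 by rewrite tB -tA eP /trk big_split.
(* [Q2] fills the corner of [u1], so its complement in [B XP] fills that of [u0]; the total trace
   [c + c1] turns [tr Q2 <= c1] into [tr Q3 >= c]. *)
pose Q3 : K2 := fun a b => B XP a b - Q2 a b.
have t3 : c <= trk Q3 by rewrite /Q3 trkB tP -addrA lerDl subr_ge0.
have [e|ne] := eqVneq (trk Q1) (trk Q3).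
  by exists Q1; split=> //; apply/eqP; rewrite eq_le t1 e t3.
have lt : 0 < trk Q3 - trk Q1 by rewrite subr_gt0 lt_def eq_sym ne (le_trans t1 t3).
pose s := (c - trk Q1) / (trk Q3 - trk Q1).
have s0 : 0 <= s by rewrite divr_ge0 ?(ltW lt) // subr_ge0.
have s1 : 0 <= 1 - s by rewrite subr_ge0 ler_pdivrMr // mul1r lerD2r.
exists (fun a b => (1 - s) * Q1 a b + s * Q3 a b); split.
  move=> v w; have := addr_ge0 (mulr_ge0 s1 (p1 v w)) (mulr_ge0 s0 (p2 v w)).
  congr (0 <= _); rewrite !qfB !qfD !qfZ !qfB; ring.
rewrite trkD !trkZ /s; field; exact: lt0r_neq0.
Qed.

Lemma ext_toeplitz (u0 u1 : 'I_2 -> C) (XP XC : K2) : hermk XP ->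
  A XP = (fun a b => u0 a * (u0 b)^* + u1 a * (u1 b)^*) -> A XC = (fun a b => u0 a * (u1 b)^*) ->
  u0 0 * u1 1 - u0 1 * u1 0 != 0 ->
  (forall X, exists x y z, A X = (fun a b => x * (u0 a * (u0 b)^* + u1 a * (u1 b)^*)
     + (y * (u0 a * (u1 b)^*) + z * (u1 a * (u0 b)^*)))) ->
  exists V, [/\ linm V, cpm V, tpm V & forall X, B X = V (A X)].
Proof.
move=> hP eP eC d sp; have [Q [p t]] := toeplitz_eq hP eP eC.
pose u (i : 'I_2) := if i == 0 then u0 else u1.
have eC' : A (adjk XC) = (fun a b => u1 a * (u0 b)^*).
  by rewrite hA eC; apply: kerext => a b; rewrite /adjk rmorphM /= conjCK mulrC.
have tX : \sum_a B XC a a = \sum_a u0 a * (u1 a)^*.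
  by have := tB XC; rewrite -(tA XC) eC.
have [||k l|V [lV cV tV VE]] := @ext_basis _ u (blk Q (B XC) (fun a b => B XP a b - Q a b)).
- by rewrite /det2 /u.
- exact: psdk_blk.
- case: (ord2P k) => ->; case: (ord2P l) => ->; rewrite /blk /u //=.
  + rewrite -rmorph_sum tX rmorph_sum; apply: eq_bigr => a _.
    by rewrite rmorphM /= conjCK mulrC.
  + rewrite sumrB; have := tB XP; rewrite -(tA XP) eP /trk => ->.
    by rewrite big_split /= -[\sum_i Q i i]/(trk Q) t [LHS]addrC addKr.
exists V; split=> // X; have [x [y [z e]]] := sp X.
have -> : B X = B (fun i j => x * XP i j + (y * XC i j + z * adjk XC i j)).
  apply: (contr_kerE lA lB hA hB cAB).
  by rewrite e (linmD _ _ lA) (linmD _ _ lA) !(linmZ _ _ lA) eP eC eC'.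
rewrite e (linmD _ _ lB) (linmD _ _ lB) !(linmZ _ _ lB) (linmD _ _ lV) (linmD _ _ lV) !(linmZ _ _ lV) (linmD _ _ lV).
have e00 := VE 0 0; have e01 := VE 0 1; have e10 := VE 1 0; have e11 := VE 1 1.
rewrite /ketbra /u /blk /= in e00 e01 e10 e11; rewrite e00 e01 e10 e11 hB.
by apply: kerext => a b; rewrite /adjk; ring.
Qed.

Lemma ext_const : psdk (B (fun a b => 2%:R^-1 * (a == b)%:R)) ->
  (forall X, exists x, A X = (fun a b => x * A (fun a b => 2%:R^-1 * (a == b)%:R) a b)) ->
  exists V, [/\ linm V, cpm V, tpm V & forall X, B X = V (A X)].
Proof.
set om : K2 := (fun a b => 2%:R^-1 * (a == b)%:R) => pB sp.
have tom : trk om = 1 by rewrite /trk sum2 /om !eqxx /=; field.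
have cp : cpm (fun (X : K2) a b => trk X * B om a b).
  move=> n X pX.
  have -> : liftk (fun (X : K2) a b => trk X * B om a b) X =
     (fun p q => \sum_k (X (k, p.2) (k, q.2) * B om p.1 q.1)).
    by apply: kerext => -[a i] [b j]; rewrite /liftk /trk /= mulr_suml.
  apply: psdk_sum => k; have [S [_ <- hS]] := psdk_gram pB.
  have -> : (fun p q => X (k, p.2) (k, q.2) * mulk S S p.1 q.1) =
     (fun p q : 'I_2 * 'I_n => \sum_l \sum_i \sum_j ((i == (k, p.2))%:R * S l p.1)^* * X i j * ((j == (k, q.2))%:R * S l q.1)).
    apply: kerext => -[a i] [b j]; rewrite /mulk /= mulr_sumr; apply: eq_bigr => l _.
    rewrite -(sum_delta (fun r => X r (k, j)) (k, i)) mulr_suml; apply: eq_bigr => r _.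
    rewrite -(sum_delta (fun r' => X r r') (k, j)) mulr_sumr mulr_suml; apply: eq_bigr => r' _.
    rewrite rmorphM /= conjC_nat -hS; ring.
  apply: psdk_sum => l; exact: psdk_congr.
exists (fun X a b => trk X * B om a b); split=> //.
- by move=> a X Y; apply: kerext => i j; rewrite trkD trkZ; ring.
- by move=> X; rewrite trkZ tB tom mulr1.
move=> X; have [x e] := sp X.
have -> : B X = B (fun i j => x * om i j).
  by apply: (contr_kerE lA lB hA hB cAB); rewrite e (linmZ x om lA).
by rewrite (linmZ x om lB) e trkZ tA tom mulr1.
Qed.

Lemma hermitian_parts (X : K2) : exists Y Z : K2, [/\ hermk Y, hermk Z & X = (fun a b => Y a b + 'i * Z a b)].
Proof.
exists (fun a b => 2%:R^-1 * (X a b + adjk X a b)), (fun a b => 2%:R^-1 * (- 'i * (X a b - adjk X a b))).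
split.
- move=> a b; rewrite /adjk rmorphM rmorphD /= fmorphV /= conjC_nat conjCK addrC //.
- move=> a b; rewrite /adjk !(rmorphM, rmorphD, rmorphN) /= fmorphV /= conjC_nat conjCK conjCi; ring.
apply: kerext => a b.
have i2 : 'i * 'i = -1 :> C by rewrite -expr2 sqrCi.
transitivity (2%:R^-1 * (X a b + adjk X a b) - 2%:R^-1 * ('i * 'i) * (X a b - adjk X a b)).
  by rewrite i2; field.
ring.
Qed.

Hypothesis (posA : forall X, psdk X -> psdk (A X)).

(** Along the line [w + x tau] the determinant is a quadratic in [x], positive at 0 and with leading
    coefficient [det2 tau < 0]. At its two real roots the determinant is 0 and the trace 1, that is,
    the state is pure. *)
Lemma pure_states (X0 : K2) : hermk X0 -> trk X0 = 0 -> A X0 <> (fun _ _ => 0) ->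
  exists (al be : 'I_2 -> C) (X1 X2 : K2), [/\ hermk X1, hermk X2, A X1 = ketbra al al, A X2 = ketbra be be
    & al 0 * be 1 - al 1 * be 0 != 0].
Proof.
move=> h0 t0 n0; set tau := A X0 in n0.
pose om : K2 := (fun a b => 2%:R^-1 * (a == b)%:R); set w := A om.
have hom : hermk om by move=> a b; rewrite /om rmorphM fmorphV /= !conjC_nat eq_sym.
have hw := hermk_map hA hom; have ht := hermk_map hA h0.
have [w0 w1 w2] := herm2 hw; have [u0 u1 u2] := herm2 ht; rewrite -/tau in u0 u1 u2; rewrite -/w in w0 w1 w2.
have tw : w 0 0 + w 1 1 = 1.
  by have := tA om; rewrite /trk !sum2 -/w => ->; rewrite /om !eqxx /=; field.
have ttau : tau 1 1 = - tau 0 0.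
  by apply/eqP; rewrite -addr_eq0 addrC; have := tA X0; rewrite t0 /trk sum2 -/tau => ->.
have dtau : det2 tau = - (tau 0 0 * (tau 0 0)^* + tau 0 1 * (tau 0 1)^*).
  by rewrite /det2 ttau u2 u0; ring.
have dneg : 0 < - det2 tau.
  rewrite dtau opprK -!normCK lt_def addr_ge0 ?exprn_ge0 // andbT.
  apply/negP; rewrite paddr_eq0 ?exprn_ge0 // !sqrf_eq0 !normr_eq0 => /andP[/eqP z1 /eqP z2].
  by apply: n0; apply: ker2; rewrite ?ttau ?u2 ?z1 ?z2 ?conjC0 ?oppr0.
set k := w 0 0 * tau 1 1 + w 1 1 * tau 0 0 - w 0 1 * tau 1 0 - w 1 0 * tau 0 1.
have dx (x y : C) : det2 (fun a b => x * w a b + y * tau a b) = x ^+ 2 * det2 w + x * y * k + y ^+ 2 * det2 tau.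
  by rewrite /det2 /k; ring.
pose s := \sum_i \sum_j `|X0 i j|.
have sE : \sum_i \sum_j `|- X0 i j| = s by apply: eq_bigr => i _; apply: eq_bigr => j _; rewrite normrN.
have hN : hermk (fun i j => - X0 i j) by move=> i j; rewrite rmorphN /= -h0.
have q1 := det2_ge0 (posA (psdk_shift h0)).
have q2 := det2_ge0 (posA (psdk_shift hN)).
have sn0 : s != 0.
  apply/negP => /eqP s0; apply: n0; rewrite /tau.
  suff -> : X0 = (fun _ _ => 0) by rewrite linm0.
  apply: kerext => i j; apply/eqP; rewrite -normr_le0 -s0 /s.
  apply: (@le_trans _ _ (\sum_j `|X0 i j|)); first by rewrite (bigD1 j) //= lerDl sumr_ge0.
  by rewrite [leRHS](bigD1 i) //= lerDl sumr_ge0 // => i' _; rewrite sumr_ge0.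
(* [A] is positive on [s + X0] and [s - X0]; adding the two determinants cancels the linear term [k]
   and leaves [4 s^2 det w >= - det tau > 0]. *)
have dw : 0 < det2 w.
  have e1 : A (fun i j => X0 i j + s * (i == j)%:R) = (fun a b => (2%:R * s) * w a b + 1 * tau a b).
    transitivity (fun a b => A (fun a b => 2%:R * s * om a b) a b + (1) * A X0 a b); last by rewrite (linmZ _ om lA).
    by rewrite -lA; congr A; apply: kerext => i j; rewrite /om; field.
  have e2 : A (fun i j => - X0 i j + s * (i == j)%:R) = (fun a b => (2%:R * s) * w a b + (-1) * tau a b).
    transitivity (fun a b => A (fun a b => 2%:R * s * om a b) a b + (-1) * A X0 a b); last by rewrite (linmZ _ om lA).
    by rewrite -lA; congr A; apply: kerext => i j; rewrite /om; field.
  rewrite -/s e1 dx in q1; rewrite sE e2 dx in q2.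
  have := addr_ge0 q1 q2.
  have -> : (2%:R * s) ^+ 2 * det2 w + 2%:R * s * 1 * k + 1 ^+ 2 * det2 tau +
    ((2%:R * s) ^+ 2 * det2 w + 2%:R * s * -1 * k + (-1) ^+ 2 * det2 tau)
    = 2%:R * ((2%:R * s) ^+ 2 * det2 w - (- det2 tau)) by ring.
  rewrite pmulr_rge0 ?ltr0n // subr_ge0 => /(lt_le_trans dneg).
  have s2 : 0 < (2%:R * s) ^+ 2.
    rewrite exprn_gt0 // mulr_gt0 ?ltr0n // lt_def sn0 /s sumr_ge0 // => i _; by rewrite sumr_ge0.
  by rewrite pmulr_rgt0.
have rk : k^* = k.
  rewrite /k w2 u2 !(rmorphD, rmorphM, rmorphN) /= !conjCK w0 w1 u0 u1; ring.
set c := - det2 tau in dneg dx.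
have p : 0 < k ^+ 2 + 4%:R * (det2 w * c).
  by rewrite ltr_wpDl ?mulr_gt0 ?ltr0n // -realEsqr; apply/CrealP.
set r := sqrtC (k ^+ 2 + 4%:R * (det2 w * c)).
have r0 : 0 < r by rewrite sqrtC_gt0.
have rr : r * r = k ^+ 2 + 4%:R * (det2 w * c) by rewrite -expr2 sqrtCK.
have cn0 : c != 0 := lt0r_neq0 dneg.
have rn := CrealP (gtr0_real r0); have cr := CrealP (gtr0_real dneg).
have root y : (y * y = r * r) -> y^* = y -> exists al, A (fun a b => om a b + (k + y) / (2%:R * c) * X0 a b) = ketbra al al
    /\ hermk (fun a b => om a b + (k + y) / (2%:R * c) * X0 a b).
  move=> yy yr; set x := (k + y) / (2%:R * c).
  have xr : x^* = x.
    by rewrite /x rmorphM fmorphV /= rmorphM rmorphD /= rk yr cr conjC_nat.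
  have hX : hermk (fun a b => om a b + x * X0 a b).
    by move=> a b; rewrite rmorphD rmorphM /= -hom -h0 xr.
  have eX : A (fun a b => om a b + x * X0 a b) = (fun a b => 1 * w a b + x * tau a b).
    by rewrite lA; apply: kerext => a b; rewrite mul1r.
  have [al e] : exists al : 'I_2 -> C, A (fun a b => om a b + x * X0 a b) = (fun a b => al a * (al b)^*).
    apply: rank1_of_det0; first exact: hermk_map.
      rewrite eX dx -[det2 tau]opprK -/c.
      have -> : 1 ^+ 2 * det2 w + 1 * x * k + x ^+ 2 * - c =
         (k ^+ 2 + 4%:R * (det2 w * c) - y * y) / (4%:R * c) by rewrite /x; field.
      by rewrite yy rr subrr mul0r.
    by rewrite tA trkD trkZ t0 mulr0 addr0 /trk sum2 /om !eqxx /= mulr1 addr_ge0 // invr_ge0 ler0n.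
  by exists al.
have [al [eal hal]] := root r (erefl _) rn.
have [be [ebe hbe]] : exists al, A (fun a b => om a b + (k + - r) / (2%:R * c) * X0 a b) = ketbra al al
    /\ hermk (fun a b => om a b + (k + - r) / (2%:R * c) * X0 a b).
  by apply: root; rewrite ?mulrNN // rmorphN /= rn.
exists al, be; do 2 eexists; split; [exact: hal | exact: hbe | exact: eal | exact: ebe |].
(* The roots differ by [r / c], so the difference of the pure states is a nonzero multiple of [tau].
   Its determinant is nonzero, hence [al] and [be] are independent. *)
have ed : (fun a b => 0 * w a b + (r / c) * tau a b) = (fun a b => ketbra al al a b - ketbra be be a b).
  rewrite -eal -ebe (lA _ om) (lA _ om) -/w -/tau; apply: kerext => a b; by field.
have := dx 0 (r / c); rewrite ed => e.
apply/negP => /eqP z.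
have : det2 (fun a b => ketbra al al a b - ketbra be be a b) =
   - ((al 0 * be 1 - al 1 * be 0) * (al 0 * be 1 - al 1 * be 0)^*).
  by rewrite /det2 /ketbra rmorphB !rmorphM /=; ring.
rewrite e z expr0n /= !mul0r oppr0 !add0r => /eqP.
rewrite mulf_eq0 expf_eq0 /= mulf_eq0 invr_eq0 (negbTE cn0) (negbTE (lt0r_neq0 r0)) /=.
by rewrite -oppr_eq0 -/c (negbTE cn0).
Qed.

Lemma qubit_ext : psdk (B (fun a b => 2%:R^-1 * (a == b)%:R)) ->
  exists V, [/\ linm V, cpm V, tpm V & forall X, B X = V (A X)].
Proof.
move=> pB; pose om : K2 := (fun a b => 2%:R^-1 * (a == b)%:R).
have hom : hermk om by move=> a b; rewrite /om rmorphM fmorphV /= !conjC_nat eq_sym.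
(* The image is one-dimensional exactly when [A] kills every traceless hermitian matrix. *)
have [H1|] := pselect (forall X, hermk X -> trk X = 0 -> A X = (fun _ _ => 0)).
  apply: ext_const => // X; have [Y [Z [hY hZ ->]]] := hermitian_parts X.
  have K (Y' : K2) : hermk Y' -> A Y' = (fun a b => trk Y' * A om a b).
    move=> hY'; have := H1 (fun a b => Y' a b - trk Y' * om a b).
    rewrite (linmB _ (fun a b => trk Y' * om a b) lA) (linmZ _ om lA) => e.
    have {}e : (fun i j => A Y' i j - trk Y' * A om i j) = (fun _ _ => 0).
      apply: e.
        move=> a b; rewrite rmorphB rmorphM /= -hY' -hom.
        by have -> : (trk Y')^* = trk Y' by rewrite /trk rmorph_sum; apply: eq_bigr => i _; rewrite /= -hY'.
      rewrite trkB trkZ (_ : trk om = 1) ?mulr1 ?subrr // /trk sum2 /om !eqxx /=; by field.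
    by apply: kerext => a b; apply/eqP; rewrite -subr_eq0; have := congr1 (fun f => f a b) e => /= ->.
  exists (trk Y + 'i * trk Z); rewrite lA (K Y) // (K Z) //; apply: kerext => a b; ring.
move=> /existsNP [X0 /not_implyP [h0 /not_implyP [t0 n0]]].
have [al [be [X1 [X2 [h1 h2 A1 A2 d]]]]] := pure_states h0 t0 n0.
have [H2|] := pselect (forall X, exists x y, A X = (fun a b => x * ketbra al al a b + y * ketbra be be a b)).
  exact: (ext_pair lA lB hA hB tA tB cAB h1 h2 A1 A2).
move=> nH2.
have [X3 [h3 nX3]] : exists X, hermk X /\ ~ exists x y, A X = (fun a b => x * ketbra al al a b + y * ketbra be be a b).
  apply: contrapT => nE; apply: nH2 => X; have [Y [Z [hY hZ ->]]] := hermitian_parts X.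
  have K (Y' : K2) : hermk Y' -> exists x y, A Y' = (fun a b => x * ketbra al al a b + y * ketbra be be a b).
    by move=> hY'; apply: contrapT => n; apply: nE; exists Y'.
  have [x [y e]] := K _ hY; have [x' [y' e']] := K _ hZ.
  exists (x + 'i * x'), (y + 'i * y'); rewrite lA e e'; apply: kerext => a b; ring.
(* Removing the diagonal part of [A X3] and rescaling leaves [al be^*] times a phase, plus its
   adjoint. The phase is absorbed into [be], which leaves [ketbra be be] unchanged. *)
have [b' [X4 [h4 A4 eb d']]] : exists b' X4, [/\ hermk X4, A X4 = (fun a b => al a * (b' b)^* + b' a * (al b)^*),
   ketbra b' b' = ketbra be be & al 0 * b' 1 - al 1 * b' 0 != 0].
  pose u (i : 'I_2) := if i == 0 then al else be.
  have [|W [_ W2]] := @dual_basis _ u; first by rewrite /det2.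
  pose x k l := \sum_b \sum_c (W k b)^* * A X3 b c * W l c.
  have e3 : A X3 = (fun a b => x 0 0 * ketbra al al a b + x 0 1 * ketbra al be a b + (x 1 0 * ketbra be al a b + x 1 1 * ketbra be be a b)).
    rewrite [LHS]W2; apply: kerext => b c.
    transitivity (\sum_k \sum_l x k l * ketbra (u k) (u l) b c) => //.
    by move: (x) => x'; rewrite !sum2.
  have hx k l : x k l = (x l k)^*.
    rewrite /x rmorph_sum; under [RHS]eq_bigr do rewrite rmorph_sum.
    rewrite [RHS]exchange_big; apply: eq_bigr => b _; apply: eq_bigr => c _ /=.
    by rewrite !rmorphM /= conjCK -(hermk_map hA h3); ring.
  have zn : x 0 1 != 0.
    apply/negP => /eqP z; apply: nX3; exists (x 0 0), (x 1 1); rewrite e3 (hx 1 0) z conjC0.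
    by apply: kerext => a b; ring.
  pose n := `|x 0 1|; have nn : n != 0 by rewrite normr_eq0.
  have nr : n^* = n by rewrite /n conj_normC.
  have zz : x 0 1 * (x 0 1)^* = n * n by rewrite -normCK expr2.
  pose z := x 0 1 / n.
  have z1 : z * z^* = 1 by rewrite /z rmorphM fmorphV /= nr mulf_div zz divff // mulf_neq0.
  exists (fun a => z^* * be a), (fun a b => n^-1 * (X3 a b - (x 0 0 * X1 a b + x 1 1 * X2 a b))); split.
  - move=> a b; rewrite !(rmorphM, rmorphD, rmorphN) /= fmorphV /= nr -h1 -h2 -h3.
    by rewrite -(hx 0 0) -(hx 1 1).
  - rewrite (linmZ _ _ lA) (linmB _ (fun a b => x 0 0 * X1 a b + x 1 1 * X2 a b) lA) (linmD _ _ lA) !(linmZ _ _ lA) A1 A2 e3.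
    rewrite (hx 1 0); apply: kerext => a b; rewrite /ketbra /z !(rmorphM, fmorphV) /= !conjCK !nr.
    by field.
  - clearbody z; apply: kerext => a b; rewrite /ketbra rmorphM /= conjCK.
    by transitivity (z * z^* * (be a * (be b)^*)); [ring | rewrite z1 mul1r].
  - have -> : al 0 * (z^* * be 1) - al 1 * (z^* * be 0) = z^* * (al 0 * be 1 - al 1 * be 0) by ring.
    rewrite mulf_neq0 // conjC_eq0; apply/negP => /eqP z0.
    by move: z1; rewrite z0 mul0r => /eqP; rewrite eq_sym oner_eq0.
rewrite -eb in A2; move: be b' d' A2 A4 {d nH2 nX3 eb} => _ be d A2 A4.
pose u0 a := al a + 'i * be a; pose u1 a := al a - 'i * be a.
have i2 : 'i * 'i = -1 :> C by rewrite -expr2 sqrCi.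
have eP : A (fun a b => 2%:R * (X1 a b + X2 a b)) = (fun a b => u0 a * (u0 b)^* + u1 a * (u1 b)^*).
  rewrite (linmZ _ _ lA) (linmD _ _ lA) A1 A2; apply: kerext => a b.
  rewrite /ketbra /u0 /u1 !(rmorphM, rmorphD, rmorphN) /= conjCi.
  transitivity (2%:R * (al a * (al b)^* - ('i * 'i) * (be a * (be b)^*))); last by ring.
  by rewrite i2; ring.
have hP : hermk (fun a b => 2%:R * (X1 a b + X2 a b)).
  by move=> a b; rewrite rmorphM /= conjC_nat rmorphD /= -h1 -h2.
have eC : A (fun a b => (X1 a b - X2 a b) + 'i * X4 a b) = (fun a b => u0 a * (u1 b)^*).
  rewrite lA (linmB _ _ lA) A1 A2 A4; apply: kerext => a b.
  rewrite /ketbra /u0 /u1 !(rmorphM, rmorphD, rmorphN) /= conjCi.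
  transitivity (al a * (al b)^* + ('i * 'i) * (be a * (be b)^*) + 'i * (al a * (be b)^* + be a * (al b)^*)); last by ring.
  by rewrite i2; ring.
have du : u0 0 * u1 1 - u0 1 * u1 0 != 0.
  have -> : u0 0 * u1 1 - u0 1 * u1 0 = - (2%:R * 'i) * (al 0 * be 1 - al 1 * be 0) by rewrite /u0 /u1; ring.
  by rewrite !mulf_neq0 // oppr_eq0 mulf_neq0 ?neq0Ci ?pnatr_eq0.
have [H3|] := pselect (forall X, exists x y z, A X = (fun a b => x * (u0 a * (u0 b)^* + u1 a * (u1 b)^*)
     + (y * (u0 a * (u1 b)^*) + z * (u1 a * (u0 b)^*)))).
  exact: (ext_toeplitz hP eP eC du H3).
move=> /existsNP [X5 n5].
pose u (i : 'I_2) := if i == 0 then u0 else u1.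
have [|W [_ W2]] := @dual_basis _ u; first by rewrite /det2.
set XP : K2 := (fun a b => 2%:R * _) in hP eP; set XC : K2 := (fun a b => _ + 'i * X4 a b) in eC.
have eC' : A (adjk XC) = (fun a b => u1 a * (u0 b)^*).
  by rewrite hA eC; apply: kerext => a b; rewrite /adjk rmorphM /= conjCK mulrC.
clearbody XP XC.
pose x k l := \sum_b \sum_c (W k b)^* * A X5 b c * W l c.
have e5 : A X5 = (fun a b => x 0 0 * ketbra u0 u0 a b + x 0 1 * ketbra u0 u1 a b + (x 1 0 * ketbra u1 u0 a b + x 1 1 * ketbra u1 u1 a b)).
  rewrite [LHS]W2; apply: kerext => b c.
  transitivity (\sum_k \sum_l x k l * ketbra (u k) (u l) b c) => //.
  by move: (x) => x'; rewrite !sum2.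
have xn : x 0 0 - x 1 1 != 0.
  rewrite subr_eq0; apply/negP => /eqP z; apply: n5; exists (x 0 0), (x 0 1), (x 1 0); rewrite e5 -z.
  by apply: kerext => a b; rewrite /ketbra; ring.
(* In the basis [u0], [u1] a Toeplitz matrix has equal diagonal coefficients. [A X5] does not, so
   removing its Toeplitz part isolates [u0 u0^*], and [A] is onto. *)
pose Y : K2 := fun a b => (x 0 0 - x 1 1)^-1 * (X5 a b - (x 1 1 * XP a b + (x 0 1 * XC a b + x 1 0 * adjk XC a b))).
have eY : A Y = ketbra u0 u0.
  rewrite /Y (linmZ _ _ lA) (linmB _ (fun a b => x 1 1 * XP a b + (x 0 1 * XC a b + x 1 0 * adjk XC a b)) lA).
  rewrite (linmD _ (fun a b => (x 0 1 * XC a b + x 1 0 * adjk XC a b)) lA) (linmD _ (fun a b => x 1 0 * adjk XC a b) lA) !(linmZ _ _ lA) eP eC eC' e5.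
  by apply: kerext => a b; rewrite /ketbra; field.
pose g (k l : 'I_2) : K2 := if k == 0 then (if l == 0 then Y else XC) else (if l == 0 then adjk XC else (fun a b => XP a b - Y a b)).
have eg k l : A (g k l) = ketbra (u k) (u l).
  case: (ord2P k) => ->; case: (ord2P l) => ->; rewrite /g /u //=.
  rewrite (linmB _ _ lA) eP eY; apply: kerext => a b; rewrite /ketbra; ring.
pose G (X : K2) : K2 := fun a b => \sum_k \sum_l (\sum_b \sum_c (W k b)^* * X b c * W l c) * g k l a b.
apply: (ext_surj (G := G)) => //.
  move=> t X X'; apply: kerext => a b; rewrite /G mulr_sumr -big_split; apply: eq_bigr => k _ /=.
  rewrite mulr_sumr -big_split; apply: eq_bigr => l _ /=.
  rewrite mulrA -mulrDl; congr (_ * _); rewrite mulr_sumr -big_split; apply: eq_bigr => b' _ /=.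
  rewrite mulr_sumr -big_split; apply: eq_bigr => c' _ /=; ring.
move=> X; rewrite [RHS]W2 /G (linm_sum _ lA); apply: kerext => a b; apply: eq_bigr => k _.
by rewrite (linm_sum _ lA); apply: eq_bigr => l _; rewrite (linmZ _ _ lA) eg.
Qed.
End Maps.
End Qubit3.

(** * From negativity to trace distance *)

Section Helstrom.
Variable C : numClosedFieldType.
Variable I : finType.
Notation Q2 := ('I_2 * 'I_2)%type.
Implicit Types (F G X Y : I -> I -> C).

Definition tensv (S : finType) X (m : S -> C) : I * S -> I * S -> C :=
  fun p q => m p.2 * (m q.2)^* * X p.1 q.1.
Definition compr (S : finType) (P : I * S -> I * S -> C) (m : S -> C) : I -> I -> C :=
  fun i j => \sum_s \sum_t (m s)^* * P (i, s) (j, t) * m t.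

Lemma psdk_tensv (S : finType) X (m : S -> C) : psdk X -> psdk (tensv X m).
Proof.
move=> x; have := psdk_congr (fun i (p : I * S) => (i == p.1)%:R * (m p.2)^*) x.
congr psdk; apply: kerext => -[i s] [j t]; rewrite /tensv /=.
rewrite -[X i j](sum_delta (fun k => X k j) i) mulr_sumr; apply: eq_bigr => k _.
rewrite -[X k j](sum_delta (fun l => X k l) j) !mulr_sumr; apply: eq_bigr => l _.
rewrite rmorphM /= conjC_nat conjCK; ring.
Qed.

Lemma tr_tensv (S : finType) X (m : S -> C) : trk (tensv X m) = (\sum_s m s * (m s)^*) * trk X.
Proof.
rewrite /trk sum_pair mulr_sumr; apply: eq_bigr => i _.
by rewrite mulr_suml.
Qed.

Lemma psdk_compr (S : finType) (P : I * S -> I * S -> C) (m : S -> C) : psdk P -> psdk (compr P m).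
Proof.
move=> p; have := psdk_congr (fun (r : I * S) i => (r.1 == i)%:R * m r.2) p.
congr psdk; apply: kerext => i j; rewrite /compr sum_pair exchange_big /=; apply: eq_bigr => s _.
rewrite -[RHS](sum_delta (fun k => \sum_t (m s)^* * P (k, s) (j, t) * m t) i); apply: eq_bigr => k _.
rewrite sum_pair exchange_big /= mulr_sumr; apply: eq_bigr => t _.
rewrite -[P (k, s) (j, t)](sum_delta (fun l => P (k, s) (l, t)) j) mulr_sumr mulr_suml mulr_sumr.
apply: eq_bigr => l _; rewrite rmorphM /= conjC_nat; ring.
Qed.

(* Partial transpose over the second qubit of the state
   P (x) |Phi+><Phi+| + N (x) |Phi-><Phi-|, where G = P + N and F = P - N. *)
Definition ptbell G F : I * Q2 -> I * Q2 -> C := fun p q =>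
  ((p.2.1 == q.2.2) && (q.2.1 == p.2.2))%:R *
  (2%:R^-1 * (if p.2.2 == q.2.2 then G p.1 q.1 else F p.1 q.1)).

Definition m00 (s : Q2) : C := (s == (0, 0))%:R.
Definition m11 (s : Q2) : C := (s == (1, 1))%:R.
Definition mpm (e : C) (s : Q2) : C := (s == (0, 1))%:R + e * (s == (1, 0))%:R.

Lemma sumQ2 (f : Q2 -> C) : \sum_s f s = f (0, 0) + f (0, 1) + (f (1, 0) + f (1, 1)).
Proof. by rewrite sum_pair !sum2. Qed.

Lemma ptbellE G F X Y p q : (forall i j, F i j = X i j - Y i j) ->
  ptbell G F p q =
  (2%:R^-1 * tensv G m00 p q + 2%:R^-1 * tensv G m11 p q
   + (4%:R^-1 * tensv X (mpm 1) p q + 4%:R^-1 * tensv Y (mpm (-1)) p q))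
  - (4%:R^-1 * tensv Y (mpm 1) p q + 4%:R^-1 * tensv X (mpm (-1)) p q).
Proof.
move=> e; case: p => i [a b]; case: q => j [c d]; rewrite /ptbell /tensv /m00 /m11 /mpm /= !xpair_eqE !e.
by case: (ord2P a) => ->; case: (ord2P b) => ->; case: (ord2P c) => ->; case: (ord2P d) => ->;
  rewrite /= !(rmorphD, rmorphM, rmorphN, conjC0, conjC1) /=; field.
Qed.

(** On the two qubits the operator is block diagonal: [G / 2] on |00> and |11>, and [F / 2],
    [- F / 2] on the normalised combinations |01> + |10>, |01> - |10>. The lower bound compresses an
    arbitrary decomposition to these four orthogonal vectors; [mpm] has squared norm 2, whence the
    coefficients. *)
Lemma isTN_ptbell G F f : psdk G -> isTN F f -> isTN (ptbell G F) (trk G + f).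
Proof.
move=> pG tF.
have h2 : 0 <= 2%:R^-1 :> C by rewrite invr_ge0 ler0n.
have h4 : 0 <= 4%:R^-1 :> C by rewrite invr_ge0 ler0n.
have norms : [/\ \sum_s m00 s * (m00 s)^* = 1, \sum_s m11 s * (m11 s)^* = 1,
   \sum_s mpm 1 s * (mpm 1 s)^* = 2%:R & \sum_s mpm (-1) s * (mpm (-1) s)^* = 2%:R].
  by rewrite !sumQ2 /m00 /m11 /mpm /= !(rmorphD, rmorphM, rmorphN, conjC0, conjC1) /=; split; ring.
case: norms => n1 n2 n3 n4.
split.
  case: tF => [[X [Y [x y e ->]]] _].
  exists (fun p q => 2%:R^-1 * tensv G m00 p q + 2%:R^-1 * tensv G m11 p q
   + (4%:R^-1 * tensv X (mpm 1) p q + 4%:R^-1 * tensv Y (mpm (-1)) p q)),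
   (fun p q => 4%:R^-1 * tensv Y (mpm 1) p q + 4%:R^-1 * tensv X (mpm (-1)) p q); split.
  - by do 2!apply: psdkD; apply: psdkZ => //; apply: psdk_tensv.
  - by apply: psdkD; apply: psdkZ => //; apply: psdk_tensv.
  - by move=> p q; apply: ptbellE.
  - by rewrite !trkD !trkZ !tr_tensv n1 n2 n3 n4; field.
move=> P N p n e.
have tr4 (Z : I * Q2 -> I * Q2 -> C) : trk Z = trk (compr Z m00) + trk (compr Z m11)
   + 2%:R^-1 * (trk (compr Z (mpm 1)) + trk (compr Z (mpm (-1)))).
  rewrite /trk -!big_split sum_pair mulr_sumr -big_split; apply: eq_bigr => i _.
  rewrite /compr !sumQ2 /m00 /m11 /mpm /= !(rmorphD, rmorphM, rmorphN, conjC0, conjC1) /=; by field.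
have cB m i j : compr (ptbell G F) m i j = compr P m i j - compr N m i j.
  rewrite /compr -sumrB; apply: eq_bigr => s _; rewrite -sumrB; apply: eq_bigr => t _.
  by rewrite e; ring.
have c1 i j : compr (ptbell G F) m00 i j = 2%:R^-1 * G i j.
  rewrite /compr !sumQ2 /m00 /ptbell /= !(rmorphD, rmorphM, rmorphN, conjC0, conjC1) /=; ring.
have c2 i j : compr (ptbell G F) m11 i j = 2%:R^-1 * G i j.
  rewrite /compr !sumQ2 /m11 /ptbell /= !(rmorphD, rmorphM, rmorphN, conjC0, conjC1) /=; ring.
have c3 i j : compr (ptbell G F) (mpm 1) i j = F i j.
  rewrite /compr !sumQ2 /mpm /ptbell /= !(rmorphD, rmorphM, rmorphN, conjC0, conjC1) /=; by field.
have c4 i j : compr (ptbell G F) (mpm (-1)) i j = - F i j.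
  rewrite /compr !sumQ2 /mpm /ptbell /= !(rmorphD, rmorphM, rmorphN, conjC0, conjC1) /=; by field.
have gG := isTN_psd (psdkZ h2 pG); rewrite trkZ in gG.
have i1 := gG.2 _ _ (psdk_compr m00 p) (psdk_compr m00 n) (fun i j => etrans (esym (c1 i j)) (cB _ i j)).
have i2 := gG.2 _ _ (psdk_compr m11 p) (psdk_compr m11 n) (fun i j => etrans (esym (c2 i j)) (cB _ i j)).
have i3 := tF.2 _ _ (psdk_compr (mpm 1) p) (psdk_compr (mpm 1) n) (fun i j => etrans (esym (c3 i j)) (cB _ i j)).
have i4 := (isTN_opp tF).2 _ _ (psdk_compr (mpm (-1)) p) (psdk_compr (mpm (-1)) n) (fun i j => etrans (esym (c4 i j)) (cB _ i j)).
rewrite (tr4 P) (tr4 N).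
have := lerD (lerD i1 i2) (ler_wpM2l h2 (lerD i3 i4)).
rewrite (_ : 2^-1 * trk G + 2^-1 * trk G + 2^-1 * (f + f) = trk G + f); last by field.
by move/le_trans; apply; rewrite le_eqVlt; apply/orP; left; apply/eqP; ring.
Qed.

(** The state before partial transposition: exchanging [p.2.2] and [q.2.2] yields [ptbell]. A map on
    the first factor acts on [G] and [F] separately. *)
Definition bellst G F : I * Q2 -> I * Q2 -> C := fun p q =>
  ((p.2.1 == p.2.2) && (q.2.1 == q.2.2))%:R *
  (2%:R^-1 * (if p.2.2 == q.2.2 then G p.1 q.1 else F p.1 q.1)).

Lemma bellst_psd X Y : psdk X -> psdk Y ->
  psdk (bellst (fun i j => X i j + Y i j) (fun i j => X i j - Y i j)).
Proof.
move=> x y; pose m (e : C) (s : Q2) : C := (s == (0, 0))%:R + e * (s == (1, 1))%:R.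
have h2 : 0 <= 2%:R^-1 :> C by rewrite invr_ge0 ler0n.
have := psdkD (psdkZ h2 (psdk_tensv (m 1) x)) (psdkZ h2 (psdk_tensv (m (-1)) y)).
congr psdk; apply: kerext => -[i [a b]] [j [c d]].
rewrite /bellst /tensv /m /= !xpair_eqE.
by case: (ord2P a) => ->; case: (ord2P b) => ->; case: (ord2P c) => ->; case: (ord2P d) => ->;
  rewrite /= !(rmorphD, rmorphM, rmorphN, conjC0, conjC1) /=; field.
Qed.

Lemma tr_bellst G F : trk (bellst G F) = trk G.
Proof.
rewrite /trk sum_pair; apply: eq_bigr => i _; rewrite sumQ2 /bellst /=; by field.
Qed.
End Helstrom.

(** * Matrices indexed by natural numbers *)

Import Defs.
Local Open Scope ring_scope.

Definition toC (z : Defs.C) : RC := Complex (re z) (im z).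
Definition ofC (z : RC) : Defs.C := mkC (complex.Re z) (complex.Im z).

Lemma toCK z : ofC (toC z) = z. Proof. by case: z. Qed.
Lemma ofCK z : toC (ofC z) = z. Proof. by case: z. Qed.
Lemma toC_inj z w : toC z = toC w -> z = w. Proof. by move=> e; rewrite -(toCK z) e toCK. Qed.
Lemma toC_add z w : toC (Cadd z w) = toC z + toC w. Proof. by []. Qed.
Lemma toC_mul z w : toC (Cmul z w) = toC z * toC w. Proof. by []. Qed.
Lemma toC_conj z : toC (Cconj z) = (toC z)^*. Proof. by []. Qed.
Lemma toC_sum n f : toC (Csum n f) = \sum_(i < n) toC (f i).
Proof.
by elim: n => [|n IH]; rewrite ?big_ord0 // big_ord_recr /= -IH toC_add.
Qed.

Definition kof n (X : Mat) : 'I_n -> 'I_n -> RC := fun i j => toC (X i j).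
Arguments kof : clear implicits.
Definition vext n (v : 'I_n -> RC) : nat -> Defs.C :=
  fun i => if insub i is Some i' then ofC (v i') else C0.
Definition mof n (K : 'I_n -> 'I_n -> RC) : Mat := fun i j =>
  match insub i, insub j with Some i', Some j' => ofC (K i' j') | _, _ => C0 end.

Lemma mofK n (K : 'I_n -> 'I_n -> RC) : kof n (mof K) = K.
Proof. by apply: kerext => i j; rewrite /kof /mof !valK ofCK. Qed.

Lemma meqP n X Y : meq n X Y <-> kof n X = kof n Y.
Proof.
split=> [h|h i j /ssrnat.ltP hi /ssrnat.ltP hj].
  by apply: kerext => i j; rewrite /kof h //; apply/ssrnat.ltP.
by have := congr1 (fun f => f (Ordinal hi) (Ordinal hj)) h => /toC_inj.
Qed.

Lemma kof_mmul n A B : kof n (mmul n A B) = mulk (kof n A) (kof n B).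
Proof. by apply: kerext => i j; rewrite /kof /mmul toC_sum. Qed.

Lemma hermitianP n X : hermitian n X <-> hermk (kof n X).
Proof.
split=> h i j.
  by rewrite /kof h; [rewrite toC_conj| |]; [ | apply/ssrnat.ltP | apply/ssrnat.ltP].
by move=> /ssrnat.ltP hi /ssrnat.ltP hj; have := h (Ordinal hi) (Ordinal hj); rewrite /kof -toC_conj => /toC_inj.
Qed.

Lemma qf_kof n X v : toC (Csum n (fun i => Csum n (fun j => Cmul (Cmul (Cconj (v i)) (X i j)) (v j))))
  = qf (kof n X) (fun i : 'I_n => toC (v i)).
Proof. by rewrite toC_sum; apply: eq_bigr => i _; rewrite toC_sum. Qed.

Lemma psdP n X : psd n X <-> psdk (kof n X).
Proof.
split=> [[/hermitianP h p] v|p].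
  have := p (vext v); set z := Csum _ _ => hz.
  have e : toC z = qf (kof n X) v.
    rewrite /z qf_kof; congr qf; apply: funext => i; by rewrite /vext valK ofCK.
  rewrite -e; have := hermk_qf_real v h; rewrite -e complex_real => /eqP i0.
  by rewrite lecE /= i0 eqxx; apply/RleP.
split; first exact/hermitianP/psdk_herm.
move=> v; set z := Csum _ _.
have := p (fun i : 'I_n => toC (v i)); rewrite -qf_kof lecE => /andP[_ h].
exact/RleP.
Qed.

Lemma trk_kof n X : trk (kof n X) = toC (mtrace n X).
Proof. by rewrite toC_sum. Qed.

Lemma trace_norm_isTN n M : hermk (kof n M) -> isTN (kof n M) (Complex (trace_norm n M) 0).
Proof.
move=> h; have [S0 [p0 e0 _]] := isTN_exists_spectral h.
have eM : kof n (mmul n (madj M) M) = mulk (kof n M) (kof n M).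
  rewrite kof_mmul; congr mulk; apply: kerext => i j; exact: (esym (h i j)).
have : exists S, psd n S /\ meq n (mmul n S S) (mmul n (madj M) M).
  exists (mof S0); split; first by apply/psdP; rewrite mofK.
  by apply/meqP; rewrite kof_mmul mofK eM.
(* [epsilon] is known only through its specification. The spectral root shows that it applies, and
   [isTN_sqrt] accepts whichever root was chosen. *)
move/(epsilon_spec (inhabits (fun _ _ : nat => C0))); rewrite -/(msqrt _ _).
rewrite /trace_norm; set S := msqrt _ _ => -[/psdP pS /meqP eS].
rewrite kof_mmul eM in eS; have := isTN_sqrt h pS eS.
have := psdk_tr_ge0 pS; rewrite trk_kof; case: (mtrace n S) => a b.
by rewrite /toC lecE /= => /andP[/eqP -> _].
Qed.

Definition tnr (I : finType) (M : I -> I -> RC) : R :=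
  match pselect (exists r, isTN M r) with
  | left h => complex.Re (sval (cid h)) | right _ => 0 end.

Lemma tnrP (I : finType) (M : I -> I -> RC) : hermk M -> isTN M (Complex (tnr M) 0).
Proof.
move=> h; rewrite /tnr; case: pselect => [e|]; last by case; exact: isTN_exists.
case: (cid e) => r t /=; have := isTN_ge0 t.
by rewrite lecE => /andP[/eqP i0 _]; case: r t i0 => x y /= t i0; rewrite -i0 in t *.
Qed.

Lemma tnr_eq (I : finType) (M : I -> I -> RC) r : isTN M (Complex r 0) -> tnr M = r.
Proof. by move=> t; have := isTN_uniq (tnrP (isTN_herm t)) t => -[]. Qed.

Section TnReal.
Variable I : finType.
Implicit Types (A B M : I -> I -> RC).

Lemma tnr_tri A B M : hermk A -> hermk B -> (forall i j, M i j = A i j + B i j) ->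
  tnr M <= tnr A + tnr B.
Proof.
move=> a b e; have hM : hermk M by move=> i j; rewrite !e rmorphD /= -a -b.
by have := isTN_triangle (tnrP a) (tnrP b) (tnrP hM) e; rewrite lecE => /andP[].
Qed.

Lemma tnr_scale A (c : R) : 0 < c -> hermk A -> tnr (fun i j => Complex c 0 * A i j) = c * tnr A.
Proof.
move=> c0 a; apply: tnr_eq.
have := isTN_scale (_ : 0 < Complex c 0) (tnrP a).
rewrite ltcE /= eqxx c0 => /(_ isT); congr isTN; apply/eqP; rewrite eq_complex /=.
by rewrite !mul0r mulr0 subr0 addr0 !eqxx.
Qed.

Lemma tnr_opp A : hermk A -> tnr (fun i j => - A i j) = tnr A.
Proof. by move=> a; apply: tnr_eq; apply: isTN_opp; apply: tnrP. Qed.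

Definition sabs M : R := \sum_i \sum_j (`|complex.Re (M i j)| + `|complex.Im (M i j)|).
Definition kI : R := 1 + #|I|%:R *+ 2.

Lemma tnr_bound M : hermk M -> tnr M <= kI * sabs M.
Proof.
move=> h; have := isTN_bound (tnrP h).
have e : 0 <= Complex kI 0 by rewrite lecE /= eqxx /kI addr_ge0 // mulrn_wge0.
have b : \sum_i \sum_j `|M i j| <= Complex (sabs M) 0.
  have -> : Complex (sabs M) 0 = \sum_i \sum_j (Complex (`|complex.Re (M i j)| + `|complex.Im (M i j)|) 0 : RC).
    by rewrite -[LHS]/((sabs M)%:C)%C /sabs rmorph_sum; apply: eq_bigr => i _; rewrite rmorph_sum.
  apply: ler_sum => i _; apply: ler_sum => j _.
  rewrite normc_def lecE /= eqxx /=.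
  set x := complex.Re _; set y := complex.Im _.
  rewrite -(ler_pXn2r (ltn0Sn 1)) ?nnegrE ?sqrtr_ge0 ?addr_ge0 // sqr_sqrtr ?addr_ge0 ?sqr_ge0 //.
  rewrite sqrrD !real_normK ?num_real //.
  by rewrite -addrA lerD2l addrC lerDl mulrn_wge0 // mulr_ge0.
have k : (1 + #|I|%:R *+ 2 : RC) = Complex kI 0.
  by rewrite -[RHS]/(kI%:C)%C /kI rmorphD rmorphMn /= rmorph_nat.
rewrite k => /le_trans /(_ (ler_wpM2l e b)).
by rewrite lecE /= => /andP[_]; rewrite mulr0 subr0.
Qed.

Lemma tnr_diff A B : hermk A -> hermk B -> `|tnr A - tnr B| <= kI * sabs (fun i j => A i j - B i j).
Proof.
move=> a b; have d : hermk (fun i j => A i j - B i j) by move=> i j; rewrite rmorphB /= -a -b.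
have d' : hermk (fun i j => - (A i j - B i j)) by move=> i j; rewrite rmorphN /= -d.
have h := tnr_bound d.
have h1 : tnr A <= tnr B + tnr (fun i j => A i j - B i j).
  by apply: tnr_tri => // i j; ring.
have h2 : tnr B <= tnr A + tnr (fun i j => - (A i j - B i j)).
  by apply: tnr_tri => // i j; ring.
rewrite tnr_opp // in h2.
rewrite ler_norml; apply/andP; split; lra.
Qed.
End TnReal.

(** * The trace norm along a curve of hermitian kernels *)

Section Curve.
Variables (I : finType) (M : R -> I -> I -> RC).

Lemma lim0_sum (T : finType) (e : T -> R -> R) : (forall t, lim0 (e t)) -> lim0 (fun h => \sum_t e t h).
Proof.
move=> H; elim: index_enum => [|t s IH].
  have -> : (fun h => \sum_(t <- [::]) e t h) = (fun=> 0) by apply: funext => h; rewrite big_nil.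
  exact: lim0_zero.
have -> : (fun h => \sum_(t <- t :: s) e t h) = (fun h => e t h + \sum_(t <- s) e t h).
  by apply: funext => h; rewrite big_cons.
exact: lim0_add.
Qed.

(** [g] is the trace norm along the tangent line. The triangle inequality makes its slopes monotone
    and at least [- tnr D], and [tnr_diff] bounds the distance from the curve by the entrywise
    remainders collected in [e]. *)
Lemma tnr_right_deriv t : (forall s, t <= s -> hermk (M s)) ->
  (forall i j, exists l1 l2, right_deriv (fun s => complex.Re (M s i j)) t l1 /\
      right_deriv (fun s => complex.Im (M s i j)) t l2) ->
  exists l, right_deriv (fun s => tnr (M s)) t l.
Proof.
move=> hM dM.
have [D dD] : exists D : I -> I -> RC, forall i j,
    right_deriv (fun s => complex.Re (M s i j)) t (complex.Re (D i j)) /\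
    right_deriv (fun s => complex.Im (M s i j)) t (complex.Im (D i j)).
  have H i j : exists z : RC, right_deriv (fun s => complex.Re (M s i j)) t (complex.Re z) /\
      right_deriv (fun s => complex.Im (M s i j)) t (complex.Im z).
    by have [l1 [l2 [a b]]] := dM i j; exists (Complex l1 l2).
  have H' i : exists f : I -> RC, forall j, right_deriv (fun s => complex.Re (M s i j)) t (complex.Re (f j)) /\
      right_deriv (fun s => complex.Im (M s i j)) t (complex.Im (f j)).
    by have [f hf] := boolp.choice (H i); exists f.
  by have [D hD] := boolp.choice H'; exists D.
have hD : hermk D.
  move=> i j; have [a b] := dD i j; have [a' b'] := dD j i.
  apply/eqP; rewrite eq_complex; apply/andP; split; apply/eqP.
    transitivity (complex.Re (D j i)); last by case: (D j i).
    apply: (right_deriv_uniq _ _ _ _ _ _ a a') => s /RleP ts; rewrite (hM s ts i j); by case: (M s j i).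
  transitivity (- complex.Im (D j i)); last by case: (D j i).
  apply: (right_deriv_uniq _ _ _ _ _ _ b (right_deriv_opp _ _ _ b')) => s /RleP ts.
  by rewrite (hM s ts i j); case: (M s j i).
have hMt := hM t (lexx t).
have hc (c : R) (X : I -> I -> RC) : hermk X -> hermk (fun i j => Complex c 0 * X i j).
  by move=> h i j; rewrite rmorphM /= -h; congr (_ * _); apply/eqP; rewrite eq_complex /= oppr0 !eqxx.
have hg h : hermk (fun i j => M t i j + Complex h 0 * D i j).
  by move=> i j; rewrite rmorphD /= -hMt -(hc h D hD).
pose g h := tnr (fun i j => M t i j + Complex h 0 * D i j).
pose e h : R := kI I * \sum_i \sum_j (Rabs ((complex.Re (M (t + h) i j) - complex.Re (M t i j)) / h - complex.Re (D i j))
   + Rabs ((complex.Im (M (t + h) i j) - complex.Im (M t i j)) / h - complex.Im (D i j))).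
have g0 : g 0 = tnr (M t).
  rewrite /g; congr tnr; apply: kerext => i j.
  have -> : Complex 0 0 = 0 :> RC by [].
  by rewrite mul0r addr0.
apply: (right_deriv_of_slopes _ g e t (tnr D)) => //.
- move=> h /RltP h0; apply/RleP; rewrite RabsE.
  have hn := lt0r_neq0 h0.
  have th : t <= t + h by rewrite lerDl ltW.
  have := tnr_diff (hM _ th) (hg h); rewrite -/(g h) => /le_trans; apply.
  rewrite /e RmultE mulrCA; apply: ler_wpM2l; first by rewrite /kI addr_ge0 // mulrn_wge0.
  rewrite /sabs mulr_sumr; apply: ler_sum => i _; rewrite mulr_sumr; apply: ler_sum => j _.
  have ab (x : R) : h * `|x| = `|h * x| by rewrite normrM gtr0_norm.
  rewrite !RabsE mulrDr !ab.
  rewrite le_eqVlt; apply/orP; left; apply/eqP; apply: (congr2 (fun x y : R => x + y)); apply: (congr1 (fun x : R => `|x|)).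
    case: (M (t + h) i j) => a b; case: (M t i j) => a' b'; case: (D i j) => x y /=.
    by rewrite ?RplusE ?RminusE ?RdivE; field.
  case: (M (t + h) i j) => a b; case: (M t i j) => a' b'; case: (D i j) => x y /=.
  by rewrite ?RplusE ?RminusE ?RdivE; field.
- apply: lim0_scale; apply: lim0_sum => i; apply: lim0_sum => j; apply: lim0_add; apply: lim0_abs.
    exact: (right_deriv_lim0 _ _ _ (dD i j).1).
  exact: (right_deriv_lim0 _ _ _ (dD i j).2).
- move=> h h' /RltP h0 /RltP hh'; apply/RleP; rewrite !RdivE !RminusE.
  have h0' := lt_trans h0 hh'.
  (* [M t + h D] is the convex combination of [M t] and [M t + h' D] with weight [la] on the
     latter. *)
  pose la := h / h'; have l0 : 0 < la by rewrite divr_gt0.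
  have l1 : 0 < 1 - la by rewrite subr_gt0 ltr_pdivrMr // mul1r.
  have H : g h <= (1 - la) * g 0 + la * g h'.
    rewrite g0 -(tnr_scale l1 hMt) -(tnr_scale l0 (hg h')).
    apply: tnr_tri; [exact: hc | exact: hc |] => i j.
    have -> : Complex (1 - la) 0 = 1 - Complex la 0 :> RC by apply/eqP; rewrite eq_complex /= subr0 !eqxx.
    have -> : Complex h 0 = Complex la 0 * Complex h' 0 :> RC.
      by apply/eqP; rewrite eq_complex /= !mulr0 mul0r subr0 addr0 /la divfK ?lt0r_neq0 // !eqxx.
    ring.
  rewrite ler_pdivrMr // mulrAC -mulrA -/la mulrC; lra.
- move=> h /RltP h0; apply/RleP; rewrite RdivE RminusE RoppE ler_pdivlMr //.
  have hN : hermk (fun i j => - D i j) by move=> i j; rewrite rmorphN /= -hD.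
  have K : g 0 <= g h + h * tnr D.
    rewrite -(tnr_opp hD) -(tnr_scale h0 hN) g0; apply: tnr_tri; [exact: hg | exact: hc |] => i j.
    by rewrite mulrN addrK.
  lra.
Qed.

Lemma tnr_cont : (forall s, 0 <= s -> hermk (M s)) ->
  (forall i j, cont_nonneg (fun s => complex.Re (M s i j)) /\ cont_nonneg (fun s => complex.Im (M s i j))) ->
  cont_nonneg (fun s => tnr (M s)).
Proof.
move=> hM cM t /RleP t0 eps /RltP e0.
(* A kernel has [2 |I|^2] real coordinates; the successor keeps [eta] positive for empty [I] and
   makes the final inequality strict. *)
pose N := (2 * #|I| * #|I|).+1.
have kp : 0 < kI I by rewrite /kI ltr_pwDl // mulrn_wge0.
pose eta := eps / (kI I * N%:R).
have eta0 : 0 < eta by rewrite divr_gt0 // mulr_gt0 // ltr0n.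
have H : forall ij : I * I, exists d : R, 0 < d /\ forall s, 0 <= s -> `|s - t| < d ->
    `|complex.Re (M s ij.1 ij.2) - complex.Re (M t ij.1 ij.2)| < eta /\
    `|complex.Im (M s ij.1 ij.2) - complex.Im (M t ij.1 ij.2)| < eta.
  move=> [i j] /=; have [c1 c2] := cM i j.
  have /RleP t0' := t0; have /RltP eta0' := eta0.
  have [d1 [/RltP p1 q1]] := c1 t t0' eta eta0'; have [d2 [/RltP p2 q2]] := c2 t t0' eta eta0'.
  exists (Num.min d1 d2); split; first by rewrite lt_min p1.
  move=> s s0; rewrite lt_min => /andP[a b]; split.
    by have := q1 s; rewrite !RabsE => h; apply/RltP/h; [apply/RleP | apply/RltP].
  by have := q2 s; rewrite !RabsE => h; apply/RltP/h; [apply/RleP | apply/RltP].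
have [d hd] := boolp.choice H.
pose del := \big[Num.min/1]_ij d ij.
have del0 : 0 < del by apply: lt_bigmin => // ij _; case: (hd ij).
have dle ij : del <= d ij by apply: bigmin_le_cond.
exists del; split; first exact/RltP.
move=> s /RleP s0 /RltP; rewrite RabsE => sd; apply/RltP; rewrite RabsE.
apply: le_lt_trans (tnr_diff (hM s s0) (hM t t0)) _.
have sb : sabs (fun i j => M s i j - M t i j) <= (2 * #|I| * #|I|)%:R * eta.
  rewrite /sabs; apply: (@le_trans _ _ (\sum_(i : I) \sum_(j : I) (eta + eta))).
    apply: ler_sum => i _; apply: ler_sum => j _.
    have [_ /(_ s s0 (lt_le_trans sd (dle (i, j))))] := hd (i, j).
    case: (M s i j) => a b; case: (M t i j) => a' b' /= [h1 h2]; apply: lerD; exact: ltW.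
  rewrite !sumr_const -!mulrnA -mulr2n -mulrnA mulr_natl le_eqVlt; apply/orP; left; apply/eqP.
  by congr (_ *+ _); rewrite mulnA.
apply: le_lt_trans (ler_wpM2l (ltW kp) sb) _.
have -> : eps = kI I * (N%:R * eta) by rewrite /eta mulrA mulrCA divff ?mulr1 // mulf_neq0 ?pnatr_eq0 // lt0r_neq0.
by rewrite ltr_pM2l // ltr_pM2r // ltr_nat.
Qed.
End Curve.

(** * Relabelling matrix indices by tensor factors *)

Section Transport.
Variables (T : finType) (n : nat) (f : T -> 'I_n) (g : 'I_n -> T).
Hypotheses (fg : cancel f g) (gf : cancel g f).

Definition pullm (X : Mat) : T -> T -> RC := fun p q => toC (X (f p) (f q)).
Definition pushm (K : T -> T -> RC) : Mat := mof (fun i j => K (g i) (g j)).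

Lemma pushmK K : pullm (pushm K) = K.
Proof.
apply: kerext => p q; rewrite /pullm /pushm.
have := congr1 (fun h => h (f p) (f q)) (mofK (fun i j => K (g i) (g j))).
by rewrite /kof /= => ->; rewrite !fg.
Qed.

Lemma psd_pullm X : psd n X <-> psdk (pullm X).
Proof.
split=> [/psdP h|h]; first exact: (psdk_pull f h).
apply/psdP; have := psdk_pull g h; congr psdk.
by apply: kerext => i j; rewrite /pullm !gf.
Qed.

Lemma trk_pullm X : trk (pullm X) = toC (mtrace n X).
Proof.
rewrite -trk_kof /trk [RHS](reindex f) //; by apply: onW_bij; exists g.
Qed.

Lemma trace_norm_pullm X : hermk (pullm X) -> isTN (pullm X) (Complex (trace_norm n X) 0).
Proof.
move=> h; have hX : hermk (kof n X).
  by move=> i j; have := h (g i) (g j); rewrite /pullm !gf.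
exact: (isTN_reindex fg gf (trace_norm_isTN hX)).
Qed.
End Transport.

Definition kmap d (Phi : Map) (K : 'I_d -> 'I_d -> RC) : 'I_d -> 'I_d -> RC :=
  kof d (Phi (mof K)).

Lemma kmapE d Phi X : lin_map d Phi -> kof d (Phi X) = kmap Phi (kof d X).
Proof. by move=> [ext _]; apply/meqP; apply: ext; apply/meqP; rewrite mofK. Qed.

Lemma kmap_lin d Phi : lin_map d Phi -> linm (kmap (d := d) Phi).
Proof.
move=> lP a X Y; have [ext lin] := lP.
have := lin (ofC a) (mof X) (mof Y) => /meqP.
have -> : kof d (madd (Phi (mof X)) (mscale (ofC a) (Phi (mof Y)))) =
   (fun i j => kmap Phi X i j + a * kmap Phi Y i j).
  by apply: kerext => i j; rewrite /kof /madd /mscale toC_add toC_mul ofCK.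
move=> <-; rewrite kmapE //; congr kmap; apply: kerext => i j.
rewrite /kof /madd /mscale toC_add toC_mul ofCK.
by rewrite -[X in X i j + _](mofK X) -[Y in _ + _ * Y i j](mofK Y).
Qed.

Section Pairs.
Variables (d k : nat).

Fact pidx_lt (p : 'I_d * 'I_k) : (idx k p.1 p.2 < d * k)%N.
Proof. by apply/ssrnat.ltP; apply: idx_lt; apply/ssrnat.ltP. Qed.
Definition pidx p := Ordinal (pidx_lt p).

Lemma pidx_bij : bijective pidx.
Proof.
apply: inj_card_bij; last by rewrite card_prod !card_ord.
move=> [a b] [a' b'] /(congr1 val) /= e.
have lb : (b < k)%coq_nat by apply/ssrnat.ltP.
have lb' : (b' < k)%coq_nat by apply/ssrnat.ltP.
have ea : a = a' by apply: val_inj; rewrite /= -(idx_div k a b) // e idx_div.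
have eb : b = b' by apply: val_inj; rewrite /= -(idx_mod k a b) // e idx_mod.
by rewrite ea eb.
Qed.

Lemma pullm_liftA Phi X : lin_map d Phi ->
  pullm pidx (liftA k Phi X) = liftk (kmap Phi) (pullm pidx X).
Proof.
move=> lP; apply: kerext => -[a b] [a' b']; rewrite /pullm /liftk /=.
rewrite liftA_idx; try by apply/ssrnat.ltP.
have := kmapE (fun x x' => X (idx k x b) (idx k x' b')) lP.
by move/(congr1 (fun h => h a a')).
Qed.
End Pairs.

Lemma kmap_tp d Phi : trace_preserving d Phi -> tpm (kmap (d := d) Phi).
Proof. by move=> tp X; rewrite /kmap trk_kof tp -trk_kof mofK. Qed.

Lemma kmap_cp d Phi : lin_map d Phi -> completely_positive d Phi -> cpm (kmap (d := d) Phi).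
Proof.
(* [completely_positive] starts at dimension 1; an ancilla of dimension 0 leaves an empty kernel. *)
move=> lP cP [|n] X pX; first by move=> v; rewrite /qf big1 // => -[a []].
have [g fg gf] := pidx_bij d n.+1.
have := cP n.+1 (ssrnat.ltP (ltn0Sn n)) (pushm g X).
have e := pushmK fg X.
move=> H; have : psd (d * n.+1) (pushm g X) by apply/(psd_pullm gf); rewrite e.
by move/H/(psd_pullm gf); rewrite pullm_liftA // e.
Qed.

Definition mapm d (V : ('I_d -> 'I_d -> RC) -> 'I_d -> 'I_d -> RC) : Map :=
  fun X => mof (V (kof d X)).

Lemma kmap_mapm d V : kmap (d := d) (mapm V) = V.
Proof. by apply: funext => K; rewrite /kmap /mapm !mofK. Qed.

Lemma mapm_CPTP d V : linm V -> cpm V -> tpm V -> CPTP d (mapm (d := d) V).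
Proof.
move=> lV cV tV.
have lm : lin_map d (mapm V).
  split=> [X Y /meqP e|a X Y]; apply/meqP; first by rewrite /mapm e.
  rewrite /mapm mofK; have -> : kof d (madd X (mscale a Y)) = (fun i j => kof d X i j + toC a * kof d Y i j) by [].
  rewrite lV; apply: kerext => i j.
  transitivity (kof d (mof (V (kof d X))) i j + toC a * kof d (mof (V (kof d Y))) i j) => //.
  by rewrite !mofK.
split=> //; split.
  move=> n n1 X; have [g fg gf] := pidx_bij d n.
  move/(psd_pullm gf) => pX; apply/(psd_pullm gf).
  by rewrite pullm_liftA // kmap_mapm; apply: cV.
by move=> X; apply: toC_inj; rewrite -!trk_kof mofK tV.
Qed.

Section Quad.
Variables (d k : nat).
Notation T := (('I_d * 'I_k) * ('I_2 * 'I_2))%type.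

(** The factors are ordered as [A], ancilla, qubit of Bob, qubit [C], so that [liftA (k * 2 * 2)]
    acts on the first and [ptrans2 2] on the last. *)
Definition qidx (p : T) : nat := idx (k * 2 * 2) p.1.1 (idx 2 (idx 2 p.1.2 p.2.1) p.2.2).

Fact qidx_lt1 (p : T) : (idx 2 (idx 2 p.1.2 p.2.1) p.2.2 < k * 2 * 2)%coq_nat.
Proof. by apply: idx_lt; [apply: idx_lt|]; apply/ssrnat.ltP. Qed.

Fact qidx_lt (p : T) : (qidx p < d * (k * 2 * 2))%N.
Proof. apply/ssrnat.ltP; apply: idx_lt; [exact/ssrnat.ltP | exact: qidx_lt1]. Qed.
Definition qord p := Ordinal (qidx_lt p).

Lemma qord_bij : bijective qord.
Proof.
apply: inj_card_bij; last by rewrite !card_prod !card_ord !mulnA.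
move=> p q /(congr1 val) /= e.
have ea : p.1.1 = q.1.1.
  apply: val_inj; have := congr1 (fun i => Nat.div i (k * 2 * 2)) e.
  by rewrite /qidx (idx_div _ _ _ (qidx_lt1 p)) (idx_div _ _ _ (qidx_lt1 q)).
have er : idx 2 (idx 2 p.1.2 p.2.1) p.2.2 = idx 2 (idx 2 q.1.2 q.2.1) q.2.2.
  have := congr1 (fun i => Nat.modulo i (k * 2 * 2)) e.
  by rewrite /qidx (idx_mod _ _ _ (qidx_lt1 p)) (idx_mod _ _ _ (qidx_lt1 q)).
have l2 (i : 'I_2) : (i < 2)%coq_nat by apply/ssrnat.ltP.
have ec : p.2.2 = q.2.2 by apply: val_inj; rewrite /= -(idx_mod 2 (idx 2 p.1.2 p.2.1) p.2.2) // er idx_mod.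
have er2 : idx 2 p.1.2 p.2.1 = idx 2 q.1.2 q.2.1 by rewrite -(idx_div 2 (idx 2 p.1.2 p.2.1) p.2.2) // er idx_div.
have eb : p.1.2 = q.1.2 by apply: val_inj; rewrite /= -(idx_div 2 p.1.2 p.2.1) // er2 idx_div.
have ee : p.2.1 = q.2.1 by apply: val_inj; rewrite /= -(idx_mod 2 p.1.2 p.2.1) // er2 idx_mod.
case: p q ea ec eb ee {e er er2} => [[? ?] [? ?]] [[? ?] [? ?]] /= -> -> -> -> //.
Qed.

Lemma pullm_ptbell Phi X (G F : 'I_d * 'I_k -> 'I_d * 'I_k -> RC) :
  lin_map d Phi -> pullm qord X = bellst G F ->
  pullm qord (ptrans2 2 (liftA (k * 2 * 2) Phi X)) = ptbell (liftk (kmap Phi) G) (liftk (kmap Phi) F).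
Proof.
move=> lP eX; apply: kerext => -[[a b] [e c]] [[a' b'] [e' c']].
have l2 (i : 'I_2) : (i < 2)%coq_nat by apply/ssrnat.ltP.
(* The index is reassociated to expose [C] for [ptrans2], then back to expose [A] for [liftA]. *)
rewrite /pullm /= /qidx /= (idx_assoc (k * 2) 2 a (idx 2 b e) c) (idx_assoc (k * 2) 2 a' (idx 2 b' e') c').
rewrite ptrans2_idx // -(idx_assoc (k * 2) 2 a (idx 2 b e) c') -(idx_assoc (k * 2) 2 a' (idx 2 b' e') c).
have lt1 := qidx_lt1 ((a, b), (e, c')); have lt2 := qidx_lt1 ((a', b'), (e', c)); rewrite /= in lt1 lt2.
rewrite liftA_idx //.
set Y := fun x x' => X _ _.
have -> : toC (Phi Y a a') = kmap Phi (kof d Y) a a' by have := kmapE Y lP => /(congr1 (fun h => h a a')).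
have -> : kof d Y = (fun x x' => ((e == c') && (e' == c))%:R * (2%:R^-1 * (if c' == c then G (x, b) (x', b') else F (x, b) (x', b')))).
  apply: kerext => x x'; have := congr1 (fun h => h ((x, b), (e, c')) ((x', b'), (e', c))) eX.
  by rewrite /bellst /= => <-.
rewrite (linmZ _ _ (kmap_lin lP)) /= (linmZ _ _ (kmap_lin lP)) /ptbell /liftk /= [c == c']eq_sym.
by case: (c' == c).
Qed.
End Quad.

(** * Contractivity of an evolution without increase of negativity *)

Section Evolution.
Variables (d : nat) (Lam : R -> Map).
Hypothesis cptp : forall t, 0 <= t -> CPTP d (Lam t).
Hypothesis diff : differentiable_family d Lam.
Hypothesis noinc : ~ (exists (dB dC : nat) (rho : Mat),
    (1 <= dB)%coq_nat /\ (1 <= dC)%coq_nat /\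
    density (d * (dB * dC)) rho /\
    exists t l, Rlt 0 t /\ Rlt 0 l /\
      right_deriv
        (fun s => negativity (d * (dB * dC)) dC (liftA (dB * dC) (Lam s) rho))
        t l).

Let L s := kmap (d := d) (Lam s).
Lemma L_lin s : 0 <= s -> linm (L s). Proof. by move=> /cptp [l _]; apply: kmap_lin. Qed.
Lemma L_cp s : 0 <= s -> cpm (L s). Proof. by move=> /cptp [l [c _]]; apply: kmap_cp. Qed.
Lemma L_tp s : 0 <= s -> tpm (L s). Proof. by move=> /cptp [_ [_ t]]; apply: kmap_tp. Qed.
Lemma L_hp s : 0 <= s -> hpm (L s). Proof. by move=> h; apply: cpm_hpm (L_lin h) (L_cp h). Qed.

Lemma liftk_scale s (J : finType) c (F : 'I_d * J -> 'I_d * J -> RC) : 0 <= s ->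
  liftk (L s) (fun p q => c * F p q) = (fun p q => c * liftk (L s) F p q).
Proof. by move=> s0; apply: kerext => p q; rewrite /liftk (linmZ _ _ (L_lin s0)). Qed.

(** With the factor 1/2 in [F], the partial transpose of the evolved state has trace norm
    [1 + 2 tnr (liftk (L s) F)], so [tnr] is the negativity itself. Its right derivative exists by
    [tnr_right_deriv], and [noinc] forbids it to be positive. *)
Lemma curve_mono k (F : 'I_d * 'I_k.+1 -> 'I_d * 'I_k.+1 -> RC) (X Y : 'I_d * 'I_k.+1 -> 'I_d * 'I_k.+1 -> RC) :
  psdk X -> psdk Y -> trk X + trk Y = 1 -> (forall p q, F p q = 2^-1 * (X p q - Y p q)) ->
  forall s t, 0 <= s -> s <= t -> tnr (liftk (L t) F) <= tnr (liftk (L s) F).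
Proof.
move=> pX pY tXY eF.
have hF : hermk F.
  by move=> p q; rewrite !eF rmorphM rmorphB /= fmorphV /= conjC_nat -(psdk_herm pX) -(psdk_herm pY).
have hM s : 0 <= s -> hermk (liftk (L s) F) by move=> s0; apply: hermk_lift (L_hp s0) hF.
pose blk p q := mof (fun a a' : 'I_d => F (a, p) (a', q)).
have dM p q (t : R) : 0 < t -> exists l1 l2,
   right_deriv (fun s => complex.Re (liftk (L s) F p q)) t l1 /\
   right_deriv (fun s => complex.Im (liftk (L s) F p q)) t l2.
  move=> /RltP t0; case: p q => [a b] [a' b'].
  have la : (a < d)%coq_nat by apply/ssrnat.ltP.
  have la' : (a' < d)%coq_nat by apply/ssrnat.ltP.
  have [h _] := diff (blk b b') la la'; have [[l1 h1] [l2 h2]] := h t t0.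
  by exists l1, l2; split; apply: right_deriv_of_deriv.
have cM p q : cont_nonneg (fun s => complex.Re (liftk (L s) F p q)) /\
    cont_nonneg (fun s => complex.Im (liftk (L s) F p q)).
  case: p q => [a b] [a' b'].
  have la : (a < d)%coq_nat by apply/ssrnat.ltP.
  have la' : (a' < d)%coq_nat by apply/ssrnat.ltP.
  have [h [h1 h2]] := diff (blk b b') la la'.
  by split; apply: cont_nonneg_of_deriv => // t t0; have [] := h t t0.
have cT := tnr_cont hM cM.
have [g fg gf] := qord_bij d k.+1.
pose G := fun p q => X p q + Y p q; pose F2 := fun p q => X p q - Y p q.
pose rho := pushm g (bellst G F2).
have erho : pullm (@qord d k.+1) rho = bellst G F2 by apply: pushmK.
have den : density (d * (k.+1 * 2 * 2)) rho.
  split; first by apply/(psd_pullm gf); rewrite erho; apply: bellst_psd.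
  apply: toC_inj; rewrite -(trk_pullm fg gf) erho tr_bellst /G trkD tXY //.
have neg s : 0 <= s -> tnr (liftk (L s) F) =
    negativity (d * (k.+1 * 2 * 2)) 2 (liftA (k.+1 * 2 * 2) (Lam s) rho).
  move=> s0; have [lP _] := cptp s0.
  have eP := pullm_ptbell lP erho.
  have pG : psdk (liftk (L s) G) by apply: (L_cp s0); apply: psdkD.
  have F2E : F2 = (fun p q => Complex 2%:R 0 * F p q).
    apply: kerext => p q; rewrite eF.
    have -> : Complex 2%:R 0 = 2%:R :> RC by rewrite -[LHS]/((2%:R)%:C)%C rmorph_nat.
    by rewrite mulVKf // pnatr_eq0.
  have tF2 : isTN (liftk (L s) F2) (Complex (2%:R * tnr (liftk (L s) F)) 0).
    rewrite -(tnr_scale _ (hM s s0)) ?ltr0n // F2E liftk_scale //.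
    apply: tnrP => p q; rewrite rmorphM /= -(hM s s0 p q); congr (_ * _).
    by apply/eqP; rewrite eq_complex /= oppr0 !eqxx.
  have := isTN_ptbell pG tF2; rewrite -/(L s) in eP *; rewrite -eP => t1.
  have t2 := trace_norm_pullm fg gf (isTN_herm t1).
  have := isTN_uniq t1 t2; rewrite (tr_liftk G (L_tp s0)) /G trkD tXY => -[e _].
  rewrite /negativity -e !RdivE RminusE.
  by rewrite addrC addKr mulrAC (_ : IZR 2 = 2%:R) ?divff ?mul1r ?pnatr_eq0 //.
have rd (x : R) : Rlt 0 x -> exists l, right_deriv (fun s => tnr (liftk (L s) F)) x l /\ Rle l 0.
  move=> x0; have /RltP x0' := x0.
  have [|l hl] := @tnr_right_deriv _ (fun s => liftk (L s) F) x _ (fun p q => dM p q x x0').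
    by move=> s xs; apply: hM; apply: le_trans xs; apply: ltW.
  exists l; split=> //; apply: Rnot_lt_le => l0; apply: noinc.
  (* Bob holds the ancilla of dimension [k + 1] and one qubit of the Bell pair. *)
  exists (k.+1 * 2)%N, 2%N, rho; split; first by apply/ssrnat.leP.
  split; first by apply/ssrnat.leP.
  split; first exact: den.
  exists x, l; split=> //; split=> //.
  apply: (right_deriv_ext _ _ _ _ _ hl) => s /RleP xs; apply: neg.
  by apply: le_trans xs; apply: ltW.
move=> s t s0 st; apply/RleP.
by apply: (nonincreasing_of_right_deriv (fun s => tnr (liftk (L s) F)) _ _ cT rd); apply/RleP.
Qed.

(** [psdk_shift] writes [F] as a difference of two positive kernels, and division by their total
    trace makes them an admissible pair for [curve_mono]. Total trace 0 means [F = 0]; the empty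
    ancilla is treated apart. *)
Lemma L_contr s t : 0 <= s -> s <= t -> contr (L s) (L t).
Proof.
move=> s0 st; have t0 := le_trans s0 st.
move=> [|k] F a b hF ta tb.
  have z (M : 'I_d * 'I_0 -> 'I_d * 'I_0 -> RC) : psdk M by move=> v; rewrite /qf big1 // => -[? []].
  rewrite (isTN_uniq ta (isTN_psd (z _))) (isTN_uniq tb (isTN_psd (z _))).
  by rewrite /trk !big1 // => -[? []].
pose S := \sum_p \sum_q `|F p q|.
have S0 : 0 <= S by rewrite sumr_ge0 // => i _; rewrite sumr_ge0.
have pX := psdk_shift hF; rewrite -/S in pX.
have pY := @psdk1 _ ('I_d * 'I_k.+1)%type S S0.
set X := (fun i j => F i j + _) in pX; set Y := (fun i j => S * _) in pY.
have [T0|T0] := eqVneq (trk X + trk Y) 0.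
  move/eqP: T0; rewrite paddr_eq0 ?psdk_tr_ge0 // => /andP[/eqP x0 /eqP y0].
  have F0 : F = (fun p q => 0 * F p q).
    apply: kerext => p q; rewrite mul0r.
    have := psdk_tr0 pX x0 p q; have := psdk_tr0 pY y0 p q.
    by rewrite /X /Y => ->; rewrite addr0.
  have z u : 0 <= u -> isTN (liftk (L u) F) 0.
    move=> u0; rewrite F0 liftk_scale //.
    have -> : (fun p q => 0 * liftk (L u) F p q) = (fun _ _ => 0) by apply: kerext => p q; rewrite mul0r.
    rewrite -[X in isTN _ X](_ : trk (fun _ _ : 'I_d * 'I_k.+1 => 0 : RC) = 0); last by rewrite /trk big1.
    by apply: isTN_psd; apply: psdk0.
  by rewrite (isTN_uniq ta (z s s0)) (isTN_uniq tb (z t t0)).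
have Tp : 0 < trk X + trk Y by rewrite lt_def T0 addr_ge0 ?psdk_tr_ge0.
set c := (trk X + trk Y)^-1.
have c0 : 0 < c by rewrite invr_gt0.
have c20 : 0 < 2^-1 * c by rewrite mulr_gt0 // invr_gt0 ltr0n.
pose F' := fun p q => 2^-1 * c * F p q.
have m := @curve_mono k F' _ _ (psdkZ (ltW c0) pX) (psdkZ (ltW c0) pY).
have {}m : tnr (liftk (L t) F') <= tnr (liftk (L s) F').
  apply: m => //; first by rewrite (trkZ c X) (trkZ c Y) -mulrDr /c mulVf.
  by move=> p q; rewrite /F' /X /Y; ring.
have tF u e : 0 <= u -> isTN (liftk (L u) F) e -> Complex (tnr (liftk (L u) F')) 0 = 2^-1 * c * e.
  move=> u0 te; have := isTN_scale c20 te; rewrite -liftk_scale // => te'.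
  exact: isTN_uniq (tnrP (isTN_herm te')) te'.
have : Complex (tnr (liftk (L t) F')) 0 <= Complex (tnr (liftk (L s) F')) 0 :> RC.
  by rewrite lecE /= eqxx.
by rewrite (tF t b) // (tF s a) // ler_pM2l.
Qed.

Lemma markovian_of_no_increase : ((forall t, 0 <= t -> invertible_map d (Lam t)) \/ d = 2%N) -> markovian d Lam.
Proof.
move=> H s t /RleP s0 /RleP st; have t0 := le_trans s0 st.
have c := L_contr s0 st.
suff [V [lV cV tV VE]] : exists V, [/\ linm V, cpm V, tpm V & forall X, L t X = V (L s X)].
  exists (mapm V); split; first exact: mapm_CPTP.
  move=> X; apply/meqP; have [ls _] := cptp s0; have [lt _] := cptp t0.
  by rewrite /mapm mofK (kmapE _ ls) (kmapE _ lt) -VE.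
case: H => [inv|d2].
  have [G [lG [_ GE]]] := inv s s0; have [ls _] := cptp s0.
  apply: (ext_surj (L_lin s0) (L_lin t0) (L_hp s0) (L_hp t0) (L_tp s0) (L_tp t0) c (kmap_lin lG)).
  move=> X; rewrite -[RHS](mofK X); transitivity (kof d (Lam s (G (mof X)))).
    by rewrite (kmapE _ ls).
  exact/meqP.
have pB : psdk (L t (fun a b => 2^-1 * (a == b)%:R)).
  by apply: cpm_pos (L_cp t0) _; apply: psdk1; rewrite invr_ge0 ler0n.
have := L_lin s0; have := L_lin t0; have := L_hp s0; have := L_hp t0; have := L_tp s0; have := L_tp t0.
have := fun X => @cpm_pos _ _ _ X (L_cp s0).
move: (L s) (L t) c pB; rewrite d2 => A B c pB pos tB tA hB hA lB lA.
exact: (qubit_ext (@short_limit _) lA lB hA hB tA tB c pos pB).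
Qed.
End Evolution.

Lemma exists_increase (d : nat) (Lam : R -> Map) :
  (forall t, Rle 0 t -> CPTP d (Lam t)) ->
  differentiable_family d Lam ->
  ~ markovian d Lam ->
  ((forall t, Rle 0 t -> invertible_map d (Lam t)) \/ d = 2%N) ->
  exists (dB dC : nat) (rho : Mat),
    (1 <= dB)%coq_nat /\ (1 <= dC)%coq_nat /\
    density (d * (dB * dC)) rho /\
    exists t l, Rlt 0 t /\ Rlt 0 l /\
      right_deriv
        (fun s => negativity (d * (dB * dC)) dC (liftA (dB * dC) (Lam s) rho))
        t l.
Proof.
move=> cptp diff nm H; apply: contrapT => ne; apply: nm.
apply: (markovian_of_no_increase (d := d)) => //; first by move=> t /RleP; apply: cptp.
by case: H => [h|]; [left => t /RleP; apply: h | right].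
Qed.

End NegativityWitness.

Theorem theorem2 (d : nat) (Lam : R -> Map) :
  (2 <= d)%nat ->
  (forall t, 0 <= t -> CPTP d (Lam t)) ->
  (forall X, meq d (Lam 0 X) X) ->
  differentiable_family d Lam ->
  ~ markovian d Lam ->
  ((forall t, 0 <= t -> invertible_map d (Lam t)) \/ d = 2%nat) ->
  exists (dB dC : nat) (rho : Mat),
    (1 <= dB)%nat /\ (1 <= dC)%nat /\
    density (d * (dB * dC)) rho /\
    exists t l, 0 < t /\ 0 < l /\
      right_deriv
        (fun s => negativity (d * (dB * dC)) dC (liftA (dB * dC) (Lam s) rho))
        t l.
Proof.
  intros _ Hcptp _ Hdiff Hnm Hcase.
  exact (NegativityWitness.exists_increase Hcptp Hdiff Hnm Hcase).
Qed.
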